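(* For every ordinal $\alpha$, $\mathbf{o}(\Phi_\alpha)=\mathbf{w}(\Phi_\alpha)=\alpha$. Moreover, if $\alpha$ is infinite then $\mathbf{w}(\mathcal{P}_f(\Phi_\alpha))=\mathbf{o}(\mathcal{P}_f(\Phi_\alpha))=2^\alpha$, and if $\alpha=k<\omega$ then $\mathbf{o}(\mathcal{P}_f(\Phi_k))=2^k$ and $\mathbf{w}(\mathcal{P}_f(\Phi_k))=\mathbf{w}(\mathcal{P}_f(\Gamma_k))$.
   Context: A wqo is a quasi-order in which every infinite sequence has $i<j$ with $x_i\le x_j$. $\mathbf{o}(A),\mathbf{h}(A),\mathbf{w}(A)$ are the ranks of the roots of the well-founded trees of finite bad sequences, finite strictly decreasing sequences, and finite sequences of pairwise incomparable elements of $A$ (root: empty sequence, children: one-element extensions; rank $r(s)=\sup\{r(t)+1: t\text{ child of } s\}$). $\mathcal{P}_f(A)$ is the set of finite subsets of $A$ with the Hoare embedding: $S\le_H S'$ iff $\forall a\in S\,\exists b\in S'\; a\le b$. $\Gamma_k$ is a $k$-element antichain. For an ordinal-indexed family $(A_\gamma)_{\gamma<\delta}$ of wqos, the lexicographic sum $\sum_{\gamma<\delta}A_\gamma$ is their disjoint union where $x\le y$ iff either $x,y\in A_\gamma$ with $x\le_{A_\gamma} y$, or $x\in A_\gamma,y\in A_{\gamma'}$ with $\gamma<\gamma'$. The lexicographic product $A\cdot B$ is $A\times B$ with $(a,b)\le(a',b')$ iff $b\le_B b'$ and ($b\equiv_B b'$ implies $a\le_A a'$); $A_1\cdots A_n$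 is iterated. $A\sqcup B$ is the disjoint union with ordering $\le_A\cup\le_B$. Define: $\Phi_{\omega^0}=\Gamma_1$; $\Phi_{\omega^1}=\sum_{n<\omega}\Gamma_n$; for $\alpha>0$, $\Phi_{\omega^{\omega^\alpha}}=\sum_{\beta<\omega^\alpha}\Phi_{\omega^\beta}$; if $\alpha=\omega^{\alpha_1}+\dots+\omega^{\alpha_n}$ in Cantor normal form with $n>1$, $\Phi_{\omega^\alpha}=\Phi_{\omega^{\omega^{\alpha_1}}}\cdots\Phi_{\omega^{\omega^{\alpha_n}}}$ (lexicographic product). Finally, for an arbitrary ordinal $\alpha=\omega^{\alpha_1}+\dots+\omega^{\alpha_n}$ in Cantor normal form, $\Phi_\alpha=\Phi_{\omega^{\alpha_1}}\sqcup\dots\sqcup\Phi_{\omega^{\alpha_n}}$ (and $\Phi_0=\emptyset$). *)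

(* Defs.v *)
From Stdlib Require Import List Arith Lia Sorted.
From Stdlib Require Import Classical ClassicalEpsilon ProofIrrelevance.
Import ListNotations.

Set Implicit Arguments.

Record RS := mkRS { rcar :> Type; rrel : rcar -> rcar -> Prop }.

Definition iso (v w : RS) : Prop :=
  exists (f : v -> w) (g : w -> v),
    (forall x, g (f x) = x) /\ (forall y, f (g y) = y) /\
    (forall x y, rrel v x y <-> rrel w (f x) (f y)).

Definition seg (w : RS) (b : w) : RS :=
  @mkRS {x : rcar w | rrel w x b} (fun x y => rrel w (proj1_sig x) (proj1_sig y)).

Record WO := mkWO {
  wrs :> RS;
  wwf : well_founded (rrel wrs);
  wtrans : forall x y z, rrel wrs x y -> rrel wrs y z -> rrel wrs x z;
  wtotal : forall x y, rrel wrs x y \/ x = y \/ rrel wrs y x }.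

Definition Ord : Type := {P : WO -> Prop | exists w : WO, forall v, P v <-> iso w v}.

Definition rep (a : Ord) : WO :=
  proj1_sig (constructive_indefinite_description _ (proj2_sig a)).

Definition ltRS (v u : RS) : Prop := exists b : rcar u, iso v (seg u b).
Definition olt (a b : Ord) : Prop := ltRS (rep a) (rep b).
Definition ole (a b : Ord) : Prop := olt a b \/ a = b.

Lemma iso_trans (u v w : RS) : iso u v -> iso v w -> iso u w.
Proof.
  intros (f1 & g1 & H1 & H2 & H3) (f2 & g2 & K1 & K2 & K3).
  exists (fun x => f2 (f1 x)), (fun z => g1 (g2 z)); split; [|split].
  - intros x; rewrite K1; apply H1.
  - intros z; rewrite H2; apply K2.
  - intros x y; rewrite H3, K3; tauto.
Qed.

Lemma iso_seg (v w : RS) (f : v -> w) (g : w -> v) :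
  (forall x, g (f x) = x) -> (forall y, f (g y) = y) ->
  (forall x y, rrel v x y <-> rrel w (f x) (f y)) ->
  forall a, iso (seg v a) (seg w (f a)).
Proof.
  intros H1 H2 H3 a.
  unshelve eexists (fun x => exist _ (f (proj1_sig x)) _).
  { destruct x as [x hx]; simpl; apply H3; exact hx. }
  unshelve eexists (fun y => exist _ (g (proj1_sig y)) _).
  { destruct y as [y hy]; simpl; apply H3; rewrite H2; exact hy. }
  split; [|split].
  - intros [x hx]; simpl. apply eq_sig_hprop; [intros; apply proof_irrelevance|].
    simpl; apply H1.
  - intros [y hy]; simpl. apply eq_sig_hprop; [intros; apply proof_irrelevance|].
    simpl; apply H2.
  - intros [x hx] [y hy]; simpl; apply H3.
Qed.

Lemma seg_seg (w : WO) (b : w) (c : seg w b) :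
  iso (seg (seg w b) c) (seg w (proj1_sig c)).
Proof.
  destruct c as [c hc]; simpl.
  unshelve eexists (fun x => exist _ (proj1_sig (proj1_sig x)) _).
  { destruct x as [[x hx] hxc]; exact hxc. }
  unshelve eexists (fun y => exist _ (exist _ (proj1_sig y) _) _).
  { destruct y as [y hy]; simpl; exact (wtrans w _ _ _ hy hc). }
  { destruct y as [y hy]; exact hy. }
  split; [|split].
  - intros [[x hx] hxc]; simpl.
    apply eq_sig_hprop; [intros; apply proof_irrelevance|].
    apply eq_sig_hprop; [intros; apply proof_irrelevance|]. reflexivity.
  - intros [y hy]; simpl. apply eq_sig_hprop; [intros; apply proof_irrelevance|].
    reflexivity.
  - intros [[x hx] hxc] [[y hy] hyc]; simpl; tauto.
Qed.

Lemma acc_seg (w : WO) (b : w) : forall v : RS, iso v (seg w b) -> Acc ltRS v.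
Proof.
  induction b as [b IH] using (well_founded_induction (wwf w)).
  intros v Hv; constructor; intros u [a Ha].
  destruct Hv as (f & g & H1 & H2 & H3).
  apply (IH (proj1_sig (f a)) (proj2_sig (f a))).
  eapply iso_trans; [exact Ha|].
  eapply iso_trans; [exact (@iso_seg _ _ f g H1 H2 H3 a)|].
  apply seg_seg.
Qed.

Lemma olt_wf : well_founded olt.
Proof.
  intros a.
  assert (H : forall v : RS, Acc ltRS v -> forall a, wrs (rep a) = v -> Acc olt a).
  { intros v Hv; induction Hv as [v _ IH]; intros a0 Ha0; constructor.
    intros c Hc; unfold olt in Hc; rewrite Ha0 in Hc.
    exact (IH _ Hc c eq_refl). }
  apply (H (rep a)); [|reflexivity].
  constructor; intros u [b Hb]; exact (@acc_seg _ b u Hb).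
Qed.

Definition emptyRS : RS := @mkRS Empty_set (fun _ _ => False).
Definition oneRS : RS := @mkRS unit (fun _ _ => False).
Definition natRS : RS := @mkRS nat lt.
Definition finRS (k : nat) : RS :=
  @mkRS {n : nat | n < k} (fun x y => proj1_sig x < proj1_sig y).

Definition sumRS (v w : RS) : RS :=
  @mkRS (rcar v + rcar w)%type (fun x y =>
    match x, y with
    | inl a, inl b => rrel v a b
    | inr a, inr b => rrel w a b
    | inl _, inr _ => True
    | inr _, inl _ => False
    end).

Definition sumList (l : list RS) : RS := fold_right sumRS emptyRS l.

(** Finite-support functions [w -> D] ordered by comparing at the largest
    point of difference (Cantor's construction of ordinal exponentiation
    [D^w]); [d0] is the least element of [D]. *)
Definition antilexRS (w : RS) (D : RS) (d0 : D) : RS :=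
  @mkRS {f : rcar w -> rcar D | exists l : list (rcar w), forall x, f x <> d0 -> In x l}
    (fun f g => exists x, rrel D (proj1_sig f x) (proj1_sig g x) /\
                 forall y, rrel w x y -> proj1_sig f y = proj1_sig g y).

Definition boolRS : RS := @mkRS bool (fun a b => a = false /\ b = true).

Definition emptyWO : WO.
Proof.
  refine (@mkWO emptyRS _ _ _).
  - intros x; destruct x.
  - intros x; destruct x.
  - intros x; destruct x.
Defined.

Definition class (w : WO) : Ord :=
  exist _ (fun v : WO => iso w v) (ex_intro _ w (fun v : WO => iff_refl _)).

Definition ozero : Ord := class emptyWO.

(** The ordinal whose order type is that of [r] (when [r] is a
    well-order; otherwise an unspecified ordinal). *)
Definition ordOf (r : RS) : Ord :=
  epsilon (inhabits ozero) (fun a => iso (rep a) r).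

Definition osucc (a : Ord) : Ord := ordOf (sumRS (rep a) oneRS).
Definition ordnat (k : nat) : Ord := ordOf (finRS k).
Definition omega : Ord := ordOf natRS.
Definition opow (a : Ord) : Ord := ordOf (@antilexRS (rep a) natRS 0).
Definition pow2 (a : Ord) : Ord := ordOf (@antilexRS (rep a) boolRS false).

Definition IsCNF (a : Ord) (l : list Ord) : Prop :=
  Sorted (fun x y => ole y x) l /\
  iso (rep a) (sumList (map (fun b => wrs (rep (opow b))) l)).

Definition cnf (a : Ord) : list Ord := epsilon (inhabits nil) (IsCNF a).

Record QO := mkQO { qcar :> Type; qle : qcar -> qcar -> Prop }.

Definition QEmpty : QO := @mkQO Empty_set (fun _ _ => True).

Definition Gamma (k : nat) : QO := @mkQO {n : nat | n < k} (fun x y => x = y).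

Definition LexSum (I : Type) (ltI : I -> I -> Prop) (F : I -> QO) : QO :=
  @mkQO {i : I & qcar (F i)} (fun x y =>
    (exists e : projT1 x = projT1 y,
        qle (F (projT1 y)) (eq_rect _ (fun i => qcar (F i)) (projT2 x) _ e) (projT2 y))
    \/ ltI (projT1 x) (projT1 y)).

Definition LexProd (A B : QO) : QO :=
  @mkQO (qcar A * qcar B)%type (fun x y =>
    qle B (snd x) (snd y) /\
    ((qle B (snd x) (snd y) /\ qle B (snd y) (snd x)) -> qle A (fst x) (fst y))).

Definition DUnion (A B : QO) : QO :=
  @mkQO (qcar A + qcar B)%type (fun x y =>
    match x, y with
    | inl a, inl b => qle A a b
    | inr a, inr b => qle B a b
    | _, _ => False
    end).

Definition Pf (A : QO) : QO :=
  @mkQO {S : qcar A -> Prop | exists l : list (qcar A), forall x, S x <-> In x l}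
    (fun S T => forall a, proj1_sig S a -> exists b, proj1_sig T b /\ qle A a b).

(** Recursive call guarded by [b < a] (always true where used). *)
Definition callF (a : Ord) (F : forall b, olt b a -> QO) (b : Ord) : QO :=
  match excluded_middle_informative (olt b a) with
  | left p => F b p
  | right _ => QEmpty
  end.

(** [PhiOmega a] is [Phi_{omega^a}]. *)
Definition PhiOmega_body (a : Ord) (F : forall b, olt b a -> QO) : QO :=
  match cnf a with
  | nil => Gamma 1
  | [a1] =>
      match excluded_middle_informative (a1 = ozero) with
      | left _ => @LexSum nat lt Gamma
      | right _ =>
          @LexSum {b : Ord | olt b a}
            (fun x y => olt (proj1_sig x) (proj1_sig y))
            (fun x => F (proj1_sig x) (proj2_sig x))
      end
  | a1 :: a2 :: t =>
      fold_left (fun P c => LexProd P (callF F (opow c)))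
        (a2 :: t) (callF F (opow a1))
  end.

Definition PhiOmega : Ord -> QO := Fix olt_wf (fun _ => QO) PhiOmega_body.

Definition Phi (a : Ord) : QO := fold_right DUnion QEmpty (map PhiOmega (cnf a)).

Definition bad (A : QO) (s : list (qcar A)) : Prop :=
  forall i j x y, i < j -> nth_error s i = Some x -> nth_error s j = Some y ->
    ~ qle A x y.

Definition antichain (A : QO) (s : list (qcar A)) : Prop :=
  forall i j x y, i <> j -> nth_error s i = Some x -> nth_error s j = Some y ->
    ~ qle A x y.

Definition IsSup (S : Ord -> Prop) (a : Ord) : Prop :=
  (forall b, S b -> ole b a) /\ (forall c, (forall b, S b -> ole b c) -> ole a c).

(** The tree whose nodes are the sequences satisfying [node] (root: the
    empty sequence; children: one-element extensions) has root rank [a]: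
    there is a rank function [r] with [r s = sup {r t + 1 : t child of s}]. *)
Definition HasRank (A : QO) (node : list (qcar A) -> Prop) (a : Ord) : Prop :=
  exists r : list (qcar A) -> Ord, r nil = a /\
    forall s, node s ->
      IsSup (fun g => exists x, node (s ++ [x]) /\ g = osucc (r (s ++ [x]))) (r s).

Definition oRank (A : QO) (a : Ord) : Prop := HasRank A (@bad A) a.
Definition wRank (A : QO) (a : Ord) : Prop := HasRank A (@antichain A) a.

(* Main.v *)
(** Both ranks of a tree of sequences depend only on residuals: after playing [x],
    the tree of bad sequences (antichains) in [S] is that of the elements of [S] not
    above (incomparable to) [x]. As antichains are bad sequences, [w <= o], so it is
    enough to bound [o] from above and [w] from below by the same ordinal. Ranks are
    computed with Cantor normal forms, coded as finite-support functions to [nat];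
    pointwise addition is then the natural sum, under which [o] is subadditive on
    unions and [w] superadditive on mutually incomparable parts. This gives
    [o = w = omega^a] on the blocks, a lexicographic product being played one copy of
    its left factor at a time.

    For the powerset, [T] fails to be above [s] iff [T] avoids the up-set of some
    [x] in [s]. Hence [o(Pf S)] is bounded through a finite natural sum of the
    [2^o(S_x)], which stays below [2^o(S)] at limits; at successors one residual
    [S_x] misses only [x] up to equivalence, and the bound doubles.

    For the lower bound, an antichain [x_1, ..., x_n] with residual [S'] yields [n]
    incomparable copies [{T + x_i : T in S'}] of [Pf S'], so
    [w(S) >= lam] implies [w(Pf S) >= 2^lam] for [lam] limit. With [k] extra isolated
    points there are [2^k] copies of [Pf S], one for each set [U] of extra points.
    Taking larger [U] first, a copy is exhausted below a point [z], after which all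
    sets of the remaining copies are required to contain [z]; since the blocks of
    infinite type keep their full width outside the down-set of a point, this
    realises [2^lam * 2^k]. *)

From Stdlib Require Import List Arith Lia Sorted.
From Stdlib Require Import Classical ClassicalEpsilon ProofIrrelevance.
From Stdlib Require Import FunctionalExtensionality PropExtensionality.
Require Import Defs.
Import ListNotations.

Set Implicit Arguments.

(** A natural sum over [Ord] is a function on a type one universe above the carriers of the
    well-orders classed by [Ord], so the order of natural sums cannot be taken as a representative
    of an ordinal. Bounds are therefore proved in an arbitrary value order and carried over to [Ord]
    by [bis]. Two sets of exponents occur. For Phi_alpha they are all ordinals. For the powerset
    they are the ordinals that are zero or limit: since 2^(omega*gamma + k) = omega^gamma * 2^k, and
    gamma to omega*gamma lists [Lim] in increasing order, [single l (2 ^ k)] stands for 2^(l + k)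
    and no division by omega is needed. The obstacle in the lower bound for alpha = lam + k is that
    a play inside one copy must not destroy the width needed by the others. A lower bound on w(S)
    does not tell what is left once a down-set is removed; [Cond] is the stronger invariant that
    does, asked for every number of repetitions and carried through each construction of Phi
    together with the two rank bounds. *)

(** * Strict well-orders *)

Record swo (T : Type) (lt : T -> T -> Prop) : Prop := {
  swo_wf : well_founded lt;
  swo_trans : forall x y z, lt x y -> lt y z -> lt x z;
  swo_total : forall x y, lt x y \/ x = y \/ lt y x }.

Lemma wf_irrefl (T : Type) (lt : T -> T -> Prop) :
  well_founded lt -> forall x, ~ lt x x.
Proof.
  intros wf x. induction x as [x IH] using (well_founded_induction wf).
  intros h; exact (IH x h h).
Qed.

Lemma wf_min (T : Type) (lt : T -> T -> Prop) (P : T -> Prop) :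
  well_founded lt -> (exists x, P x) -> exists m, P m /\ forall y, lt y m -> ~ P y.
Proof.
  intros wf [x Px]. apply NNPP; intros hn.
  induction x as [x IH] using (well_founded_induction wf).
  apply hn; exists x; split; [exact Px|]. intros y hy Py; exact (IH y hy Py).
Qed.

Lemma swo_not_lt (T : Type) (lt : T -> T -> Prop) : swo lt ->
  forall x y, ~ lt x y <-> (lt y x \/ y = x).
Proof.
  intros W x y; split.
  - intros h; destruct (swo_total W x y) as [h'|[->|h']]; tauto.
  - intros [h|<-] h'.
    + exact (wf_irrefl (swo_wf W) _ (swo_trans W _ _ _ h h')).
    + exact (wf_irrefl (swo_wf W) _ h').
Qed.

Lemma mono_inflationary (T : Type) (lt : T -> T -> Prop) (f : T -> T) : swo lt ->
  (forall x y, lt x y -> lt (f x) (f y)) -> forall x, ~ lt (f x) x.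
Proof.
  intros W hf x. induction x as [x IH] using (well_founded_induction (swo_wf W)).
  intros h; exact (IH _ h (hf _ _ h)).
Qed.

(** * Comparing well-orders *)

(** [bis x y] says that the initial segments below [x] and [y] have the same
    order type; unlike [iso] it relates well-orders in different universes. *)
Inductive bis (A B : Type) (ltA : A -> A -> Prop) (ltB : B -> B -> Prop)
    (x : A) (y : B) : Prop :=
  bis_intro :
    (forall x', ltA x' x -> exists y', ltB y' y /\ bis ltA ltB x' y') ->
    (forall y', ltB y' y -> exists x', ltA x' x /\ bis ltA ltB x' y') ->
    bis ltA ltB x y.

Lemma bis_fwd (A B : Type) (ltA : A -> A -> Prop) (ltB : B -> B -> Prop) x y :
  bis ltA ltB x y -> forall x', ltA x' x -> exists y', ltB y' y /\ bis ltA ltB x' y'.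
Proof. intros [h _]; exact h. Qed.

Lemma bis_bwd (A B : Type) (ltA : A -> A -> Prop) (ltB : B -> B -> Prop) x y :
  bis ltA ltB x y -> forall y', ltB y' y -> exists x', ltA x' x /\ bis ltA ltB x' y'.
Proof. intros [_ h]; exact h. Qed.

Section Bis.
Variables (A B : Type) (ltA : A -> A -> Prop) (ltB : B -> B -> Prop).
Hypothesis WA : swo ltA.
Hypothesis WB : swo ltB.
Notation bisAB := (bis ltA ltB).

Lemma bis_mono x y x' y' : bisAB x y -> bisAB x' y' -> ltA x x' -> ltB y y'.
Proof.
  revert y x' y'. induction x as [x IH] using (well_founded_induction (swo_wf WA)).
  intros y x' y' h h' hx. destruct (swo_total WB y y') as [hy|hy]; [exact hy|exfalso].
  destruct (bis_fwd h' _ hx) as (y1 & hy1 & h1).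
  assert (hy2 : ltB y1 y).
  { destruct hy as [->|hy]; [exact hy1|exact (swo_trans WB _ _ _ hy1 hy)]. }
  destruct (bis_bwd h _ hy2) as (x2 & hx2 & h2).
  exact (wf_irrefl (swo_wf WB) _ (IH x2 hx2 y1 x y1 h2 h1 hx2)).
Qed.

Lemma bis_mono_inv x y x' y' : bisAB x y -> bisAB x' y' -> ltB y y' -> ltA x x'.
Proof.
  intros h h' hy. destruct (bis_bwd h' _ hy) as (x1 & hx1 & h1).
  destruct (swo_total WA x x') as [hx|[->|hx]]; [exact hx| |]; exfalso.
  - exact (wf_irrefl (swo_wf WB) _ (bis_mono h1 h hx1)).
  - exact (wf_irrefl (swo_wf WB) _ (swo_trans WB _ _ _ hy (bis_mono h' h hx))).
Qed.

Lemma bis_fun x y y' : bisAB x y -> bisAB x y' -> y = y'.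
Proof.
  intros h h'. destruct (swo_total WB y y') as [hy|[hy|hy]]; [|exact hy|].
  - destruct (wf_irrefl (swo_wf WA) _ (bis_mono_inv h h' hy)).
  - destruct (wf_irrefl (swo_wf WA) _ (bis_mono_inv h' h hy)).
Qed.

Lemma bis_inj x x' y : bisAB x y -> bisAB x' y -> x = x'.
Proof.
  intros h h'. destruct (swo_total WA x x') as [hx|[hx|hx]]; [|exact hx|].
  - destruct (wf_irrefl (swo_wf WB) _ (bis_mono h h' hx)).
  - destruct (wf_irrefl (swo_wf WB) _ (bis_mono h' h hx)).
Qed.

(** If both failed, the least [x] and the least [y] without a partner would be partners: every
    predecessor of either has one, and if that partner were not below, [y] (or [x]) would have a
    partner as well. *)
Lemma bis_compare : (forall x, exists y, bisAB x y) \/ (forall y, exists x, bisAB x y).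
Proof.
  apply NNPP; intros hn. apply not_or_and in hn; destruct hn as [h1 h2].
  apply not_all_ex_not in h1; apply not_all_ex_not in h2.
  destruct (wf_min _ (swo_wf WA) h1) as (x & hx & mx).
  destruct (wf_min _ (swo_wf WB) h2) as (y & hy & my).
  apply hx; exists y; constructor.
  - intros x' hx'. destruct (NNPP _ (mx _ hx')) as [y' h].
    exists y'; split; [|exact h].
    destruct (swo_total WB y' y) as [h'|[->|h']]; [exact h'| |]; exfalso.
    + apply hy; exists x'; exact h.
    + destruct (bis_bwd h _ h') as (x'' & _ & h''). apply hy; exists x''; exact h''.
  - intros y' hy'. destruct (NNPP _ (my _ hy')) as [x' h].
    exists x'; split; [|exact h].
    destruct (swo_total WA x' x) as [h'|[->|h']]; [exact h'| |]; exfalso.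
    + apply hx; exists y'; exact h.
    + destruct (bis_fwd h _ h') as (y'' & _ & h''). apply hx; exists y''; exact h''.
Qed.

End Bis.

(** The order type of [A] is named by a point [v] of a possibly much larger order, so that elements
    of [Ord] and natural sums can denote ordinals alike. *)
Definition otype (A V : Type) (ltA : A -> A -> Prop) (ltV : V -> V -> Prop) (v : V) : Prop :=
  exists f : A -> V, (forall x y, ltA x y -> ltV (f x) (f y)) /\
                     (forall u, ltV u v <-> exists x, f x = u).

Lemma otype_bis (A V V' : Type) (ltA : A -> A -> Prop) (ltV : V -> V -> Prop)
    (ltV' : V' -> V' -> Prop) (v : V) (v' : V') :
  swo ltA -> swo ltV -> swo ltV' -> otype ltA ltV v -> otype ltA ltV' v' -> bis ltV ltV' v v'.
Proof.
  intros WA WV WV' (f & hf & If) (g & hg & Ig).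
  assert (hlt : forall (U : Type) (ltU : U -> U -> Prop) (k : A -> U), swo ltU ->
      (forall x y, ltA x y -> ltU (k x) (k y)) -> forall x y, ltU (k x) (k y) -> ltA x y).
  { intros U ltU k WU hk x y h. destruct (swo_total WA x y) as [h'|[->|h']]; [exact h'| |]; exfalso.
    - exact (wf_irrefl (swo_wf WU) _ h).
    - exact (wf_irrefl (swo_wf WU) _ (swo_trans WU _ _ _ h (hk _ _ h'))). }
  assert (H : forall x, bis ltV ltV' (f x) (g x)).
  { intros x; induction x as [x IH] using (well_founded_induction (swo_wf WA)).
    constructor.
    - intros u hu. destruct (proj1 (If u)) as [x' <-].
      { apply (swo_trans WV _ _ _ hu). apply If; exists x; reflexivity. }
      apply (hlt _ _ _ WV hf) in hu. exists (g x'); split; [apply hg, hu|apply IH, hu].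
    - intros u hu. destruct (proj1 (Ig u)) as [x' <-].
      { apply (swo_trans WV' _ _ _ hu). apply Ig; exists x; reflexivity. }
      apply (hlt _ _ _ WV' hg) in hu. exists (f x'); split; [apply hf, hu|apply IH, hu]. }
  constructor.
  - intros u hu. apply If in hu; destruct hu as [x <-]. exists (g x); split; [|apply H].
    apply Ig; exists x; reflexivity.
  - intros u hu. apply Ig in hu; destruct hu as [x <-]. exists (f x); split; [|apply H].
    apply If; exists x; reflexivity.
Qed.

Lemma iso_sym (v w : RS) : iso v w -> iso w v.
Proof.
  intros (f & g & h1 & h2 & h3). exists g, f; repeat split; auto.
  - intros h; apply h3; rewrite !h2; exact h.
  - intros h; apply h3 in h; rewrite !h2 in h; exact h.
Qed.

Lemma iso_of_mono_surj (v w : RS) (f : v -> w) : swo (rrel v) -> swo (rrel w) ->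
  (forall x y, rrel v x y -> rrel w (f x) (f y)) -> (forall y, exists x, f x = y) -> iso v w.
Proof.
  intros Wv Ww hf hs.
  assert (inj : forall x y, f x = f y -> x = y).
  { intros x y e; destruct (swo_total Wv x y) as [h|[h|h]]; [|exact h|]; apply hf in h;
      rewrite e in h; destruct (wf_irrefl (swo_wf Ww) _ h). }
  destruct (choice (fun y x => f x = y) hs) as [g hg].
  exists f, g; split; [|split].
  - intros x; apply inj, hg.
  - exact hg.
  - intros x y; split; [apply hf|]. intros h.
    destruct (swo_total Wv x y) as [h'|[->|h']]; [exact h'| |].
    + destruct (wf_irrefl (swo_wf Ww) _ h).
    + destruct (wf_irrefl (swo_wf Ww) _ (swo_trans Ww _ _ _ h (hf _ _ h'))).
Qed.

Lemma otype_iso (v w : RS) (V : Type) (ltV : V -> V -> Prop) (c : V) :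
  iso v w -> otype (rrel w) ltV c -> otype (rrel v) ltV c.
Proof.
  intros (f & g & h1 & h2 & h3) (k & hk & Ik). exists (fun x => k (f x)); split.
  - intros x y h; apply hk, h3, h.
  - intros u; rewrite Ik; split; intros [x <-].
    + exists (g x); rewrite h2; reflexivity.
    + exists (f x); reflexivity.
Qed.

Lemma WO_swo (w : WO) : swo (rrel w).
Proof. destruct w as [w h1 h2 h3]; split; assumption. Qed.

Definition swoWO (r : RS) (W : swo (rrel r)) : WO :=
  mkWO r (swo_wf W) (swo_trans W) (swo_total W).

(** * The class of ordinals *)

Lemma rep_spec (a : Ord) : forall v, proj1_sig a v <-> iso (rep a) v.
Proof. unfold rep. destruct (constructive_indefinite_description _ (proj2_sig a)) as [w h]; exact h. Qed.

Lemma iso_refl (v : RS) : iso v v.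
Proof. exists (fun x => x), (fun x => x); repeat split; auto. Qed.

(** An ordinal is the predicate of one isomorphism class, so isomorphic representatives give
    extensionally equal predicates. *)
Lemma ord_eq (a b : Ord) : iso (rep a) (rep b) -> a = b.
Proof.
  intros h. apply eq_sig_hprop; [intros; apply proof_irrelevance|].
  apply functional_extensionality; intros v; apply propositional_extensionality.
  rewrite !rep_spec. split; intros h'.
  - exact (iso_trans (iso_sym h) h').
  - exact (iso_trans h h').
Qed.

Lemma rep_class (w : WO) : iso (rep (class w)) w.
Proof. apply rep_spec. simpl. apply iso_refl. Qed.

Lemma rep_ordOf (r : RS) : swo (rrel r) -> iso (rep (ordOf r)) r.
Proof.
  intros W. unfold ordOf. apply epsilon_spec. exists (class (swoWO r W)).
  exact (rep_class (swoWO r W)).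
Qed.

Lemma seg_swo (w : WO) (b : w) : swo (rrel (seg w b)).
Proof.
  pose proof (WO_swo w) as W. split.
  - intros [x hx]. revert hx. induction x as [x IH] using (well_founded_induction (wwf w)).
    intros hx; constructor; intros [y hy] h; simpl in h. apply IH, h.
  - intros [x hx] [y hy] [z hz]; simpl. apply (wtrans w).
  - intros [x hx] [y hy]; simpl.
    destruct (swo_total W x y) as [h|[h|h]]; auto. right; left.
    apply eq_sig_hprop; [intros; apply proof_irrelevance|exact h].
Qed.

Lemma ltRS_iso_seg (v : RS) (w : WO) (c : w) (u : RS) :
  ltRS v u -> iso u (seg w c) -> exists d : w, rrel w d c /\ iso v (seg w d).
Proof.
  intros [b hb] (f & g & h1 & h2 & h3). exists (proj1_sig (f b)); split.
  - exact (proj2_sig (f b)).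
  - eapply iso_trans; [exact hb|]. eapply iso_trans; [exact (iso_seg _ _ f g h1 h2 h3 b)|].
    apply seg_seg.
Qed.

Lemma olt_trans (a b c : Ord) : olt a b -> olt b c -> olt a c.
Proof.
  intros h [z hz]. destruct (ltRS_iso_seg (rep c) h hz) as (d & _ & hd). exists d; exact hd.
Qed.

Lemma olt_total (a b : Ord) : olt a b \/ a = b \/ olt b a.
Proof.
  assert (H : forall a b : Ord, (forall x, exists y, bis (rrel (rep a)) (rrel (rep b)) x y) ->
             olt a b \/ a = b).
  { clear; intros a b h. set (A := rep a) in *; set (B := rep b) in *.
    pose proof (WO_swo A) as WA; pose proof (WO_swo B) as WB.
    destruct (choice _ h) as [f hf].
    assert (mf : forall x y, rrel A x y -> rrel B (f x) (f y)).
    { intros x y hxy; exact (bis_mono WA WB (hf x) (hf y) hxy). }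
    (* The image of [f] is downward closed. Either it misses a least point [y], and then [A] is
       isomorphic to the segment below [y], or [f] is onto. *)
    destruct (classic (exists y, ~ exists x, f x = y)) as [hy|hy].
    - destruct (wf_min _ (swo_wf WB) hy) as (y & ny & my). left; exists y.
      assert (fy : forall x, rrel B (f x) y).
      { intros x; destruct (swo_total WB (f x) y) as [k|[k|k]]; [exact k| |]; exfalso; apply ny.
        - exists x; exact k.
        - destruct (bis_bwd (hf x) _ k) as (x' & _ & k'). exists x'.
          exact (bis_fun WA WB (hf x') k'). }
      apply (iso_of_mono_surj A (seg B y) (fun x => exist _ (f x) (fy x))).
      + exact WA.
      + apply seg_swo.
      + exact mf.
      + intros [z hz]. destruct (NNPP _ (my z hz)) as [x <-]. exists x.
        apply eq_sig_hprop; [intros; apply proof_irrelevance|reflexivity].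
    - right. apply ord_eq. apply (iso_of_mono_surj A B f WA WB mf).
      intros y; apply NNPP; intros k; apply hy; exists y; exact k. }
  destruct (bis_compare (WO_swo (rep a)) (WO_swo (rep b))) as [h|h].
  - destruct (H a b h); auto.
  - assert (h' : forall x, exists y, bis (rrel (rep b)) (rrel (rep a)) x y).
    { assert (S : forall x y, bis (rrel (rep a)) (rrel (rep b)) x y -> bis (rrel (rep b)) (rrel (rep a)) y x).
      { intros x; induction x as [x IH] using (well_founded_induction (wwf (rep a))).
        intros y [k1 k2]; constructor.
        - intros y' hy'. destruct (k2 y' hy') as (x' & hx' & k). exists x'; split; auto.
        - intros x' hx'. destruct (k1 x' hx') as (y' & hy' & k). exists y'; split; auto. }
      intros x; destruct (h x) as [y hy]; exists y; apply S, hy. }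
    destruct (H b a h') as [k|k]; auto.
Qed.

Lemma olt_swo : swo olt.
Proof. split; [exact olt_wf|exact olt_trans|exact olt_total]. Qed.

Lemma olt_irrefl (a : Ord) : ~ olt a a.
Proof. apply wf_irrefl, olt_wf. Qed.

(** Each point of the representative is sent to the ordinal of its own segment. *)
Lemma otype_rep (a : Ord) : otype (rrel (rep a)) olt a.
Proof.
  pose (e := fun x : rep a => class (swoWO (seg (rep a) x) (seg_swo (rep a) x))).
  assert (he : forall x, iso (rep (e x)) (seg (rep a) x)).
  { intros x; exact (rep_class (swoWO _ (seg_swo (rep a) x))). }
  exists e; split.
  - intros x y h. destruct (he y) as (f & g & h1 & h2 & h3).
    pose (sx := exist _ x h : seg (rep a) y).
    exists (g sx). eapply iso_trans; [apply he|].
    apply (@iso_trans _ (seg (seg (rep a) y) sx)).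
    + apply iso_sym. apply seg_seg.
    + apply (iso_seg _ _ g f h2 h1). intros u v; rewrite h3, !h2; tauto.
  - intros b; split.
    + intros [x hx]. exists x. apply ord_eq. exact (iso_trans (he x) (iso_sym hx)).
    + intros [x <-]. exists x; apply he.
Qed.

Lemma bis_of_otype (r : RS) (a : Ord) (V : Type) (ltV : V -> V -> Prop) (v : V) :
  swo ltV -> iso (rep a) r -> otype (rrel r) ltV v -> bis ltV olt v a.
Proof.
  intros WV hi ho. apply (@otype_bis (rep a) V Ord (rrel (rep a)) ltV olt v a (WO_swo _) WV olt_swo).
  - exact (otype_iso hi ho).
  - apply otype_rep.
Qed.

Arguments bis_of_otype [r a V ltV v].

Lemma ozero_le (a : Ord) : ~ olt a ozero.
Proof.
  intros [x _]. destruct (rep_class emptyWO) as (f & _). destruct (f x).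
Qed.

Lemma ozero_lt (a : Ord) : a <> ozero -> olt ozero a.
Proof.
  intros h; destruct (olt_total ozero a) as [k|[k|k]]; [exact k| |].
  - destruct (h (eq_sym k)).
  - destruct (ozero_le k).
Qed.

Lemma sum_swo (v w : RS) : swo (rrel v) -> swo (rrel w) -> swo (rrel (sumRS v w)).
Proof.
  intros Wv Ww.
  assert (Al : forall a, Acc (rrel (sumRS v w)) (inl a)).
  { intros a; induction a as [a IH] using (well_founded_induction (swo_wf Wv)).
    constructor; intros [b|b] h; [apply IH, h|destruct h]. }
  split.
  - intros [a|a]; [apply Al|].
    induction a as [a IH] using (well_founded_induction (swo_wf Ww)).
    constructor; intros [b|b] h; [apply Al|apply IH, h].
  - intros [x|x] [y|y] [z|z]; simpl; try tauto; [apply (swo_trans Wv)|apply (swo_trans Ww)].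
  - intros [x|x] [y|y]; simpl; auto.
    + destruct (swo_total Wv x y) as [h|[->|h]]; auto.
    + destruct (swo_total Ww x y) as [h|[->|h]]; auto.
Qed.

Lemma empty_swo : swo (rrel emptyRS).
Proof. split; intros x; destruct x. Qed.

Lemma one_swo : swo (rrel oneRS).
Proof.
  split.
  - intros x; constructor; intros y h; destruct h.
  - intros x y z h; destruct h.
  - intros [] []; auto.
Qed.

(** Ordinal addition enters only through exponents: lexicographic products need omega^p * omega^q =
    omega^(p+q). *)
Definition oadd (a b : Ord) : Ord := ordOf (sumRS (rep a) (rep b)).

Lemma rep_oadd (a b : Ord) : iso (rep (oadd a b)) (sumRS (rep a) (rep b)).
Proof. apply rep_ordOf, sum_swo; apply WO_swo. Qed.

Lemma lt_iff_seg (c a : Ord) (r : RS) : iso (rep a) r ->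
  (olt c a <-> exists x : r, iso (rep c) (seg r x)).
Proof.
  intros (f & g & h1 & h2 & h3); split; intros [x hx].
  - exists (f x). exact (iso_trans hx (iso_seg _ _ f g h1 h2 h3 x)).
  - exists (g x). apply (iso_trans hx). apply (iso_seg r (rep a) g f h2 h1).
    intros u v; rewrite h3, !h2; tauto.
Qed.

Lemma seg_inl (v w : RS) (x : v) : iso (seg (sumRS v w) (inl x)) (seg v x).
Proof.
  apply iso_sym.
  exists (fun y : seg v x => exist (fun z => rrel (sumRS v w) z (inl x)) (inl (proj1_sig y)) (proj2_sig y)).
  unshelve eexists.
  { intros [[y|y] hy]; simpl in hy; [exact (exist _ y hy)|destruct hy]. }
  split; [|split].
  - intros [y hy]; reflexivity.
  - intros [[y|y] hy]; [reflexivity|destruct hy].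
  - intros [y hy] [z hz]; simpl; tauto.
Qed.

Lemma seg_inr (v w : RS) (x : w) : iso (seg (sumRS v w) (inr x)) (sumRS v (seg w x)).
Proof.
  unshelve eexists.
  { intros [[y|y] hy]; [exact (inl y)|right; exact (exist _ y hy)]. }
  unshelve eexists.
  { intros [y|[y hy]]; [exact (exist _ (inl y) I)|exact (exist _ (inr y) hy)]. }
  split; [|split].
  - intros [[y|y] hy]; apply eq_sig_hprop; auto; intros; apply proof_irrelevance.
  - intros [y|[y hy]]; reflexivity.
  - intros [[y|y] hy] [[z|z] hz]; simpl; tauto.
Qed.

Lemma sum_iso (v v' w w' : RS) : iso v v' -> iso w w' -> iso (sumRS v w) (sumRS v' w').
Proof.
  intros (f & g & h1 & h2 & h3) (f' & g' & h1' & h2' & h3').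
  exists (fun x => match x with inl a => inl (f a) | inr b => inr (f' b) end),
         (fun x => match x with inl a => inl (g a) | inr b => inr (g' b) end).
  split; [|split].
  - intros [x|x]; simpl; [rewrite h1|rewrite h1']; reflexivity.
  - intros [x|x]; simpl; [rewrite h2|rewrite h2']; reflexivity.
  - intros [x|x] [y|y]; simpl; try tauto; auto.
Qed.

Lemma lt_oadd (c a b : Ord) :
  olt c (oadd a b) <-> olt c a \/ exists b', olt b' b /\ c = oadd a b'.
Proof.
  rewrite (@lt_iff_seg c _ _ (rep_oadd a b)). split.
  - intros [[x|x] hx].
    + left; exists x. exact (iso_trans hx (seg_inl _ (rep b) x)).
    + right. pose (b' := class (swoWO _ (seg_swo (rep b) x))).
      assert (hb : iso (rep b') (seg (rep b) x)) by exact (rep_class (swoWO _ (seg_swo (rep b) x))).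
      exists b'; split; [exists x; exact hb|]. apply ord_eq.
      apply (iso_trans hx). apply (iso_trans (seg_inr (rep a) (rep b) x)).
      apply iso_sym. apply (iso_trans (rep_oadd a b')). apply sum_iso; [apply iso_refl|exact hb].
  - intros [[x hx]|(b' & [x hx] & ->)].
    + exists (inl x). apply (iso_trans hx), iso_sym, seg_inl.
    + exists (inr x). apply (iso_trans (rep_oadd a b')), iso_sym.
      apply (iso_trans (seg_inr (rep a) (rep b) x)).
      apply sum_iso; [apply iso_refl|apply iso_sym, hx].
Qed.

Lemma oadd_mono (a b b' : Ord) : olt b' b -> olt (oadd a b') (oadd a b).
Proof. intros h; apply lt_oadd; right; exists b'; auto. Qed.

Lemma olt_ext (a b : Ord) : (forall c, olt c a <-> olt c b) -> a = b.
Proof.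
  intros h; destruct (olt_total a b) as [k|[k|k]]; [|exact k|]; apply h in k; destruct (olt_irrefl k).
Qed.

Lemma oadd_0 (a : Ord) : oadd a ozero = a.
Proof.
  apply olt_ext; intros c; rewrite lt_oadd; split; [|auto].
  intros [h|(b' & h & _)]; [exact h|destruct (ozero_le h)].
Qed.

Lemma oadd_ge (a b : Ord) : ~ olt (oadd a b) a.
Proof.
  intros h. destruct (classic (b = ozero)) as [->|hb].
  - rewrite oadd_0 in h; exact (olt_irrefl h).
  - apply ozero_lt in hb. apply (oadd_mono a) in hb. rewrite oadd_0 in hb.
    exact (olt_irrefl (olt_trans h hb)).
Qed.

Lemma oadd_sub (a x : Ord) : ~ olt x a -> exists b, x = oadd a b.
Proof.
  intros h.
  assert (hx : exists b, ~ olt (oadd a b) x).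
  { exists x. exact (@mono_inflationary _ _ (oadd a) olt_swo (fun u v => @oadd_mono a v u) x). }
  destruct (wf_min _ olt_wf hx) as (b & hb & mb). exists b.
  destruct (olt_total x (oadd a b)) as [k|[k|k]]; [|exact k|destruct (hb k)].
  apply lt_oadd in k. destruct k as [k|(b' & hb' & ->)]; [destruct (h k)|].
  destruct (mb b' hb' (@olt_irrefl _)).
Qed.

Lemma rep_osucc (a : Ord) : iso (rep (osucc a)) (sumRS (rep a) oneRS).
Proof. apply rep_ordOf, sum_swo; [apply WO_swo|apply one_swo]. Qed.

Lemma lt_osucc (c a : Ord) : olt c (osucc a) <-> ~ olt a c.
Proof.
  assert (H : olt c (osucc a) <-> olt c a \/ c = a).
  { rewrite (@lt_iff_seg c _ _ (rep_osucc a)).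
    assert (hz : iso (seg (sumRS (rep a) oneRS) (inr tt)) (rep a)).
    { apply (iso_trans (seg_inr (rep a) oneRS tt)). apply iso_sym.
      exists inl. unshelve eexists.
      { intros [x|[x []]]; exact x. }
      split; [|split]; [reflexivity| |simpl; tauto].
      intros [x|[x []]]; reflexivity. }
    split.
    - intros [[x|[]] hx].
      + left; exists x. exact (iso_trans hx (seg_inl _ oneRS x)).
      + right; apply ord_eq. exact (iso_trans hx hz).
    - intros [[x hx]| ->].
      + exists (inl x). apply (iso_trans hx), iso_sym, seg_inl.
      + exists (inr tt). apply iso_sym, hz. }
  rewrite H, (swo_not_lt olt_swo). tauto.
Qed.

Lemma olt_osucc (a : Ord) : olt a (osucc a).
Proof. apply lt_osucc, olt_irrefl. Qed.

(** * Finite-support functions *)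

Section FiniteSupport.
Variables (I : Type) (ltI : I -> I -> Prop).
Hypothesis WI : swo ltI.

Lemma max_in_list (P : I -> Prop) (l : list I) (x0 : I) : P x0 ->
  exists m, P m /\ (m = x0 \/ ltI x0 m) /\ forall y, In y l -> P y -> ~ ltI m y.
Proof.
  intros h0; induction l as [|a l (m & hm & h1 & h2)].
  - exists x0; split; [exact h0|split; [auto|intros y []]].
  - destruct (classic (P a /\ ltI m a)) as [[ha hma]|hn].
    + exists a; split; [exact ha|split].
      * right; destruct h1 as [<-|h1]; [exact hma|exact (swo_trans WI _ _ _ h1 hma)].
      * intros y [<-|hy] py h; [exact (wf_irrefl (swo_wf WI) _ h)|].
        exact (h2 y hy py (swo_trans WI _ _ _ hma h)).
    + exists m; split; [exact hm|split; [exact h1|]].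
      intros y [<-|hy] py h; [tauto|exact (h2 y hy py h)].
Qed.

Lemma max_finite (P : I -> Prop) (l : list I) : (forall x, P x -> In x l) ->
  (exists x, P x) -> exists m, P m /\ forall y, ltI m y -> ~ P y.
Proof.
  intros hl [x0 h0]. destruct (max_in_list P l x0 h0) as (m & hm & _ & h).
  exists m; split; [exact hm|]. intros y hy py; exact (h y (hl y py) py hy).
Qed.

Variables (D : Type) (ltD : D -> D -> Prop) (d0 : D).
Hypothesis WD : swo ltD.
Hypothesis D0 : forall d, ~ ltD d d0.

Definition FS : Type := {f : I -> D | exists l : list I, forall x, f x <> d0 -> In x l}.
Definition AL (f g : FS) : Prop :=
  exists x, ltD (proj1_sig f x) (proj1_sig g x) /\
            forall y, ltI x y -> proj1_sig f y = proj1_sig g y.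

Lemma FS_ext (f g : FS) : (forall x, proj1_sig f x = proj1_sig g x) -> f = g.
Proof.
  intros h; apply eq_sig_hprop; [intros; apply proof_irrelevance|].
  apply functional_extensionality, h.
Qed.

Lemma FS_max_supp (f : FS) : (exists x, proj1_sig f x <> d0) ->
  exists m, proj1_sig f m <> d0 /\ forall y, ltI m y -> proj1_sig f y = d0.
Proof.
  destruct f as [f [l hl]]; simpl; intros h.
  destruct (max_finite _ l hl h) as (m & hm & k). exists m; split; [exact hm|].
  intros y hy; exact (NNPP _ (k y hy)).
Qed.

Lemma AL_trans f g h : AL f g -> AL g h -> AL f h.
Proof.
  intros (x & hx & kx) (y & hy & ky).
  destruct (swo_total WI x y) as [hxy|[<-|hxy]].
  - exists y; split; [rewrite kx by exact hxy; exact hy|].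
    intros z hz; rewrite kx by exact (swo_trans WI _ _ _ hxy hz); apply ky, hz.
  - exists x; split; [exact (swo_trans WD _ _ _ hx hy)|].
    intros z hz; rewrite kx by exact hz; apply ky, hz.
  - exists x; split; [rewrite <- ky by exact hxy; exact hx|].
    intros z hz; rewrite kx by exact hz; apply ky, (swo_trans WI _ _ _ hxy hz).
Qed.

Lemma AL_total f g : AL f g \/ f = g \/ AL g f.
Proof.
  destruct (classic (exists x, proj1_sig f x <> proj1_sig g x)) as [h|h].
  - destruct f as [f [lf hf]], g as [g [lg hg]]; simpl in h.
    destruct (@max_finite (fun x => f x <> g x) (lf ++ lg)) as (m & hm & km).
    + intros x hx; apply in_or_app. destruct (classic (f x = d0)) as [e|e]; [|left; auto].
      right; apply hg; intros e'; apply hx; congruence.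
    + exact h.
    + destruct (swo_total WD (f m) (g m)) as [k|[k|k]].
      * left; exists m; split; [exact k|]. intros y hy; exact (NNPP _ (km y hy)).
      * destruct (hm k).
      * right; right; exists m; split; [exact k|]. intros y hy; symmetry; exact (NNPP _ (km y hy)).
  - right; left; apply FS_ext. intros x; apply NNPP; intros k; apply h; exists x; exact k.
Qed.

Lemma FS_erase (f : FS) (x : I) : exists g : FS, proj1_sig g x = d0 /\
  forall y, y <> x -> proj1_sig g y = proj1_sig f y.
Proof.
  unshelve eexists.
  { exists (fun y => if excluded_middle_informative (y = x) then d0 else proj1_sig f y).
    destruct f as [f [l hl]]; exists l; intros y; simpl.
    destruct (excluded_middle_informative (y = x)); [tauto|apply hl]. }
  simpl; split.
  - destruct (excluded_middle_informative (x = x)); tauto.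
  - intros y hy; destruct (excluded_middle_informative (y = x)); tauto.
Qed.

Lemma AL_zero_acc (f : FS) : (forall x, proj1_sig f x = d0) -> Acc AL f.
Proof.
  intros h; constructor; intros g (x & hx & _). rewrite h in hx; destruct (D0 hx).
Qed.

(** Three nested inductions: on a bound [x] for the support, on the value [d] at [x], and on the
    accessibility of the function with its value at [x] erased. A step down either lowers [d], or
    keeps [d] and lowers the erased part. *)
Lemma AL_wf : well_founded AL.
Proof.
  assert (P : forall x (f : FS), (forall y, ltI x y -> proj1_sig f y = d0) -> Acc AL f).
  { intros x; induction x as [x IHx] using (well_founded_induction (swo_wf WI)).
    assert (Q : forall d (f : FS), (forall y, ltI x y -> proj1_sig f y = d0) ->
                proj1_sig f x = d -> Acc AL f).
    { intros d; induction d as [d IHd] using (well_founded_induction (swo_wf WD)).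
      assert (R : forall g : FS, Acc AL g -> proj1_sig g x = d0 -> forall f : FS,
                (forall y, ltI x y -> proj1_sig f y = d0) -> proj1_sig f x = d ->
                (forall y, y <> x -> proj1_sig g y = proj1_sig f y) -> Acc AL f).
      { intros g Ag; induction Ag as [g _ IHg]. intros gx f f1 f2 f3.
        constructor; intros f' (z & hz & kz).
        assert (zx : ~ ltI x z).
        { intros h; rewrite (f1 z h) in hz; exact (D0 hz). }
        assert (f'1 : forall y, ltI x y -> proj1_sig f' y = d0).
        { intros y hy; rewrite <- (f1 y hy); apply kz.
          destruct (proj1 (swo_not_lt WI _ _) zx) as [h| ->]; [|exact hy].
          exact (swo_trans WI _ _ _ h hy). }
        destruct (proj1 (swo_not_lt WI _ _) zx) as [h|e].
        - destruct (FS_erase f' x) as (g' & g'1 & g'2).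
          assert (zn : z <> x) by (intros e; subst z; exact (wf_irrefl (swo_wf WI) _ h)).
          apply (IHg g'); auto.
          + exists z; split; [rewrite g'2, f3 by exact zn; exact hz|].
            intros y hy. destruct (classic (y = x)) as [->|hyx]; [congruence|].
            rewrite g'2, f3 by exact hyx. apply kz, hy.
          + rewrite (kz x h); exact f2.
        - subst z. rewrite f2 in hz. apply (IHd _ hz); auto. }
      intros f f1 f2. destruct (FS_erase f x) as (g & g1 & g2).
      apply (R g); auto.
      destruct (classic (exists y, proj1_sig g y <> d0)) as [h|h].
      - destruct (FS_max_supp g h) as (m & hm & km). apply (IHx m); [|exact km].
        destruct (swo_total WI m x) as [k|[->|k]]; [exact k| |]; exfalso; apply hm.
        + exact g1.
        + rewrite g2; [apply f1, k|]. intros ->; exact (wf_irrefl (swo_wf WI) _ k).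
      - apply AL_zero_acc. intros y; apply NNPP; intros k; apply h; exists y; exact k. }
    intros f hf; exact (Q _ f hf eq_refl). }
  intros f. destruct (classic (exists y, proj1_sig f y <> d0)) as [h|h].
  - destruct (FS_max_supp f h) as (m & hm & km). exact (P m f km).
  - apply AL_zero_acc. intros y; apply NNPP; intros k; apply h; exists y; exact k.
Qed.

Lemma AL_swo : swo AL.
Proof. split; [exact AL_wf|exact AL_trans|exact AL_total]. Qed.

End FiniteSupport.

Lemma nat_swo : swo lt.
Proof. split; [exact lt_wf|exact Nat.lt_trans|intros; lia]. Qed.

Definition ltbool (a b : bool) : Prop := a = false /\ b = true.

Lemma bool_swo : swo ltbool.
Proof.
  assert (A : Acc ltbool false) by (constructor; intros y [_ h]; discriminate).
  split.
  - intros [|]; [|exact A]. constructor; intros y [-> _]; exact A.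
  - intros x y z [-> ->] [h _]; discriminate.
  - unfold ltbool. intros [] []; auto.
Qed.

(** Functions on the carrier of [rep a] become functions on all of [Ord] vanishing outside the
    segment of [a]. One embedding serves both exponentials, base omega with [natRS] and base 2 with
    [boolRS]. *)
Lemma antilex_rep_embed (a : Ord) (D : RS) (d0 : D) :
  exists F : antilexRS (rep a) D d0 -> @FS Ord (rcar D) d0,
    (forall f g, rrel (antilexRS (rep a) D d0) f g -> AL olt (rrel D) (F f) (F g)) /\
    (forall g, (exists f, F f = g) <-> (forall b, ~ olt b a -> proj1_sig g b = d0)).
Proof.
  destruct (otype_rep a) as (e & he & Ie).
  assert (inj : forall x y, e x = e y -> x = y).
  { intros x y h. destruct (swo_total (WO_swo (rep a)) x y) as [k|[k|k]]; [|exact k|];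
      apply he in k; rewrite h in k; destruct (olt_irrefl k). }
  assert (ext : forall f : rep a -> D, exists g : Ord -> D,
      (forall x, g (e x) = f x) /\ forall b, ~ olt b a -> g b = d0).
  { intros f. destruct (choice (fun b d => (forall x, e x = b -> d = f x) /\ (~ olt b a -> d = d0))) as [g hg].
    - intros b. destruct (classic (olt b a)) as [h|h].
      + apply Ie in h; destruct h as [x <-]. exists (f x); split.
        * intros y k; apply inj in k; congruence.
        * intros k; destruct k; apply Ie; exists x; reflexivity.
      + exists d0; split; [|auto]. intros x <-; destruct h; apply Ie; exists x; reflexivity.
    - exists g; split; [intros x; apply (hg (e x)); reflexivity|intros b; apply hg]. }
  destruct (choice _ ext) as [G hG].
  assert (fin : forall f : antilexRS (rep a) D d0, exists l : list Ord, forall b, G (proj1_sig f) b <> d0 -> In b l).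
  { intros [f [l hl]]; simpl. exists (map e l). intros b hb.
    destruct (hG f) as [h1 h2]. destruct (classic (olt b a)) as [h|h].
    - apply Ie in h; destruct h as [x <-]. rewrite h1 in hb. apply in_map, hl, hb.
    - destruct (hb (h2 b h)). }
  exists (fun f => exist _ (G (proj1_sig f)) (fin f)); split.
  - intros [f pf] [g pg] (x & hx & kx); simpl in *. exists (e x); simpl.
    destruct (hG f) as [f1 f2], (hG g) as [g1 g2]. split; [rewrite f1, g1; exact hx|].
    intros b hb. destruct (classic (olt b a)) as [h|h]; [|rewrite f2, g2; auto].
    apply Ie in h; destruct h as [y <-]. rewrite f1, g1. apply kx.
    destruct (swo_total (WO_swo (rep a)) x y) as [k|[->|k]]; [exact k| |].
    + destruct (olt_irrefl hb).
    + destruct (olt_irrefl (olt_trans hb (he _ _ k))).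
  - intros g; split.
    + intros [f <-] b hb; simpl. apply (hG (proj1_sig f)), hb.
    + intros hg.
      assert (fin' : exists l : list (rep a), forall x, proj1_sig g (e x) <> d0 -> In x l).
      { destruct g as [g [l hl]]; simpl.
        assert (Hl : forall l : list Ord, exists l' : list (rep a), forall x, In (e x) l -> In x l').
        { clear - inj; intros l; induction l as [|b l [l' IH]].
          - exists nil; intros x h; exact h.
          - destruct (classic (exists y, e y = b)) as [[y <-]|h].
            + exists (y :: l'). intros x [h|h]; [left; apply inj, h|right; auto].
            + exists l'. intros x [k|k]; [destruct h; exists x; auto|auto]. }
        destruct (Hl l) as [l' hl']. exists l'; intros x hx; apply hl', hl, hx. }
      exists (exist _ (fun x => proj1_sig g (e x)) fin'). apply FS_ext; simpl. intros b.
      destruct (hG (fun x => proj1_sig g (e x))) as [h1 h2].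
      destruct (classic (olt b a)) as [h|h].
      * apply Ie in h; destruct h as [x <-]. apply h1.
      * rewrite h2, hg; auto.
Qed.

(** * Natural sums: finite-support functions into [nat] *)

Section NaturalSum.
Variables (I : Type) (ltI : I -> I -> Prop).
Hypothesis WI : swo ltI.

Definition Hess : Type := @FS I nat 0.
Definition ltH : Hess -> Hess -> Prop := @AL I ltI nat lt 0.

Lemma ltH_swo : swo ltH.
Proof. apply AL_swo; [exact WI|exact nat_swo|intros; lia]. Qed.

Definition at_ (f : Hess) (x : I) : nat := proj1_sig f x.

Lemma H_ext (f g : Hess) : (forall x, at_ f x = at_ g x) -> f = g.
Proof. apply FS_ext. Qed.

Lemma ltH_intro (f g : Hess) (x : I) : at_ f x < at_ g x ->
  (forall y, ltI x y -> at_ f y = at_ g y) -> ltH f g.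
Proof. intros h k; exists x; split; [exact h|exact k]. Qed.

Definition hfun (f : I -> nat) (h : exists l : list I, forall x, f x <> 0 -> In x l) : Hess := exist _ f h.
Arguments hfun [f] h.

Lemma hadd_fin (f g : Hess) : exists l : list I, forall x, at_ f x + at_ g x <> 0 -> In x l.
Proof.
  destruct f as [f [l hl]], g as [g [l' hl']]; exists (l ++ l'); intros x; simpl; intros h.
  apply in_or_app. destruct (Nat.eq_dec (f x) 0); [right; apply hl'; lia|left; auto].
Qed.
Definition hadd (f g : Hess) : Hess := hfun (hadd_fin f g).

Lemma hsub_fin (f g : Hess) : exists l : list I, forall x, at_ f x - at_ g x <> 0 -> In x l.
Proof.
  destruct f as [f [l hl]]; exists l; intros x; simpl; intros h. apply hl; lia.
Qed.
Definition hsub (f g : Hess) : Hess := hfun (hsub_fin f g).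

Definition single_fun (x : I) (n : nat) (y : I) : nat :=
  if excluded_middle_informative (y = x) then n else 0.
Lemma single_fin (x : I) (n : nat) : exists l : list I, forall y, single_fun x n y <> 0 -> In y l.
Proof.
  exists [x]; intros y; unfold single_fun.
  destruct (excluded_middle_informative (y = x)); [left; auto|tauto].
Qed.
(** The ordinal [omega^x * n]. *)
Definition single (x : I) (n : nat) : Hess := hfun (single_fin x n).

Lemma hpart_fin (P : I -> Prop) (f : Hess) : exists l : list I, forall x,
  (if excluded_middle_informative (P x) then at_ f x else 0) <> 0 -> In x l.
Proof.
  destruct f as [f [l hl]]; exists l; intros x; simpl.
  destruct (excluded_middle_informative (P x)); [apply hl|tauto].
Qed.
Definition hpart (P : I -> Prop) (f : Hess) : Hess := hfun (hpart_fin P f).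

Lemma hpart_in (P : I -> Prop) f x : P x -> at_ (hpart P f) x = at_ f x.
Proof. intros h; simpl; destruct (excluded_middle_informative (P x)); tauto. Qed.
Lemma hpart_out (P : I -> Prop) f x : ~ P x -> at_ (hpart P f) x = 0.
Proof. intros h; simpl; destruct (excluded_middle_informative (P x)); tauto. Qed.

Lemma single_eq x n : at_ (single x n) x = n.
Proof. simpl; unfold single_fun; destruct (excluded_middle_informative (x = x)); tauto. Qed.
Lemma single_neq x n y : y <> x -> at_ (single x n) y = 0.
Proof. intros h; simpl; unfold single_fun; destruct (excluded_middle_informative (y = x)); tauto. Qed.

Lemma hadd_at f g x : at_ (hadd f g) x = at_ f x + at_ g x.
Proof. reflexivity. Qed.
Lemma hsub_at f g x : at_ (hsub f g) x = at_ f x - at_ g x.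
Proof. reflexivity. Qed.

Lemma lt_neq_I x y : ltI x y -> y <> x.
Proof. intros h ->; exact (wf_irrefl (swo_wf WI) _ h). Qed.

Lemma hadd_comm f g : hadd f g = hadd g f.
Proof. apply H_ext; intros x; rewrite !hadd_at; lia. Qed.
Lemma hadd_assoc f g h : hadd (hadd f g) h = hadd f (hadd g h).
Proof. apply H_ext; intros x; rewrite !hadd_at; lia. Qed.
Lemma single_add x n m : hadd (single x n) (single x m) = single x (n + m).
Proof.
  apply H_ext; intros y; rewrite hadd_at. destruct (classic (y = x)) as [->|h].
  - rewrite !single_eq; reflexivity.
  - rewrite !single_neq by exact h; reflexivity.
Qed.
Lemma single_0 x y : single x 0 = single y 0.
Proof.
  apply H_ext; intros z; simpl; unfold single_fun;
    destruct (excluded_middle_informative (z = x)), (excluded_middle_informative (z = y)); reflexivity.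
Qed.
Lemma single_0_at x y : at_ (single x 0) y = 0.
Proof. rewrite (single_0 x y). apply single_eq. Qed.

Lemma hadd_0 f x : hadd f (single x 0) = f.
Proof. apply H_ext; intros y; rewrite hadd_at, single_0_at; lia. Qed.

Lemma hadd_mono_l f f' g : ltH f f' -> ltH (hadd f g) (hadd f' g).
Proof.
  intros (x & h & k). apply ltH_intro with x; rewrite ?hadd_at; unfold at_ in *; [lia|].
  intros y hy; rewrite !hadd_at; unfold at_; rewrite k; auto.
Qed.
Lemma hadd_mono_r f f' g : ltH f f' -> ltH (hadd g f) (hadd g f').
Proof. rewrite !(hadd_comm g); apply hadd_mono_l. Qed.

Lemma single_mono x n m : n < m -> ltH (single x n) (single x m).
Proof.
  intros h; apply ltH_intro with x; rewrite ?single_eq; [exact h|].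
  intros y hy; rewrite !single_neq; auto using lt_neq_I.
Qed.

Lemma single_lt x y n m : ltI x y -> 0 < m -> ltH (single x n) (single y m).
Proof.
  intros h hm; apply ltH_intro with y.
  - rewrite single_eq, single_neq; auto using lt_neq_I.
  - intros z hz. rewrite !single_neq; auto using lt_neq_I.
    apply lt_neq_I, (swo_trans WI _ _ _ h hz).
Qed.

Lemma lt_single1 (f : Hess) x : ltH f (single x 1) <-> forall y, ~ ltI y x -> at_ f y = 0.
Proof.
  split.
  - intros (z & hz & kz). change (at_ f z < at_ (single x 1) z) in hz.
    assert (z = x) as ->.
    { apply NNPP; intros e; rewrite (single_neq 1 e) in hz; lia. }
    rewrite single_eq in hz. intros y hy.
    apply (swo_not_lt WI) in hy. destruct hy as [hy| ->]; [|lia].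
    transitivity (at_ (single x 1) y); [exact (kz y hy)|apply single_neq, lt_neq_I, hy].
  - intros h; apply ltH_intro with x.
    + rewrite single_eq, h; [lia|]. apply (wf_irrefl (swo_wf WI)).
    + intros y hy. rewrite single_neq by (apply lt_neq_I, hy). apply h.
      intros k; exact (wf_irrefl (swo_wf WI) _ (swo_trans WI _ _ _ hy k)).
Qed.

Lemma lt_single (f : Hess) x n : ltH f (single x n) <->
  at_ f x < n /\ forall y, ltI x y -> at_ f y = 0.
Proof.
  split.
  - intros (z & hz & kz). change (at_ f z < at_ (single x n) z) in hz.
    assert (z = x) as ->.
    { apply NNPP; intros e; rewrite (single_neq n e) in hz; lia. }
    rewrite single_eq in hz; split; [exact hz|]. intros y hy.
    transitivity (at_ (single x n) y); [exact (kz y hy)|apply single_neq, lt_neq_I, hy].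
  - intros [h k]; apply ltH_intro with x; [rewrite single_eq; exact h|].
    intros y hy. rewrite single_neq by (apply lt_neq_I, hy). apply k, hy.
Qed.

Lemma hadd_lt_single1 f g x : ltH f (single x 1) -> ltH g (single x 1) -> ltH (hadd f g) (single x 1).
Proof.
  rewrite !lt_single1; intros h k y hy. rewrite hadd_at, h, k; auto.
Qed.

(** The leading exponent of [f] and its coefficient plus one serve as [y] and [n]. *)
Lemma lt_single1_bound (f : Hess) x : ltH f (single x 1) ->
  f = single x 0 \/ exists y n, ltI y x /\ ltH f (single y n).
Proof.
  intros h. rewrite lt_single1 in h.
  destruct (classic (exists y, proj1_sig f y <> 0)) as [k|k].
  - right. destruct (FS_max_supp WI f k) as (m & hm & km). fold (at_ f m) in hm.
    exists m, (S (at_ f m)). split.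
    + apply NNPP; intros e; exact (hm (h m e)).
    + apply lt_single; split; [lia|exact km].
  - left; apply H_ext; intros y; rewrite single_0_at. apply NNPP; intros e; apply k; exists y; exact e.
Qed.

Lemma lt_hadd (c f g : Hess) : ltH c (hadd f g) ->
  (exists f', ltH f' f /\ ~ ltH (hadd f' g) c) \/ (exists g', ltH g' g /\ ~ ltH (hadd f g') c).
Proof.
  assert (Hl : forall f g : Hess, forall x, at_ c x < at_ f x + at_ g x ->
      (forall y, ltI x y -> at_ c y = at_ f y + at_ g y) -> 0 < at_ f x ->
      exists f', ltH f' f /\ ~ ltH (hadd f' g) c).
  { clear f g; intros f g x hx kx hf.
    (* The witness copies [f] above [x], loses one at [x] and copies [c] below [x]; after adding [g]
       it is at least [c] in every coefficient. *)
    assert (fin : exists l : list I, forall y,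
      (if excluded_middle_informative (ltI x y) then at_ f y else
       if excluded_middle_informative (y = x) then pred (at_ f x) else at_ c y) <> 0 -> In y l).
    { destruct f as [f [l hl]], c as [c' [l' hl']]; exists (x :: l ++ l'); intros y; simpl.
      intros h; rewrite in_app_iff.
      destruct (excluded_middle_informative (ltI x y)); auto.
      destruct (excluded_middle_informative (y = x)); auto. }
    exists (hfun fin); split.
    - apply ltH_intro with x; simpl.
      + destruct (excluded_middle_informative (ltI x x)) as [k|_]; [destruct (wf_irrefl (swo_wf WI) _ k)|].
        destruct (excluded_middle_informative (x = x)); [lia|tauto].
      + intros y hy; destruct (excluded_middle_informative (ltI x y)); tauto.
    - intros (z & hz & _).
      change ((if excluded_middle_informative (ltI x z) then at_ f z else
       if excluded_middle_informative (z = x) then pred (at_ f x) else at_ c z) + at_ g z < at_ c z) in hz.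
      destruct (excluded_middle_informative (ltI x z)) as [k|k]; [rewrite kx in hz; [lia|exact k]|].
      destruct (excluded_middle_informative (z = x)) as [->|k']; lia. }
  intros (x & hx & kx). change (at_ c x < at_ f x + at_ g x) in hx.
  destruct (Nat.eq_dec (at_ f x) 0) as [e|e].
  - right. destruct (Hl g f x) as (g' & h1 & h2).
    + lia.
    + intros y hy; rewrite Nat.add_comm; exact (kx y hy).
    + lia.
    + exists g'; split; [exact h1|rewrite hadd_comm; exact h2].
  - left; apply (Hl f g x hx kx); lia.
Qed.

(** When no exponent of [g] exceeds one of [f], the natural sum is the ordinal sum. *)
Lemma lt_hadd_ordered (f g d : Hess) :
  (forall x y, at_ f x <> 0 -> at_ g y <> 0 -> ~ ltI x y) ->
  ltH d (hadd f g) -> ltH d f \/ exists d', ltH d' g /\ d = hadd f d'.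
Proof.
  intros hs hd. destruct (swo_total ltH_swo d f) as [h|[h|h]]; [auto| |]; right.
  - subst d. exists (hsub f f). split.
    + destruct hd as (y & hy & ky). change (at_ f y < at_ f y + at_ g y) in hy.
      apply ltH_intro with y; rewrite ?hsub_at; [lia|]. intros z hz.
      specialize (ky z hz). change (at_ f z = at_ f z + at_ g z) in ky. rewrite hsub_at; lia.
    + apply H_ext; intros z; rewrite hadd_at, hsub_at; lia.
  - destruct hd as (y & hy & ky), h as (x & hx & kx).
    change (at_ d y < at_ f y + at_ g y) in hy. change (at_ f x < at_ d x) in hx.
    assert (ky' : forall z, ltI y z -> at_ d z = at_ f z + at_ g z) by exact ky.
    assert (kx' : forall z, ltI x z -> at_ f z = at_ d z) by exact kx.
    (* In each case [g] has a non-zero coefficient at the larger of [x] and [y], so [f] vanishes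
       below that point. *)
    assert (P : forall z, at_ f z <= at_ d z).
    { intros z. destruct (Nat.eq_dec (at_ f z) 0) as [e|e]; [lia|].
      destruct (swo_total WI x y) as [k|[k|k]].
      - destruct (swo_total WI y z) as [l|[l|l]].
        + rewrite ky'; [lia|exact l].
        + subst z. rewrite kx'; [lia|exact k].
        + destruct (hs z y e); [rewrite <- (kx' y k) in hy; lia|exact l].
      - subst y. destruct (swo_total WI x z) as [l|[l|l]].
        + rewrite ky'; [lia|exact l].
        + subst z; lia.
        + destruct (hs z x e); [lia|exact l].
      - destruct (swo_total WI x z) as [l|[l|l]].
        + rewrite <- kx'; [lia|exact l].
        + subst z; lia.
        + destruct (hs z x e); [rewrite (ky' x k) in hx; lia|exact l]. }
    exists (hsub d f). split.
    + apply ltH_intro with y; rewrite ?hsub_at; [specialize (P y); lia|].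
      intros z hz; rewrite hsub_at, ky' by exact hz; lia.
    + apply H_ext; intros z; rewrite hadd_at, hsub_at; specialize (P z); lia.
Qed.

End NaturalSum.

Arguments hfun {I f} h.

(** * Ranks of residual trees *)

(** [LE R S v] (resp. [GE R S v]) bounds from above (resp. below) the rank of the
    tree of sequences in [S] in which every later entry is [R]-allowed after every
    earlier one: after [x], the tree is that of the residual [S /\ R x]. *)
Inductive LE (V X : Type) (lt : V -> V -> Prop) (R : X -> X -> Prop)
    (S : X -> Prop) (v : V) : Prop :=
  LE_intro : (forall x, S x -> exists v', lt v' v /\ LE lt R (fun y => S y /\ R x y) v') ->
             LE lt R S v.

Inductive GE (V X : Type) (lt : V -> V -> Prop) (R : X -> X -> Prop)
    (S : X -> Prop) (v : V) : Prop :=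
  GE_intro : (forall v', lt v' v -> exists x, S x /\ GE lt R (fun y => S y /\ R x y) v') ->
             GE lt R S v.

Section Ranks.
Variables (V : Type) (lt : V -> V -> Prop).
Hypothesis W : swo lt.

Lemma LE_inv (X : Type) (R : X -> X -> Prop) S v : LE lt R S v ->
  forall x, S x -> exists v', lt v' v /\ LE lt R (fun y => S y /\ R x y) v'.
Proof. intros [h]; exact h. Qed.

Lemma GE_inv (X : Type) (R : X -> X -> Prop) S v : GE lt R S v ->
  forall v', lt v' v -> exists x, S x /\ GE lt R (fun y => S y /\ R x y) v'.
Proof. intros [h]; exact h. Qed.

(** A map preserving the allowed relation sends each sequence in [SX] to one of the same length in
    [SY], so the tree over [SY] dominates. This one transport covers restriction to a subset,
    projection to a fibre and choice of representatives. *)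
Lemma LE_map (X Y : Type) (RX : X -> X -> Prop) (RY : Y -> Y -> Prop) (f : X -> Y)
    (SX : X -> Prop) (SY : Y -> Prop) (v v' : V) :
  (forall x, SX x -> SY (f x)) ->
  (forall x x', SX x -> SX x' -> RX x x' -> RY (f x) (f x')) ->
  ~ lt v' v -> LE lt RY SY v -> LE lt RX SX v'.
Proof.
  revert SX SY v'. induction v as [v IH] using (well_founded_induction (swo_wf W)).
  intros SX SY v' hS hR hv h. constructor; intros x hx.
  destruct (LE_inv h (f x) (hS x hx)) as (u & hu & h').
  exists u; split.
  - apply (swo_not_lt W) in hv. destruct hv as [hv| <-]; [exact (swo_trans W _ _ _ hu hv)|exact hu].
  - apply (IH u hu _ (fun y => SY y /\ RY (f x) y)); auto.
    + intros y [hy hxy]; auto.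
    + intros y y' [hy _] [hy' _]; auto.
    + apply (wf_irrefl (swo_wf W)).
Qed.

Lemma GE_map (X Y : Type) (RX : X -> X -> Prop) (RY : Y -> Y -> Prop) (f : X -> Y)
    (SX : X -> Prop) (SY : Y -> Prop) (v v' : V) :
  (forall x, SX x -> SY (f x)) ->
  (forall x x', SX x -> SX x' -> RX x x' -> RY (f x) (f x')) ->
  ~ lt v v' -> GE lt RX SX v -> GE lt RY SY v'.
Proof.
  revert SX SY v'. induction v as [v IH] using (well_founded_induction (swo_wf W)).
  intros SX SY v' hS hR hv h. constructor; intros u hu.
  assert (hu' : lt u v).
  { apply (swo_not_lt W) in hv. destruct hv as [hv| ->]; [exact (swo_trans W _ _ _ hu hv)|exact hu]. }
  destruct (GE_inv h hu') as (x & hx & h').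
  exists (f x); split; [auto|].
  apply (IH u hu' (fun y => SX y /\ RX x y)); auto.
  - intros y [hy hxy]; auto.
  - intros y y' [hy _] [hy' _]; auto.
  - apply (wf_irrefl (swo_wf W)).
Qed.

Lemma LE_mono (X : Type) (R : X -> X -> Prop) (S S' : X -> Prop) (v v' : V) :
  (forall x, S' x -> S x) -> ~ lt v' v -> LE lt R S v -> LE lt R S' v'.
Proof. intros h; apply LE_map with (f := fun x : X => x); auto. Qed.

Lemma GE_mono (X : Type) (R : X -> X -> Prop) (S S' : X -> Prop) (v v' : V) :
  (forall x, S x -> S' x) -> ~ lt v v' -> GE lt R S v -> GE lt R S' v'.
Proof. intros h; apply GE_map with (f := fun x : X => x); auto. Qed.

Lemma LE_sub (X : Type) (R : X -> X -> Prop) (S S' : X -> Prop) (v : V) :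
  (forall x, S' x -> S x) -> LE lt R S v -> LE lt R S' v.
Proof. intros h; apply LE_mono; [exact h|apply (wf_irrefl (swo_wf W))]. Qed.

Lemma GE_sub (X : Type) (R : X -> X -> Prop) (S S' : X -> Prop) (v : V) :
  (forall x, S x -> S' x) -> GE lt R S v -> GE lt R S' v.
Proof. intros h; apply GE_mono; [exact h|apply (wf_irrefl (swo_wf W))]. Qed.

Lemma LE_GE (X : Type) (R : X -> X -> Prop) (S : X -> Prop) (v v' : V) :
  LE lt R S v -> GE lt R S v' -> ~ lt v v'.
Proof.
  revert S v'. induction v as [v IH] using (well_founded_induction (swo_wf W)).
  intros S v' h k hv. destruct (GE_inv k hv) as (x & hx & k').
  destruct (LE_inv h x hx) as (u & hu & h'). exact (IH u hu _ _ h' k' hu).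
Qed.

(** A bound depends only on the order type below its value; this is the passage from natural sums to
    [Ord]. *)
Lemma LE_bis (V' X : Type) (lt' : V' -> V' -> Prop) (R : X -> X -> Prop) (S : X -> Prop)
    (v : V) (v' : V') : bis lt lt' v v' -> LE lt R S v -> LE lt' R S v'.
Proof.
  revert S v'. induction v as [v IH] using (well_founded_induction (swo_wf W)).
  intros S v' hb h. constructor; intros x hx. destruct (LE_inv h x hx) as (u & hu & h').
  destruct (bis_fwd hb _ hu) as (u' & hu' & hb'). exists u'; split; [exact hu'|].
  exact (IH u hu _ _ hb' h').
Qed.

Lemma GE_bis (V' X : Type) (lt' : V' -> V' -> Prop) (R : X -> X -> Prop) (S : X -> Prop)
    (v : V) (v' : V') : bis lt lt' v v' -> GE lt R S v -> GE lt' R S v'.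
Proof.
  revert S v'. induction v as [v IH] using (well_founded_induction (swo_wf W)).
  intros S v' hb h. constructor; intros u' hu'.
  destruct (bis_bwd hb _ hu') as (u & hu & hb').
  destruct (GE_inv h hu) as (x & hx & h'). exists x; split; [exact hx|].
  exact (IH u hu _ _ hb' h').
Qed.

End Ranks.

Arguments GE_inv {V lt X R S v} _ {v'} _.
Arguments LE_sub {V lt} W {X R} S {S' v}.
Arguments GE_sub {V lt} W {X R} S {S' v}.
Arguments LE_mono {V lt} W {X R} S {S'} v {v'}.
Arguments GE_mono {V lt} W {X R} S {S'} v {v'}.
Arguments LE_map {V lt} W {X Y RX RY} f {SX SY v v'}.
Arguments GE_map {V lt} W {X Y RX RY} f {SX SY v v'}.

Lemma ole_not_lt (a b : Ord) : ole a b <-> ~ olt b a.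
Proof. rewrite (swo_not_lt olt_swo); reflexivity. Qed.

(** The rank of a node is the least [LE] bound of its residual, which exists as soon as one bound
    [a] is known at the root. Describing the root rank by its upper bounds allows two ranks to be
    compared without computing either. *)
Lemma rank_exists (A : QO) (node : list A -> Prop) (R : A -> A -> Prop) (a : Ord) :
  node nil ->
  (forall s x, node (s ++ [x]) <-> node s /\ forall y, In y s -> R y x) ->
  LE olt R (fun _ => True) a ->
  exists g, HasRank A node g /\ forall c, LE olt R (fun _ => True) c <-> ~ olt c g.
Proof.
  intros hnil hnode ha.
  set (res := fun (s : list A) y => forall x, In x s -> R x y).
  set (least := fun S c => LE olt R S c /\ forall c', olt c' c -> ~ LE olt R S c').
  assert (hex : forall s, node s -> exists c, LE olt R (res s) c).
  { intros s; induction s as [|x s IH] using rev_ind; intros hs.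
    - exists a. apply (LE_sub olt_swo (fun _ => True)); auto.
    - apply hnode in hs; destruct hs as [hs hx]. destruct (IH hs) as [c hc].
      destruct (LE_inv hc x hx) as (c' & _ & hc'). exists c'.
      apply (LE_sub olt_swo (fun y => res s y /\ R x y)); [|exact hc'].
      intros y hy; split; [intros z hz|]; apply hy, in_or_app; simpl; auto. }
  assert (hl : forall s, exists c, node s -> least (res s) c).
  { intros s. destruct (classic (node s)) as [hs|hs]; [|exists ozero; tauto].
    destruct (wf_min _ olt_wf (hex s hs)) as (c & hc). exists c; intros _; exact hc. }
  destruct (choice _ hl) as [r hr].
  assert (hle : forall s, node s -> forall c, LE olt R (res s) c <-> ~ olt c (r s)).
  { intros s hs c; destruct (hr s hs) as [h1 h2]; split.
    - intros h k; exact (h2 c k h).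
    - intros h; exact (LE_mono olt_swo _ _ (fun x k => k) h h1). }
  exists (r nil); split.
  - exists r; split; [reflexivity|]. intros s hs; split.
    + intros b (x & hx & ->). apply ole_not_lt. intros k.
      pose proof (proj2 (hle s hs (r s)) (@olt_irrefl _)) as h.
      destruct (proj1 (hnode s x) hx) as [_ hx'].
      destruct (LE_inv h x hx') as (c & hc & h').
      assert (h2 : LE olt R (res (s ++ [x])) c).
      { apply (LE_sub olt_swo (fun y => res s y /\ R x y)); [|exact h'].
        intros y hy; split; [intros z hz|]; apply hy, in_or_app; simpl; auto. }
      apply (hle _ hx) in h2. apply lt_osucc in k. apply k.
      destruct (proj1 (swo_not_lt olt_swo _ _) h2) as [l| ->]; [exact (olt_trans l hc)|exact hc].
    (* Any [c] at least the successors of the children's ranks is itself an [LE] bound for the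
       residual of [s], hence not below the least one. *)
    + intros c hc. apply ole_not_lt. apply (hle s hs). constructor; intros x hx.
      assert (hn : node (s ++ [x])) by (apply hnode; auto).
      exists (r (s ++ [x])); split.
      * assert (k : ole (osucc (r (s ++ [x]))) c) by (apply hc; exists x; auto).
        destruct k as [k| <-]; [exact (olt_trans (olt_osucc _) k)|apply olt_osucc].
      * apply (LE_sub olt_swo (res (s ++ [x]))).
        -- intros y [hy1 hy2] z hz. apply in_app_or in hz. destruct hz as [hz|[<-|[]]]; auto.
        -- apply (hle _ hn), olt_irrefl.
  - intros c. rewrite <- (hle nil hnil c). split; apply (LE_sub olt_swo); auto.
    intros x _ y [].
Qed.

Lemma rank_eq (A : QO) (node : list A -> Prop) (R : A -> A -> Prop) (a : Ord) :
  node nil ->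
  (forall s x, node (s ++ [x]) <-> node s /\ forall y, In y s -> R y x) ->
  LE olt R (fun _ => True) a -> GE olt R (fun _ => True) a -> HasRank A node a.
Proof.
  intros h1 h2 h3 h4. destruct (@rank_exists A node R a h1 h2 h3) as (g & hg & k).
  replace a with g; [exact hg|].
  pose proof (proj1 (k a) h3) as l1. pose proof (LE_GE olt_swo (proj2 (k g) (@olt_irrefl g)) h4) as l2.
  destruct (olt_total g a) as [e|[e|e]]; tauto.
Qed.

(** * Bad sequences and antichains as residual trees *)

Definition Rbad (A : QO) (x y : A) : Prop := ~ qle A x y.
Definition Rinc (A : QO) (x y : A) : Prop := ~ qle A x y /\ ~ qle A y x.
Arguments Rbad A x y : clear implicits.
Arguments Rinc A x y : clear implicits.

Lemma nth_error_snoc (A : Type) (s : list A) (x : A) (i : nat) (y : A) :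
  nth_error (s ++ [x]) i = Some y <->
  (nth_error s i = Some y) \/ (i = length s /\ x = y).
Proof.
  destruct (lt_eq_lt_dec i (length s)) as [[h|h]|h].
  - rewrite nth_error_app1 by exact h. split; [auto|]. intros [k|[k _]]; [exact k|lia].
  - subst i. rewrite nth_error_app2, Nat.sub_diag by lia. simpl.
    split; [intros [= <-]; auto|]. intros [k|[_ <-]]; [|reflexivity].
    assert (hb : length s < length s) by (apply nth_error_Some; congruence); lia.
  - rewrite nth_error_app2 by lia. split.
    + intros k. assert (hb : i - length s < length [x]) by (apply nth_error_Some; congruence).
      simpl in hb; lia.
    + intros [k|[k _]]; [|lia]. assert (hb : i < length s) by (apply nth_error_Some; congruence); lia.
Qed.

Lemma bad_snoc (A : QO) (s : list A) (x : A) :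
  bad A (s ++ [x]) <-> bad A s /\ forall y, In y s -> Rbad A y x.
Proof.
  unfold bad; split.
  - intros h; split.
    + intros i j u v hij hu hv. apply (h i j u v hij); apply nth_error_snoc; auto.
    + intros y hy. apply In_nth_error in hy; destruct hy as [i hi].
      assert (hb : i < length s) by (apply nth_error_Some; congruence).
      apply (h i (length s) y x hb); apply nth_error_snoc; auto.
  - intros [h k] i j u v hij hu hv. apply nth_error_snoc in hu, hv.
    destruct hv as [hv|[-> <-]].
    + destruct hu as [hu|[-> <-]]; [exact (h i j u v hij hu hv)|].
      assert (hb : j < length s) by (apply nth_error_Some; congruence). lia.
    + destruct hu as [hu|[-> <-]]; [|lia]. apply k. exact (nth_error_In _ _ hu).
Qed.

Lemma antichain_snoc (A : QO) (s : list A) (x : A) :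
  antichain A (s ++ [x]) <-> antichain A s /\ forall y, In y s -> Rinc A y x.
Proof.
  unfold antichain; split.
  - intros h; split.
    + intros i j u v hij hu hv. apply (h i j u v hij); apply nth_error_snoc; auto.
    + intros y hy. apply In_nth_error in hy; destruct hy as [i hi].
      assert (hb : i < length s) by (apply nth_error_Some; congruence).
      split; [apply (h i (length s))|apply (h (length s) i)]; try lia; apply nth_error_snoc; auto.
  - intros [h k] i j u v hij hu hv. apply nth_error_snoc in hu, hv.
    destruct hu as [hu|[-> <-]], hv as [hv|[-> <-]].
    + exact (h i j u v hij hu hv).
    + apply k. exact (nth_error_In _ _ hu).
    + apply (k v). exact (nth_error_In _ _ hv).
    + lia.
Qed.

Lemma bad_nil (A : QO) : bad A nil.
Proof. intros i j x y _ h; destruct i; discriminate h. Qed.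
Lemma antichain_nil (A : QO) : antichain A nil.
Proof. intros i j x y _ h; destruct i; discriminate h. Qed.

Lemma oRank_eq (A : QO) (a : Ord) : LE olt (Rbad A) (fun _ => True) a ->
  GE olt (Rbad A) (fun _ => True) a -> oRank A a.
Proof. apply rank_eq; [apply bad_nil|apply bad_snoc]. Qed.

Lemma wRank_eq (A : QO) (a : Ord) : LE olt (Rinc A) (fun _ => True) a ->
  GE olt (Rinc A) (fun _ => True) a -> wRank A a.
Proof. apply rank_eq; [apply antichain_nil|apply antichain_snoc]. Qed.

(** Antichains are bad sequences, so an upper bound on [o] and a lower bound on [w]
    determine both. *)
Lemma ranks_eq (A : QO) (a : Ord) : LE olt (Rbad A) (fun _ => True) a ->
  GE olt (Rinc A) (fun _ => True) a -> oRank A a /\ wRank A a.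
Proof.
  intros h k; split.
  - apply oRank_eq; [exact h|]. apply (fun h1 h2 h3 => GE_map olt_swo (fun x => x) h1 h2 h3 k); auto.
    + intros x x' _ _ [l _]; exact l.
    + apply olt_irrefl.
  - apply wRank_eq; [|exact k]. apply (fun h1 h2 h3 => LE_map olt_swo (fun x => x) h1 h2 h3 h); auto.
    + intros x x' _ _ [l _]; exact l.
    + apply olt_irrefl.
Qed.

(** * Ranks of unions *)

Section HessRanks.
Variables (I : Type) (ltI : I -> I -> Prop).
Hypothesis WI : swo ltI.
Let W := ltH_swo WI.
Notation LEH := (LE (ltH ltI)).
Notation GEH := (GE (ltH ltI)).

(** A move in one part shrinks that part to a residual and may leave the other whole, so one summand
    goes down, and the natural sum is strictly monotone in each. *)
Lemma LE_union (X : Type) (R : X -> X -> Prop) (S T : X -> Prop) (v w : Hess I) :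
  LEH R S v -> LEH R T w -> LEH R (fun x => S x \/ T x) (hadd v w).
Proof.
  remember (hadd v w) as u eqn:e. revert v w e S T.
  induction u as [u IH] using (well_founded_induction (swo_wf W)).
  intros v w -> S T hS hT. constructor; intros x [hx|hx].
  - destruct (LE_inv hS x hx) as (v' & hv & h). exists (hadd v' w); split; [apply hadd_mono_l; auto|].
    apply (LE_sub W (fun y => (S y /\ R x y) \/ T y)); [tauto|].
    exact (IH _ (hadd_mono_l w hv) v' w eq_refl _ _ h hT).
  - destruct (LE_inv hT x hx) as (w' & hw & h). exists (hadd v w'); split; [apply hadd_mono_r; auto|].
    apply (LE_sub W (fun y => S y \/ (T y /\ R x y))); [tauto|].
    exact (IH _ (hadd_mono_r v hw) v w' eq_refl _ _ hS h).
Qed.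

(** Incomparability keeps the other part intact after a move. For a target [c] below the sum,
    [lt_hadd] tells which summand can be lowered with the sum staying at or above [c]; that is the
    part to play in. *)
Lemma GE_union (X : Type) (R : X -> X -> Prop) (S T : X -> Prop) (v w : Hess I) :
  (forall x y, S x -> T y -> R x y /\ R y x) ->
  GEH R S v -> GEH R T w -> GEH R (fun x => S x \/ T x) (hadd v w).
Proof.
  remember (hadd v w) as u eqn:e. revert v w e S T.
  induction u as [u IH] using (well_founded_induction (swo_wf W)).
  intros v w -> S T hR hS hT. constructor; intros c hc.
  destruct (lt_hadd WI hc) as [(v' & hv & k)|(w' & hw & k)].
  - destruct (GE_inv hS hv) as (x & hx & h). exists x; split; [auto|].
    assert (k' : GEH R (fun y => (S y /\ R x y) \/ T y) (hadd v' w)).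
    { apply (IH _ (hadd_mono_l w hv) v' w eq_refl); auto. intros y z [hy _] hz; auto. }
    apply (fun h1 => GE_mono W _ (hadd v' w) h1 k k').
    intros y [[hy hxy]|hy]; [tauto|]. split; [auto|]. apply (hR x y hx hy).
  - destruct (GE_inv hT hw) as (x & hx & h). exists x; split; [auto|].
    assert (k' : GEH R (fun y => S y \/ (T y /\ R x y)) (hadd v w')).
    { apply (IH _ (hadd_mono_r v hw) v w' eq_refl); auto. intros y z hy [hz _]; auto. }
    apply (fun h1 => GE_mono W _ (hadd v w') h1 k k').
    intros y [hy|[hy hxy]]; [|tauto]. split; [auto|]. apply (hR y x hy hx).
Qed.

Lemma not_lt_single_0 (f : Hess I) x : ~ ltH ltI f (single x 0).
Proof. intros h; apply (lt_single WI) in h; destruct h; lia. Qed.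

Lemma LE_empty (X : Type) (R : X -> X -> Prop) (S : X -> Prop) (v : Hess I) :
  (forall x, ~ S x) -> LEH R S v.
Proof. intros h; constructor; intros x hx; destruct (h x hx). Qed.

Lemma GE_zero (X : Type) (R : X -> X -> Prop) (S : X -> Prop) x : GEH R S (single x 0).
Proof. constructor; intros v' h; destruct (not_lt_single_0 h). Qed.

End HessRanks.

Lemma hadd_ge (I : Type) (ltI : I -> I -> Prop) (WI : swo ltI) (f g : Hess I) :
  ~ ltH ltI (hadd f g) f.
Proof. intros (x & hx & _). change (at_ f x + at_ g x < at_ f x) in hx. lia. Qed.

Lemma lt_hadd_least (I : Type) (ltI : I -> I -> Prop) (WI : swo ltI) (i0 : I) (f d : Hess I) :
  (forall x, ~ ltI x i0) -> ltH ltI d (hadd f (single i0 1)) -> ltH ltI d f \/ d = f.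
Proof.
  intros hm hd. destruct (lt_hadd_ordered WI (f := f) (g := single i0 1)) with (2 := hd) as [h|(d' & h & ->)].
  - intros x y _ hy. destruct (classic (y = i0)) as [->|k]; [apply hm|].
    destruct (hy (single_neq 1 k)).
  - auto.
  - right. apply H_ext; intros x; rewrite hadd_at, (proj1 (lt_single1 WI d' i0) h); [lia|apply hm].
Qed.

(** * Cantor normal forms *)

Notation HO := (Hess Ord).
Notation ltO := (ltH olt).
Notation swoO := (ltH_swo olt_swo).

Definition hcnf (l : list Ord) : HO :=
  fold_right (fun b h => hadd (single b 1) h) (single ozero 0) l.

Definition opow_sum (l : list Ord) : RS := sumList (map (fun b => wrs (rep (opow b))) l).

Lemma antilex_nat_swo (a : Ord) : swo (rrel (antilexRS (rep a) natRS 0)).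
Proof. exact (@AL_swo _ _ (WO_swo (rep a)) nat lt 0 nat_swo Nat.nlt_0_r). Qed.

Lemma otype_opow (b : Ord) : otype (rrel (antilexRS (rep b) natRS 0)) ltO (single b 1).
Proof.
  destruct (@antilex_rep_embed b natRS 0) as (F & hF & IF). exists F; split; [exact hF|].
  intros u; rewrite (lt_single1 olt_swo), IF. reflexivity.
Qed.

Lemma rep_opow (b : Ord) : iso (rep (opow b)) (antilexRS (rep b) natRS 0).
Proof. apply rep_ordOf, antilex_nat_swo. Qed.

Lemma bis_opow (b : Ord) : bis ltO olt (single b 1) (opow b).
Proof. exact (bis_of_otype swoO (rep_opow b) (otype_opow b)). Qed.

(** Concatenation realises the ordinal sum, and this is the natural sum because no exponent of [g]
    exceeds one of [f]. *)
Lemma otype_sum (v w : RS) (f g : HO) :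
  (forall x y, at_ f x <> 0 -> at_ g y <> 0 -> ~ olt x y) ->
  otype (rrel v) ltO f -> otype (rrel w) ltO g -> otype (rrel (sumRS v w)) ltO (hadd f g).
Proof.
  intros hs (F & hF & IF) (G & hG & IG).
  exists (fun x => match x with inl a => F a | inr b => hadd f (G b) end); split.
  - intros [x|x] [y|y] h; simpl in h.
    + apply hF, h.
    + pose proof (proj2 (IF _) (ex_intro _ x eq_refl)) as k.
      destruct (proj1 (swo_not_lt swoO _ _) (hadd_ge olt_swo (f := f) (g := G y))) as [l|l].
      * exact (swo_trans swoO _ _ _ k l).
      * rewrite <- l; exact k.
    + destruct h.
    + apply (hadd_mono_r), hG, h.
  - intros u; split.
    + intros hu. destruct (lt_hadd_ordered olt_swo hs hu) as [h|(d' & h & ->)].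
      * apply IF in h; destruct h as [x <-]. exists (inl x); reflexivity.
      * apply IG in h; destruct h as [x <-]. exists (inr x); reflexivity.
    + intros [[x|x] <-].
      * pose proof (proj2 (IF _) (ex_intro _ x eq_refl)) as k.
        destruct (proj1 (swo_not_lt swoO _ _) (hadd_ge olt_swo (f := f) (g := g))) as [l|l].
        -- exact (swo_trans swoO _ _ _ k l).
        -- rewrite <- l; exact k.
      * apply hadd_mono_r, IG. exists x; reflexivity.
Qed.

Lemma hcnf_supp (l : list Ord) (x : Ord) : at_ (hcnf l) x <> 0 <-> In x l.
Proof.
  induction l as [|b l IH]; simpl hcnf.
  - rewrite single_0_at; simpl; tauto.
  - rewrite hadd_at. destruct (classic (x = b)) as [->|h].
    + rewrite single_eq; simpl; split; [auto|lia].
    + rewrite (single_neq 1 h), Nat.add_0_l, IH; simpl. split; [auto|intros [k|k]; congruence].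
Qed.

Lemma opow_sum_swo (l : list Ord) : swo (rrel (opow_sum l)).
Proof.
  induction l as [|b l IH]; [exact empty_swo|]. apply sum_swo; [apply WO_swo|exact IH].
Qed.

Definition desc (l : list Ord) : Prop := StronglySorted (fun x y => ole y x) l.

Lemma ole_trans (a b c : Ord) : ole a b -> ole b c -> ole a c.
Proof.
  intros [h| ->]; [|auto]. intros [k| <-]; left; [exact (olt_trans h k)|exact h].
Qed.

Lemma otype_hcnf (l : list Ord) : desc l -> otype (rrel (opow_sum l)) ltO (hcnf l).
Proof.
  intros hl; induction hl as [|b l hl IH hb].
  - exists (fun x : emptyRS => match x with end); split; [intros []|]. intros u; split.
    + intros h; destruct (not_lt_single_0 olt_swo h).
    + intros [[] _].
  - apply otype_sum; [|exact (otype_iso (rep_opow b) (otype_opow b))|exact IH].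
    intros x y hx hy h.
    assert (x = b) as ->.
    { apply NNPP; intros k; exact (hx (single_neq 1 k)). }
    apply hcnf_supp in hy. rewrite Forall_forall in hb. apply (proj1 (ole_not_lt _ _) (hb y hy) h).
Qed.

Lemma cnf_desc (a : Ord) (l : list Ord) : IsCNF a l -> desc l.
Proof.
  intros [h _]. apply Sorted_StronglySorted; [|exact h].
  intros x y z h1 h2; exact (ole_trans h2 h1).
Qed.

Lemma bis_hcnf (a : Ord) (l : list Ord) : IsCNF a l -> bis ltO olt (hcnf l) a.
Proof.
  intros h. exact (bis_of_otype swoO (proj2 h) (otype_hcnf (cnf_desc h))).
Qed.

(** Strip one copy of the leading term and list the rest by induction. *)
Lemma hcnf_surj (h : HO) : exists l, desc l /\ hcnf l = h.
Proof.
  induction h as [h IH] using (well_founded_induction (swo_wf swoO)).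
  destruct (classic (exists x, proj1_sig h x <> 0)) as [k|k].
  - destruct (FS_max_supp olt_swo h k) as (m & hm & km). fold (at_ h m) in hm.
    destruct (IH (hsub h (single m 1))) as (l & hl & el).
    + apply ltH_intro with m.
      * rewrite hsub_at, single_eq; lia.
      * intros y hy; rewrite hsub_at, single_neq; [lia|]. intros ->; exact (olt_irrefl hy).
    + assert (e : hcnf (m :: l) = h).
      { simpl; rewrite el. apply H_ext; intros x; rewrite hadd_at, hsub_at.
        destruct (classic (x = m)) as [->|n]; [rewrite single_eq; lia|rewrite (single_neq 1 n); lia]. }
      exists (m :: l); split; [|exact e]. constructor; [exact hl|].
      apply Forall_forall; intros x hx. apply ole_not_lt; intros hmx.
      assert (hx' : at_ (hcnf (m :: l)) x <> 0) by (apply hcnf_supp; simpl; auto).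
      rewrite e in hx'. exact (hx' (km x hmx)).
  - exists nil; split; [constructor|]. apply H_ext; intros x; simpl hcnf. rewrite single_0_at.
    symmetry; apply NNPP; intros n; apply k; exists x; exact n.
Qed.

(** This gives every ordinal a Cantor normal form. If [a] matched no natural sum, all natural sums
    would match ordinals below [a]; but sending [b] to the partner of omega^b is strictly increasing
    on [Ord], so its value at [a] cannot lie below [a]. *)
Lemma bis_HO_total (a : Ord) : exists h : HO, bis ltO olt h a.
Proof.
  destruct (bis_compare swoO olt_swo) as [h|h]; [|apply h].
  destruct (choice _ h) as [F hF]. apply NNPP; intros hn.
  assert (hb : forall x, olt (F x) a).
  { intros x. destruct (olt_total (F x) a) as [k|[k|k]]; [exact k| |]; exfalso; apply hn.
    - exists x; rewrite <- k; apply hF.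
    - destruct (bis_bwd (hF x) _ k) as (x' & _ & k'). exists x'; exact k'. }
  apply (@mono_inflationary Ord olt (fun b => F (single b 1)) olt_swo) with a; [|apply hb].
  intros x y hxy. apply (bis_mono swoO olt_swo (hF _) (hF _)). apply (single_lt olt_swo); auto.
Qed.

Lemma bis_HO_uniq (h : HO) (a b : Ord) : bis ltO olt h a -> bis ltO olt h b -> a = b.
Proof. apply (bis_fun swoO olt_swo). Qed.

Lemma cnf_spec (a : Ord) : IsCNF a (cnf a).
Proof.
  unfold cnf; apply epsilon_spec.
  destruct (bis_HO_total a) as [h hh]. destruct (hcnf_surj h) as (l & hl & <-).
  exists l; split; [apply StronglySorted_Sorted, hl|].
  assert (e : a = ordOf (opow_sum l)).
  { apply (bis_HO_uniq hh). apply (@bis_of_otype (opow_sum l)); [exact swoO| |apply otype_hcnf, hl].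
    apply rep_ordOf, opow_sum_swo. }
  rewrite e. apply rep_ordOf, opow_sum_swo.
Qed.

Lemma bis_cnf (a : Ord) : bis ltO olt (hcnf (cnf a)) a.
Proof. apply bis_hcnf, cnf_spec. Qed.

Lemma bis_osucc (h : HO) (a : Ord) :
  bis ltO olt h a -> bis ltO olt (hadd h (single ozero 1)) (osucc a).
Proof.
  intros hb; constructor.
  - intros u hu. destruct (lt_hadd_least olt_swo (i0 := ozero)) with (2 := hu) as [k| ->].
    + exact ozero_le.
    + destruct (bis_fwd hb _ k) as (b & h1 & h2). exists b; split; [|exact h2].
      exact (olt_trans h1 (olt_osucc a)).
    + exists a; split; [apply olt_osucc|exact hb].
  - intros b k. apply lt_osucc, (swo_not_lt olt_swo) in k.
    assert (l : ltO h (hadd h (single ozero 1))).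
    { apply ltH_intro with ozero; rewrite ?hadd_at, ?single_eq; [lia|]. intros y hy.
      rewrite hadd_at, single_neq; [lia|]. intros ->; exact (olt_irrefl hy). }
    destruct k as [k| ->].
    + destruct (bis_bwd hb _ k) as (u & h1 & h2). exists u; split; [|exact h2].
      exact (swo_trans swoO _ _ _ h1 l).
    + exists h; split; [exact l|exact hb].
Qed.

Lemma bis_ozero : bis ltO olt (single ozero 0) ozero.
Proof.
  constructor.
  - intros u hu; destruct (not_lt_single_0 olt_swo hu).
  - intros b hb; destruct (ozero_le hb).
Qed.

Definition osn (k : nat) (a : Ord) : Ord := Nat.iter k osucc a.

Lemma bis_osn (k : nat) (h : HO) (a : Ord) :
  bis ltO olt h a -> bis ltO olt (hadd h (single ozero k)) (osn k a).
Proof.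
  intros hb; induction k as [|k IH].
  - rewrite hadd_0; exact hb.
  - replace (S k) with (k + 1) at 1 by lia. rewrite <- single_add, <- hadd_assoc.
    apply bis_osucc, IH.
Qed.

Lemma finRS_swo (k : nat) : swo (rrel (finRS k)).
Proof.
  split.
  - intros [x hx]; revert hx. induction x as [x IH] using lt_wf_ind. intros hx.
    constructor; intros [y hy] h. apply IH, h.
  - intros [x hx] [y hy] [z hz]; simpl; lia.
  - intros [x hx] [y hy]; simpl. destruct (lt_eq_lt_dec x y) as [[h|h]|h]; auto.
    right; left. apply eq_sig_hprop; [intros; apply proof_irrelevance|exact h].
Qed.

(** Stated for any exponents with a least element, because finite values are needed both over [Ord]
    and over [Lim]. *)
Lemma bis_ordnat (I : Type) (ltI : I -> I -> Prop) (i0 : I) (k : nat) : swo ltI ->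
  (forall x, ~ ltI x i0) -> bis (ltH ltI) olt (single i0 k) (ordnat k).
Proof.
  intros WI hm. apply (@bis_of_otype (finRS k)); [exact (ltH_swo WI)|apply rep_ordOf, finRS_swo|].
  exists (fun x => single i0 (proj1_sig x)); split.
  - intros [x hx] [y hy] h; simpl in *. apply (single_mono WI), h.
  - intros u; split.
    + intros hu. apply (lt_single WI) in hu; destruct hu as [h1 h2].
      exists (exist _ (at_ u i0) h1); simpl. apply H_ext; intros y.
      destruct (classic (y = i0)) as [->|n]; [apply single_eq|]. rewrite (single_neq _ n).
      symmetry; apply h2. destruct (swo_total WI i0 y) as [k1|[k1|k1]]; [exact k1|congruence|].
      destruct (hm _ k1).
    + intros [[x hx] <-]; simpl. apply (single_mono WI), hx.
Qed.

(** * Limits and powers of two *)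

(** [Lim] is the class of ordinals that are zero or limit. *)
Definition Lim : Type := {a : Ord | forall b, a <> osucc b}.
Definition ltL (x y : Lim) : Prop := olt (proj1_sig x) (proj1_sig y).
Notation HL := (Hess Lim).
Notation ltHL := (ltH ltL).

Lemma L_eq (x y : Lim) : proj1_sig x = proj1_sig y -> x = y.
Proof. intros h; apply eq_sig_hprop; [intros; apply proof_irrelevance|exact h]. Qed.

Lemma ltL_swo : swo ltL.
Proof.
  split.
  - intros [x hx]; revert hx. induction x as [x IH] using (well_founded_induction olt_wf).
    intros hx; constructor; intros [y hy] h. apply IH, h.
  - intros x y z; apply olt_trans.
  - intros x y. destruct (olt_total (proj1_sig x) (proj1_sig y)) as [h|[h|h]]; auto.
    right; left; apply L_eq, h.
Qed.
Notation swoL := (ltH_swo ltL_swo).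

Lemma ozero_L : forall b, ozero <> osucc b.
Proof. intros b h. apply (@ozero_le b). rewrite h; apply olt_osucc. Qed.
Definition L0 : Lim := exist _ ozero ozero_L.
Lemma L0_least (x : Lim) : ~ ltL x L0.
Proof. apply ozero_le. Qed.

Lemma osn_decomp (a : Ord) : exists (l : Lim) (k : nat), a = osn k (proj1_sig l).
Proof.
  induction a as [a IH] using (well_founded_induction olt_wf).
  destruct (classic (exists b, a = osucc b)) as [[b ->]|h].
  - destruct (IH b (olt_osucc b)) as (l & k & ->). exists l, (S k); reflexivity.
  - unshelve eexists (exist _ a _); [intros b e; apply h; exists b; exact e|].
    exists 0; reflexivity.
Qed.

Lemma osn_le (k : nat) (a : Ord) : ~ olt (osn k a) a.
Proof.
  induction k as [|k IH]; [apply olt_irrefl|].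
  intros h; apply IH. exact (olt_trans (olt_osucc _) h).
Qed.

Lemma osn_mono_k (j k : nat) (a : Ord) : j < k -> olt (osn j a) (osn k a).
Proof.
  intros h; induction h as [|k h IH]; [apply olt_osucc|].
  exact (olt_trans IH (olt_osucc _)).
Qed.

Lemma osucc_lt_L (x : Lim) (a : Ord) : olt a (proj1_sig x) -> olt (osucc a) (proj1_sig x).
Proof.
  intros h. destruct (olt_total (osucc a) (proj1_sig x)) as [k|[k|k]]; [exact k| |].
  - destruct x as [x hx]; simpl in k; destruct (hx a (eq_sym k)).
  - apply lt_osucc in k; destruct (k h).
Qed.

Lemma osn_lt_L (k : nat) (x : Lim) (a : Ord) : olt a (proj1_sig x) -> olt (osn k a) (proj1_sig x).
Proof. intros h; induction k as [|k IH]; [exact h|apply osucc_lt_L, IH]. Qed.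

Lemma osn_lt (j k : nat) (x y : Lim) :
  olt (osn j (proj1_sig x)) (osn k (proj1_sig y)) <-> ltL x y \/ (x = y /\ j < k).
Proof.
  assert (A : forall j k x y, ltL x y \/ (x = y /\ j < k) -> olt (osn j (proj1_sig x)) (osn k (proj1_sig y))).
  { clear; intros j k x y [h|[-> h]]; [|apply osn_mono_k, h].
    assert (h' : olt (osn j (proj1_sig x)) (proj1_sig y)) by apply osn_lt_L, h.
    destruct (olt_total (osn j (proj1_sig x)) (osn k (proj1_sig y))) as [l|[l|l]]; [exact l| |].
    - rewrite l in h'; destruct (osn_le _ h').
    - destruct (osn_le _ (olt_trans l h')). }
  split; [|apply A]. intros h. apply NNPP; intros n. apply not_or_and in n; destruct n as [n1 n2].
  apply (swo_not_lt ltL_swo) in n1.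
  assert (B : (ltL y x \/ (y = x /\ k < j)) \/ (y = x /\ k = j)).
  { destruct n1 as [n1|n1]; [auto|]. subst y. destruct (lt_eq_lt_dec j k) as [[l|l]|l]; auto.
    destruct n2; auto. }
  destruct B as [B|[-> ->]]; [|exact (olt_irrefl h)].
  exact (olt_irrefl (olt_trans h (A _ _ _ _ B))).
Qed.

Lemma osn_inj (j k : nat) (x y : Lim) :
  osn j (proj1_sig x) = osn k (proj1_sig y) -> x = y /\ j = k.
Proof.
  intros e. destruct (swo_total ltL_swo x y) as [h|[->|h]].
  - assert (l : olt (osn j (proj1_sig x)) (osn k (proj1_sig y))) by (apply osn_lt; auto).
    rewrite e in l; destruct (olt_irrefl l).
  - split; [reflexivity|]. destruct (lt_eq_lt_dec j k) as [[h|h]|h]; [|exact h|];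
    pose proof (osn_mono_k (proj1_sig y) h) as l; rewrite e in l; destruct (olt_irrefl l).
  - assert (l : olt (osn k (proj1_sig y)) (osn j (proj1_sig x))) by (apply osn_lt; auto).
    rewrite e in l; destruct (olt_irrefl l).
Qed.

Lemma testbit_S (n j : nat) : Nat.testbit n (S j) = Nat.testbit (Nat.div2 n) j.
Proof. reflexivity. Qed.

Lemma testbit_lt (k n m : nat) : Nat.testbit n k = false -> Nat.testbit m k = true ->
  (forall j, k < j -> Nat.testbit n j = Nat.testbit m j) -> n < m.
Proof.
  revert n m; induction k as [|k IH]; intros n m hn hm h;
    rewrite (Nat.div2_odd n), (Nat.div2_odd m).
  - assert (e : Nat.div2 n = Nat.div2 m).
    { apply Nat.bits_inj; intros j. rewrite <- !testbit_S; apply h; lia. }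
    rewrite !Nat.bit0_odd in *. rewrite hn, hm, e; simpl; lia.
  - assert (l : Nat.div2 n < Nat.div2 m).
    { apply IH; rewrite <- ?testbit_S; auto. intros j hj; rewrite <- !testbit_S; apply h; lia. }
    destruct (Nat.odd n), (Nat.odd m); simpl; lia.
Qed.

Lemma testbit_bound (k n : nat) : (forall j, k <= j -> Nat.testbit n j = false) -> n < 2 ^ k.
Proof.
  revert n; induction k as [|k IH]; intros n h.
  - assert (e : n = 0) by (apply Nat.bits_inj; intros j; rewrite h, Nat.bits_0; [reflexivity|lia]).
    subst n; simpl; lia.
  - specialize (IH (Nat.div2 n)). rewrite (Nat.div2_odd n).
    assert (l : Nat.div2 n < 2 ^ k) by (apply IH; intros j hj; rewrite <- testbit_S; apply h; lia).
    simpl Nat.pow. destruct (Nat.odd n); simpl; lia.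
Qed.

Lemma testbit_big (n j : nat) : n <= j -> Nat.testbit n j = false.
Proof.
  intros h. destruct (Nat.eq_dec n 0) as [->|hn]; [apply Nat.bits_0|].
  apply Nat.bits_above_log2. apply Nat.log2_lt_pow2; [lia|].
  apply Nat.le_lt_trans with j; [exact h|apply Nat.pow_gt_lin_r; lia].
Qed.

Lemma testbit_lt_pow2 (k n j : nat) : n < 2 ^ k -> k <= j -> Nat.testbit n j = false.
Proof.
  intros h hj. destruct (Nat.eq_dec n 0) as [->|hn]; [apply Nat.bits_0|].
  apply Nat.bits_above_log2. apply Nat.lt_le_trans with k; [|exact hj].
  apply Nat.log2_lt_pow2; [lia|exact h].
Qed.

Lemma nat_of_bits (N : nat) (g : nat -> bool) : (forall k, N <= k -> g k = false) ->
  exists n, forall k, Nat.testbit n k = g k.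
Proof.
  revert g; induction N as [|N IH]; intros g h.
  - exists 0; intros k. rewrite Nat.bits_0, h; [reflexivity|lia].
  - destruct (IH (fun k => g (S k))) as [n hn]; [intros k hk; apply h; lia|].
    exists (2 * n + Nat.b2n (g 0)); intros [|k].
    + apply Nat.testbit_0_r.
    + rewrite Nat.testbit_succ_r. apply hn.
Qed.

Lemma osn_infinite (l : list Ord) (a : Ord) : exists N, forall k, N <= k -> ~ In (osn k a) l.
Proof.
  induction l as [|b l [N hN]]; [exists 0; intros k _ []|].
  destruct (classic (exists k, b = osn k a)) as [[k ->]|h].
  - exists (S (Nat.max k N)); intros j hj [e|e].
    + assert (l' : olt (osn k a) (osn j a)) by (apply osn_mono_k; lia).
      rewrite e in l'; exact (olt_irrefl l').
    + apply (hN j); [lia|exact e].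
  - exists N; intros k hk [e|e]; [apply h; exists k; exact e|exact (hN k hk e)].
Qed.

(** The support meets the block l, l+1, l+2, ... in finitely many points, so the block spells out
    the binary digits of one natural number. *)
Lemma collect_bits (f : @FS Ord bool false) : exists h : HL,
  forall l k, Nat.testbit (at_ h l) k = proj1_sig f (osn k (proj1_sig l)).
Proof.
  destruct f as [f [s hs]]; simpl.
  destruct (choice (fun (l : Lim) n => forall k, Nat.testbit n k = f (osn k (proj1_sig l)))) as [g hg].
  - intros l. destruct (osn_infinite s (proj1_sig l)) as [N hN].
    apply (@nat_of_bits N). intros k hk. destruct (f (osn k (proj1_sig l))) eqn:e; [|reflexivity].
    destruct (hN k hk). apply hs; congruence.
  - assert (fin : exists s' : list Lim, forall l, g l <> 0 -> In l s').
    { assert (Q : exists s' : list Lim, forall l k, In (osn k (proj1_sig l)) s -> In l s').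
      { clear. induction s as [|b s [s' IH]]; [exists nil; intros l k []|].
        destruct (osn_decomp b) as (l0 & k0 & ->). exists (l0 :: s'). intros l k [e|e].
        - left; apply (osn_inj _ _ _ _ e).
        - right; exact (IH l k e). }
      destruct Q as [s' hs']. exists s'; intros l hl. apply NNPP; intros n. apply hl.
      apply Nat.bits_inj; intros k. rewrite hg, Nat.bits_0.
      destruct (f (osn k (proj1_sig l))) eqn:e; [|reflexivity]. destruct n.
      apply (hs' l k), hs; congruence. }
    exists (hfun fin). exact hg.
Qed.

Lemma antilex_bool_swo (a : Ord) : swo (rrel (antilexRS (rep a) boolRS false)).
Proof.
  refine (@AL_swo _ _ (WO_swo (rep a)) bool ltbool false bool_swo _).
  intros d [_ h]; discriminate.
Qed.

Lemma rep_pow2 (a : Ord) : iso (rep (pow2 a)) (antilexRS (rep a) boolRS false).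
Proof. apply rep_ordOf, antilex_bool_swo. Qed.

(** A finite subset of an ordinal is read, block of length [omega] by block, as the
    binary digits of the coefficients of a natural sum. *)
Lemma bis_pow2 (l0 : Lim) (K : nat) :
  bis ltHL olt (single l0 (2 ^ K)) (pow2 (osn K (proj1_sig l0))).
Proof.
  set (a := osn K (proj1_sig l0)).
  apply (bis_of_otype swoL (rep_pow2 a)).
  destruct (@antilex_rep_embed a boolRS false) as (F & hF & IF).
  destruct (choice _ collect_bits) as [G hG].
  exists (fun f => G (F f)); split.
  - intros f g hfg. apply hF in hfg. destruct hfg as (b & [hb1 hb2] & kb).
    destruct (osn_decomp b) as (l & k & ->). apply ltH_intro with l.
    + apply (@testbit_lt k); rewrite ?hG; auto. intros j hj; rewrite !hG. apply kb, osn_mono_k, hj.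
    + intros l' hl'. apply Nat.bits_inj; intros j. rewrite !hG. apply kb, osn_lt; auto.
  - intros u. rewrite (lt_single ltL_swo); split.
    + intros [h1 h2].
      destruct (choice (fun b (v : bool) => forall l k, b = osn k (proj1_sig l) -> v = Nat.testbit (at_ u l) k)) as [f hf].
      { intros b; destruct (osn_decomp b) as (l & k & ->). exists (Nat.testbit (at_ u l) k).
        intros l' k' e; apply osn_inj in e; destruct e as [-> ->]; reflexivity. }
      assert (fin : exists s : list Ord, forall b, f b <> false -> In b s).
      { destruct u as [u [s hs]]; simpl in *.
        (* Bit [k] of a number [n] vanishes once [k >= n], so the positions below [u l] cover all
           digits of the coefficient at [l]. *)
        exists (flat_map (fun l : Lim => map (fun k => osn k (proj1_sig l)) (List.seq 0 (u l))) s).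
        intros b hb. destruct (osn_decomp b) as (l & k & ->). rewrite (hf _ l k eq_refl) in hb.
        apply in_flat_map; exists l; split.
        - apply hs; intros e; rewrite e, Nat.bits_0 in hb; congruence.
        - apply in_map_iff; exists k; split; [reflexivity|]. apply in_seq; split; [lia|].
          destruct (le_lt_dec (u l) k) as [h|h]; [|exact h].
          rewrite (testbit_big h) in hb; congruence. }
      destruct (proj2 (IF (exist _ f fin))) as [f0 e0].
      { intros b hb; simpl. destruct (osn_decomp b) as (l & k & ->).
        rewrite (hf _ l k eq_refl). unfold a in hb. rewrite osn_lt in hb.
        destruct (swo_total ltL_swo l l0) as [h|[->|h]].
        - destruct hb; auto.
        - apply (@testbit_lt_pow2 K); [exact h1|].
          destruct (le_lt_dec K k) as [h|h]; [exact h|destruct hb; auto].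
        - rewrite h2 by exact h; apply Nat.bits_0. }
      exists f0. apply H_ext; intros l; apply Nat.bits_inj; intros k.
      rewrite hG, e0; simpl. apply hf; reflexivity.
    + intros [f <-]. pose proof (proj1 (IF (F f)) (ex_intro _ f eq_refl)) as hf. split.
      * apply testbit_bound; intros j hj. rewrite hG; apply hf. intros h; apply osn_lt in h.
        destruct h as [h|[_ h]]; [exact (wf_irrefl (swo_wf ltL_swo) _ h)|lia].
      * intros l hl. apply Nat.bits_inj; intros j. rewrite hG, Nat.bits_0. apply hf.
        intros h; apply osn_lt in h. destruct h as [h|[-> _]].
        -- exact (wf_irrefl (swo_wf ltL_swo) _ (swo_trans ltL_swo _ _ _ h hl)).
        -- exact (wf_irrefl (swo_wf ltL_swo) _ hl).
Qed.

(** * Transferable width *)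

Notation full := (fun _ => True).

Definition qtrans (A : QO) : Prop := forall x y z : A, qle A x y -> qle A y z -> qle A x z.

(** A form of transferability of the width, [j] times over: below a suitable point
    [z] one finds any prescribed width under [v], and what lies outside the down-set
    of [z] still has the property. *)
Fixpoint Cond (V : Type) (lt : V -> V -> Prop) (A : QO) (v : V) (j : nat) (S : A -> Prop) : Prop :=
  match j with
  | 0 => True
  | Datatypes.S j' => forall d, lt d v -> exists z, S z /\
      GE lt (Rinc A) (fun y => S y /\ ~ qle A z y) d /\ Cond lt A v j' (fun y => S y /\ ~ qle A y z)
  end.

Lemma Cond_sub (V : Type) (lt : V -> V -> Prop) (W : swo lt) (A : QO) (v : V) (j : nat)
    (S S' : A -> Prop) : (forall x, S x -> S' x) -> Cond lt A v j S -> Cond lt A v j S'.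
Proof.
  revert S S'; induction j as [|j IH]; intros S S' hS; [auto|]. simpl; intros h d hd.
  destruct (h d hd) as (z & hz & h1 & h2). exists z; split; [auto|split].
  - apply (GE_sub W (fun y => S y /\ ~ qle A z y)); [|exact h1]. intros y [k1 k2]; auto.
  - apply (IH (fun y => S y /\ ~ qle A y z)); [|exact h2]. intros y [k1 k2]; auto.
Qed.

Lemma Cond_bis (V V' : Type) (lt : V -> V -> Prop) (lt' : V' -> V' -> Prop) (W : swo lt)
    (A : QO) (v : V) (v' : V') (j : nat) (S : A -> Prop) :
  bis lt lt' v v' -> Cond lt A v j S -> Cond lt' A v' j S.
Proof.
  intros hb; revert S; induction j as [|j IH]; intros S; [auto|]. simpl; intros h d hd.
  destruct (bis_bwd hb _ hd) as (u & hu & hbu).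
  destruct (h u hu) as (z & hz & h1 & h2). exists z; split; [auto|split; [|auto]].
  exact (GE_bis W hbu h1).
Qed.

(** * Antichains *)

Lemma gamma_GE (n m : nat) : m <= n ->
  GE ltO (Rinc (Gamma n)) (fun x => proj1_sig x < m) (single ozero m).
Proof.
  induction m as [|m IH]; intros hm.
  - apply GE_zero, olt_swo.
  - assert (h : GE ltO (Rinc (Gamma n)) (fun x => proj1_sig x = m \/ proj1_sig x < m)
                   (hadd (single ozero 1) (single ozero m))).
    { apply (GE_union olt_swo); [| |apply IH; lia].
      - intros [x hx] [y hy] e h; simpl in *. split; split; intros k; apply (f_equal (@proj1_sig _ _)) in k; simpl in k; lia.
      - constructor; intros u hu. exists (exist _ m hm); split; [reflexivity|].
        replace u with (single ozero 0); [apply GE_zero, olt_swo|].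
        symmetry; apply H_ext; intros x. rewrite single_0_at. apply (proj1 (lt_single1 olt_swo _ _) hu).
        apply ozero_le. }
    rewrite single_add in h. apply (GE_sub swoO (fun x : Gamma n => proj1_sig x = m \/ proj1_sig x < m)); [|exact h].
    intros x k; lia.
Qed.

Lemma gamma_LE (n m : nat) :
  LE ltO (Rbad (Gamma n)) (fun x => proj1_sig x < m) (single ozero m).
Proof.
  induction m as [|m IH].
  - apply LE_empty; intros x h; lia.
  - assert (h : LE ltO (Rbad (Gamma n)) (fun x => proj1_sig x = m \/ proj1_sig x < m)
                   (hadd (single ozero 1) (single ozero m))).
    { apply (LE_union olt_swo); [|exact IH]. constructor; intros x hx.
      exists (single ozero 0); split; [apply (single_mono olt_swo); auto|].
      apply LE_empty; intros y [hy k]. apply k. simpl.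
      apply eq_sig_hprop; [intros; apply proof_irrelevance|congruence]. }
    rewrite single_add in h. apply (LE_sub swoO (fun x : Gamma n => proj1_sig x = m \/ proj1_sig x < m)); [|exact h].
    intros x k; lia.
Qed.

Lemma gamma_full_GE (n : nat) : GE ltO (Rinc (Gamma n)) full (single ozero n).
Proof. apply (GE_sub swoO (fun x : Gamma n => proj1_sig x < n)); [auto|apply gamma_GE; auto]. Qed.

Lemma gamma_full_LE (n : nat) : LE ltO (Rbad (Gamma n)) full (single ozero n).
Proof.
  apply (LE_sub swoO (fun x : Gamma n => proj1_sig x < n)); [|apply gamma_LE; auto].
  intros x _; exact (proj2_sig x).
Qed.

(** * Lexicographic sums *)

Section LexSum.
Variables (I : Type) (ltI : I -> I -> Prop) (F : I -> QO).
Hypothesis WI : swo ltI.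
Notation LS := (@LexSum I ltI F).

Lemma lexsum_le_fiber i (y y' : F i) : qle LS (existT _ i y) (existT _ i y') <-> qle (F i) y y'.
Proof.
  simpl; split.
  - intros [[e h]|h].
    + rewrite (proof_irrelevance _ e eq_refl) in h; exact h.
    + destruct (wf_irrefl (swo_wf WI) _ h).
  - intros h; left; exists eq_refl; exact h.
Qed.

Lemma lexsum_le_lt i j (y : F i) (z : F j) : qle LS (existT _ i y) (existT _ j z) -> i <> j -> ltI i j.
Proof. intros [[e _]|h] n; [destruct (n e)|exact h]. Qed.

Lemma lexsum_trans : (forall i, qtrans (F i)) -> qtrans LS.
Proof.
  intros h [i x] [j y] [k z] [[e hxy]|hxy] [[e' hyz]|hyz]; simpl in *.
  - subst j k; left; exists eq_refl; exact (h i _ _ _ hxy hyz).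
  - subst j; right; exact hyz.
  - subst k; right; exact hxy.
  - right; exact (swo_trans WI _ _ _ hxy hyz).
Qed.

Lemma lexsum_fiber_LE i (K : F i -> Prop) (v : HO) : LE ltO (Rbad (F i)) K v ->
  LE ltO (Rbad LS) (fun x => exists y, x = existT _ i y /\ K y) v.
Proof.
  revert K; induction v as [v IH] using (well_founded_induction (swo_wf swoO)).
  intros K h. constructor; intros x (y & -> & hy). destruct (LE_inv h y hy) as (v' & hv & h').
  exists v'; split; [exact hv|].
  apply (LE_sub swoO (fun x => exists y', x = existT _ i y' /\ K y' /\ Rbad (F i) y y')).
  - intros x [(y' & -> & hy') hr]. exists y'; repeat split; auto.
    intros k; apply hr, lexsum_le_fiber, k.
  - exact (IH v' hv _ h').
Qed.

Lemma lexsum_fiber_GE i (v : HO) : GE ltO (Rinc (F i)) full v ->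
  GE ltO (Rinc LS) (fun x => projT1 x = i) v.
Proof.
  apply (GE_map swoO (fun y => existT (fun i => qcar (F i)) i y)); auto.
  - intros y y' _ _ [h1 h2]; split; rewrite lexsum_le_fiber; assumption.
  - apply (wf_irrefl (swo_wf swoO)).
Qed.

Variables (v : I -> HO) (t : HO).

(** A first move in fibre [j] confines later moves to indices at most [j]. Here [u j] bounds
    everything of index below [j], so [hadd (u j) (v j)] bounds what remains, even charging fibre
    [j] in full. *)
Lemma lexsum_LE (u : I -> HO) :
  (forall i, LE ltO (Rbad (F i)) full (v i)) ->
  (forall j i, ltI j i -> ltO (hadd (u j) (v j)) (u i)) ->
  (forall j, ltO (hadd (u j) (v j)) t) -> LE ltO (Rbad LS) full t.
Proof.
  intros hv hu ht.
  assert (hr : forall j, LE ltO (Rbad LS) (fun x => ltI (projT1 x) j) (u j) ->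
     forall y S, LE ltO (Rbad LS) (fun x => S x /\ Rbad LS (existT _ j y) x) (hadd (u j) (v j))).
  { intros j hj y S.
    apply (LE_sub swoO (fun x => ltI (projT1 x) j \/ exists y, x = existT _ j y /\ True)).
    - intros [j' y'] [_ k]; simpl. destruct (swo_total WI j' j) as [l|[->|l]]; [auto| |].
      + right; exists y'; auto.
      + destruct k; right; exact l.
    - apply (LE_union olt_swo); [exact hj|]. apply lexsum_fiber_LE, hv. }
  assert (hp : forall i, LE ltO (Rbad LS) (fun x => ltI (projT1 x) i) (u i)).
  { intros i; induction i as [i IH] using (well_founded_induction (swo_wf WI)).
    constructor; intros [j y] hj; simpl in hj. exists (hadd (u j) (v j)); split; [auto|].
    apply hr, IH, hj. }
  constructor; intros [j y] _. exists (hadd (u j) (v j)); split; [auto|]. apply hr, hp.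
Qed.

(** For each target below [t] one fibre is already wide enough, and the whole play can stay inside
    it. *)
Lemma lexsum_GE :
  (forall i, GE ltO (Rinc (F i)) full (v i)) ->
  (forall c, ltO c t -> exists i, ltO c (v i)) -> GE ltO (Rinc LS) full t.
Proof.
  intros hv hc. constructor; intros c h. destruct (hc c h) as [i hi].
  destruct (GE_inv (lexsum_fiber_GE (hv i)) hi) as (x & hx & k). exists x; split; [auto|].
  apply (GE_sub swoO (fun y => projT1 y = i /\ Rinc LS x y)); [|exact k]. tauto.
Qed.

(** The point [z] is taken in a fibre [i'] beyond a fibre [i] that is wide enough for [d]. Fibre [i]
    lies strictly below [z], hence outside its up-set, and all fibres beyond [i'] lie outside its
    down-set, where the same choice can be repeated. *)
Lemma lexsum_Cond_above :
  (forall i, GE ltO (Rinc (F i)) full (v i)) ->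
  (forall c i0, ltO c t -> exists i, ltI i0 i /\ ltO c (v i)) ->
  forall j i0, Cond ltO LS t j (fun x => ltI i0 (projT1 x)).
Proof.
  intros hv hc j; induction j as [|j IH]; intros i0; simpl; [auto|]. intros d hd.
  destruct (hc d i0 hd) as (i & hi & hdi). destruct (hc d i hd) as (i' & hi' & hdi').
  destruct (GE_inv (hv i') hdi') as (y & _ & _).
  exists (existT _ i' y); split; [exact (swo_trans WI _ _ _ hi hi')|split].
  - apply (GE_mono swoO (fun x => projT1 x = i) (v i)) with (3 := lexsum_fiber_GE (hv i)).
    + intros [k z] e; simpl in e; subst k; split; [exact hi|]. intros h.
      apply (wf_irrefl (swo_wf WI) i). apply (swo_trans WI _ _ _ hi').
      apply (lexsum_le_lt h). intros e; subst i'; exact (wf_irrefl (swo_wf WI) _ hi').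
    + intros k; exact (wf_irrefl (swo_wf swoO) _ (swo_trans swoO _ _ _ k hdi)).
  - apply (@Cond_sub _ _ swoO LS t j (fun x => ltI i' (projT1 x))); [|apply IH].
    intros [k z] h; simpl in h; split; [exact (swo_trans WI _ _ _ hi (swo_trans WI _ _ _ hi' h))|].
    intros h'. apply (wf_irrefl (swo_wf WI) i'). apply (swo_trans WI _ _ _ h).
    apply (lexsum_le_lt h'). intros e; subst k; exact (wf_irrefl (swo_wf WI) _ h).
Qed.

Lemma lexsum_Cond : I ->
  (forall i, GE ltO (Rinc (F i)) full (v i)) ->
  (forall c i0, ltO c t -> exists i, ltI i0 i /\ ltO c (v i)) ->
  forall j, Cond ltO LS t j full.
Proof.
  intros i0 hv hc j. apply (@Cond_sub _ _ swoO LS t j (fun x => ltI i0 (projT1 x))); [auto|].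
  apply lexsum_Cond_above; assumption.
Qed.

End LexSum.

(** * Lexicographic products *)

Definition osub (p x : Ord) : Ord := epsilon (inhabits ozero) (fun b => x = oadd p b).

Lemma osub_spec (p x : Ord) : ~ olt x p -> x = oadd p (osub p x).
Proof. intros h; unfold osub; apply epsilon_spec, oadd_sub, h. Qed.

Lemma oadd_inj (p b c : Ord) : oadd p b = oadd p c -> b = c.
Proof.
  intros e; destruct (olt_total b c) as [h|[h|h]]; [|exact h|]; apply (oadd_mono p) in h;
    rewrite e in h; destruct (olt_irrefl h).
Qed.

Lemma osub_oadd (p b : Ord) : osub p (oadd p b) = b.
Proof. apply (@oadd_inj p). symmetry; apply osub_spec, oadd_ge. Qed.

Lemma oadd_lt_inv (p b c : Ord) : olt (oadd p b) (oadd p c) -> olt b c.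
Proof.
  intros h; destruct (olt_total b c) as [k|[->|k]]; [exact k| |].
  - destruct (olt_irrefl h).
  - destruct (olt_irrefl (olt_trans h (oadd_mono p k))).
Qed.

Lemma opmul_fin (p : Ord) (h : HO) : exists l : list Ord, forall x,
  (if excluded_middle_informative (olt x p) then 0 else at_ h (osub p x)) <> 0 -> In x l.
Proof.
  destruct h as [h [l hl]]; exists (map (oadd p) l); intros x; simpl.
  destruct (excluded_middle_informative (olt x p)) as [k|k]; [tauto|]. intros hx.
  rewrite (osub_spec k). apply in_map, hl, hx.
Qed.
(** [omega^p * h]. *)
Definition opmul (p : Ord) (h : HO) : HO := hfun (opmul_fin p h).

Lemma opmul_at_lt p h x : olt x p -> at_ (opmul p h) x = 0.
Proof. intros k; simpl; destruct (excluded_middle_informative (olt x p)); tauto. Qed.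

Lemma opmul_at p h b : at_ (opmul p h) (oadd p b) = at_ h b.
Proof.
  simpl; destruct (excluded_middle_informative (olt (oadd p b) p)) as [k|k].
  - destruct (oadd_ge _ k).
  - rewrite osub_oadd; reflexivity.
Qed.

Lemma opmul_lt_add p h' h k : ltO h' h -> ltO k (single p 1) -> ltO (hadd (opmul p h') k) (opmul p h).
Proof.
  intros (x & hx & kx) hk. rewrite (lt_single1 olt_swo) in hk.
  apply ltH_intro with (oadd p x).
  - rewrite hadd_at, !opmul_at, hk by apply oadd_ge. rewrite Nat.add_0_r; exact hx.
  - intros y hy. assert (hp : ~ olt y p).
    { intros l; exact (oadd_ge _ (olt_trans hy l)). }
    rewrite hadd_at, (hk y hp), Nat.add_0_r. rewrite (osub_spec hp) in hy |- *. rewrite !opmul_at.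
    apply kx; eapply oadd_lt_inv; exact hy.
Qed.

(** Division of [c] by omega^p: the exponents at least [p], shifted down, form the quotient [h'],
    and those below [p] the remainder [k]. *)
Lemma opmul_decomp p h c : ltO c (opmul p h) ->
  exists h' k, ltO h' h /\ ltO k (single p 1) /\ c = hadd (opmul p h') k.
Proof.
  intros (z & hz & kz). change (at_ c z < at_ (opmul p h) z) in hz.
  assert (fin : exists l : list Ord, forall b, at_ c (oadd p b) <> 0 -> In b l).
  { destruct c as [c [l hl]]; exists (map (osub p) l); intros b hb.
    rewrite <- (osub_oadd p b). apply in_map, hl, hb. }
  exists (hfun fin), (hpart (fun x => olt x p) c); split; [|split].
  - assert (hp : ~ olt z p).
    { intros l; rewrite (opmul_at_lt h l) in hz; lia. }
    rewrite (osub_spec hp), opmul_at in hz.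
    apply ltH_intro with (osub p z); [exact hz|]. intros y hy.
    transitivity (at_ (opmul p h) (oadd p y)); [|apply opmul_at]. apply kz.
    rewrite (osub_spec hp); apply oadd_mono, hy.
  - apply (lt_single1 olt_swo). intros y hy; apply hpart_out, hy.
  - apply H_ext; intros x; rewrite hadd_at. destruct (classic (olt x p)) as [l|l].
    + rewrite (opmul_at_lt _ l), hpart_in by exact l; reflexivity.
    + rewrite hpart_out by exact l. rewrite (osub_spec l), opmul_at, Nat.add_0_r. reflexivity.
Qed.

Lemma opmul_single p q : opmul p (single q 1) = single (oadd p q) 1.
Proof.
  apply H_ext; intros x. destruct (classic (olt x p)) as [l|l].
  - rewrite (opmul_at_lt _ l), single_neq; [reflexivity|]. intros ->; exact (oadd_ge _ l).
  - rewrite (osub_spec l), opmul_at. destruct (classic (osub p x = q)) as [->|n].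
    + rewrite !single_eq; reflexivity.
    + rewrite !single_neq; auto. intros e; apply n, (@oadd_inj p), e.
Qed.

Section LexProd.
Variables (A B : QO) (p : Ord).
Hypothesis Bt : qtrans B.
Notation AB := (LexProd A B).

Lemma lexprod_trans : qtrans A -> qtrans AB.
Proof.
  intros At [x y] [x' y'] [x'' y''] [h1 h2] [k1 k2]; simpl in *. split; simpl; [exact (Bt _ _ _ h1 k1)|].
  intros [_ l]. apply (At _ x').
  - apply h2; split; [exact h1|exact (Bt _ _ _ k1 l)].
  - apply k2; split; [exact k1|exact (Bt _ _ _ l h1)].
Qed.

Lemma lexprod_fiber_LE (K : A -> Prop) (y : B) (v : HO) : LE ltO (Rbad A) K v ->
  LE ltO (Rbad AB) (fun z => K (fst z) /\ qle B y (snd z) /\ qle B (snd z) y) v.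
Proof.
  intros h. constructor; intros [x y1] (hx & h1 & h2); simpl in *.
  destruct (LE_inv h x hx) as (v' & hv & h'). exists v'; split; [exact hv|].
  apply (LE_map swoO (fst : AB -> A)) with (4 := h').
  - intros [x' y'] [(hx' & k1 & k2) k]; simpl in *. split; [exact hx'|]. intros l; apply k.
    split; simpl; [exact (Bt _ _ _ h2 k1)|auto].
  - intros [x2 y2] [x' y'] [(_ & k1 & k2) _] [(_ & l1 & l2) _] k l; simpl in *. apply k.
    split; simpl; [exact (Bt _ _ _ k2 l1)|auto].
  - apply (wf_irrefl (swo_wf swoO)).
Qed.

(** A pair surviving [(x, y)] has its second coordinate not above [y], or equivalent to [y] with its
    first coordinate not above [x]. The former are bounded by omega^p * h', the latter by some k
    below omega^p, and together these stay below omega^p * h. *)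
Lemma lexprod_LE (T : B -> Prop) (h : HO) : LE ltO (Rbad A) full (single p 1) ->
  LE ltO (Rbad B) T h -> LE ltO (Rbad AB) (fun z => T (snd z)) (opmul p h).
Proof.
  intros hA. revert T; induction h as [h IH] using (well_founded_induction (swo_wf swoO)).
  intros T hT. constructor; intros [x y] hy; simpl in hy.
  destruct (LE_inv hT y hy) as (h' & hh & hT'). destruct (LE_inv hA x I) as (k & hk & hA').
  exists (hadd (opmul p h') k); split; [exact (opmul_lt_add hh hk)|].
  apply (LE_sub swoO (fun z => (T (snd z) /\ Rbad B y (snd z)) \/
     ((True /\ Rbad A x (fst z)) /\ qle B y (snd z) /\ qle B (snd z) y))).
  - intros [x' y'] [hy' hr]; simpl in *. destruct (classic (qle B y y')) as [l|l]; [right|left; auto].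
    assert (hn : qle B y' y /\ ~ qle A x x').
    { apply NNPP; intros n. apply hr. split; simpl; [exact l|]. intros [_ l'].
      apply NNPP; intros n'; apply n; auto. }
    unfold Rbad; tauto.
  - apply (LE_union olt_swo); [exact (IH h' hh _ hT')|]. exact (@lexprod_fiber_LE _ y k hA').
Qed.

(** A target is omega^p * h' + k. The quotient is answered by a move [y] in [B], the remainder by a
    move [x] in the copy of [A] over [y], and the two residual parts are mutually incomparable. *)
Lemma lexprod_GE (T : B -> Prop) (h : HO) : GE ltO (Rinc A) full (single p 1) ->
  GE ltO (Rinc B) T h -> GE ltO (Rinc AB) (fun z => T (snd z)) (opmul p h).
Proof.
  intros hA. revert T; induction h as [h IH] using (well_founded_induction (swo_wf swoO)).
  intros T hT. constructor; intros c hc.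
  destruct (opmul_decomp hc) as (h' & k & hh & hk & ->).
  destruct (GE_inv hT hh) as (y & hy & hT'). destruct (GE_inv hA hk) as (x & _ & hA').
  exists (x, y); split; [exact hy|].
  apply (GE_sub swoO (fun z => (T (snd z) /\ Rinc B y (snd z)) \/
     ((True /\ Rinc A x (fst z)) /\ snd z = y))).
  - intros [x' y'] [[h1 [h2 h3]]|[[_ [h2 h3]] e]]; simpl in *.
    + split; [exact h1|]. split; intros [l _]; auto.
    + subst y'; split; [exact hy|]. split; intros [l l']; simpl in *; [apply h2|apply h3]; auto.
  - apply (GE_union olt_swo).
    + intros [x1 y1] [x2 y2] [h1 [h2 h3]] [_ e]; simpl in *; subst y2.
      split; split; intros [l _]; auto.
    + exact (IH h' hh _ hT').
    + apply (GE_map swoO (fun x' => (x', y) : AB)) with (4 := hA').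
      * intros x' h1; simpl; auto.
      * intros x1 x2 _ _ [h1 h2]; split; intros [l l']; simpl in *; [apply h1|apply h2]; auto.
      * apply (wf_irrefl (swo_wf swoO)).
Qed.

Lemma lexprod_Cond (q : Ord) (j : nat) (T : B -> Prop) : q <> ozero ->
  GE ltO (Rinc A) full (single p 1) -> Cond ltO B (single q 1) j T ->
  Cond ltO AB (single (oadd p q) 1) j (fun z => T (snd z)).
Proof.
  intros hq hA. rewrite <- opmul_single. revert T; induction j as [|j IH]; intros T; [auto|].
  simpl; intros h d hd. destruct (opmul_decomp hd) as (h' & k & hh & hk & ->).
  assert (h0 : ltO (single ozero 0) (single p 1)).
  { apply (lt_single1 olt_swo); intros y _; apply single_0_at. }
  destruct (GE_inv hA h0) as (x & _ & _).
  (* The target omega^p * h' + k lies below omega^p times h' + 1, so width h' + 1 is requested in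
     [B]; it is below omega^q because [q] is not zero. *)
  destruct (h (hadd h' (single ozero 1))) as (z & hz & h1 & h2).
  { apply (hadd_lt_single1 olt_swo); [exact hh|]. apply (single_lt olt_swo); [apply ozero_lt, hq|auto]. }
  exists (x, z); split; [exact hz|split].
  - apply (GE_mono swoO (fun w : AB => T (snd w) /\ ~ qle B z (snd w)) (opmul p (hadd h' (single ozero 1))))
      with (3 := @lexprod_GE (fun y => T y /\ ~ qle B z y) _ hA h1).
    + intros [x' y'] [k1 k2]; simpl in *; split; [exact k1|]. intros [l _]; exact (k2 l).
    + intros l. assert (l' : ltO (hadd (opmul p h') k) (opmul p (hadd h' (single ozero 1)))).
      { apply opmul_lt_add; [|exact hk]. rewrite <- (hadd_0 h' ozero) at 1.
        apply hadd_mono_r, (single_mono olt_swo); auto. }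
      exact (wf_irrefl (swo_wf swoO) _ (swo_trans swoO _ _ _ l l')).
  - apply (@Cond_sub _ _ swoO AB _ j (fun w => T (snd w) /\ ~ qle B (snd w) z)).
    + intros [x' y'] [k1 k2]; simpl in *; split; [exact k1|]. intros [l _]; exact (k2 l).
    + exact (IH _ h2).
Qed.

End LexProd.

(** * The indecomposable building blocks *)

(** The package carried through the recursion. The last clause excludes [a = ozero] because a
    one-element block is used up after one repetition. *)
Definition phi_spec (a : Ord) (P : QO) : Prop :=
  qtrans P /\ LE ltO (Rbad P) full (single a 1) /\
  GE ltO (Rinc P) full (single a 1) /\
  (a <> ozero -> forall j, Cond ltO P (single a 1) j full).

Lemma lexprod_spec (p q : Ord) (P Q : QO) : q <> ozero ->
  phi_spec p P -> phi_spec q Q -> phi_spec (oadd p q) (LexProd P Q).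
Proof.
  intros hq (t & l & g & _) (t' & l' & g' & c').
  split; [|split; [|split]].
  - exact (lexprod_trans t' t).
  - rewrite <- opmul_single. exact (lexprod_LE t' l l').
  - rewrite <- opmul_single. exact (lexprod_GE g g').
  - intros _ j. exact (@lexprod_Cond P Q p q j _ hq g (c' hq j)).
Qed.

Lemma PhiOmega_eq (a : Ord) : PhiOmega a = @PhiOmega_body a (fun b _ => PhiOmega b).
Proof.
  unfold PhiOmega at 1. rewrite Fix_eq; [reflexivity|].
  intros x f g hfg. replace g with f; [reflexivity|].
  apply functional_extensionality_dep; intros y; apply functional_extensionality_dep; apply hfg.
Qed.

Lemma callF_eq (a b : Ord) : olt b a -> @callF a (fun b _ => PhiOmega b) b = PhiOmega b.
Proof. intros h; unfold callF; destruct (excluded_middle_informative (olt b a)); tauto. Qed.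

Lemma single_pos (I : Type) (ltI : I -> I -> Prop) (WI : swo ltI) (x y : I) :
  ltH ltI (single x 0) (single y 1).
Proof. apply (lt_single1 WI); intros z _; apply single_0_at. Qed.

Lemma bis_pos (h : HO) (a x : Ord) : bis ltO olt h a -> ltO (single x 0) h -> a <> ozero.
Proof. intros hb hl ->. destruct (bis_fwd hb _ hl) as (b & hb' & _). exact (ozero_le hb'). Qed.

Lemma opow_pos (c : Ord) : opow c <> ozero.
Proof. exact (bis_pos (bis_opow c) (single_pos olt_swo c c)). Qed.

Lemma hcnf_cons_lt (b c : Ord) (l : list Ord) : desc (b :: l) -> l <> nil -> In c (b :: l) ->
  ltO (single c 1) (hcnf (b :: l)).
Proof.
  intros hd hl hc. simpl hcnf.
  assert (h : ltO (single b 1) (hadd (single b 1) (hcnf l))).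
  { rewrite <- (hadd_0 (single b 1) ozero) at 1. apply hadd_mono_r.
    destruct l as [|d l]; [tauto|].
    destruct (swo_total swoO (single ozero 0) (hcnf (d :: l))) as [k|[k|k]]; [exact k| |].
    - assert (e : at_ (hcnf (d :: l)) d <> 0) by (apply hcnf_supp; simpl; auto).
      rewrite <- k, single_0_at in e; tauto.
    - destruct (not_lt_single_0 olt_swo k). }
  destruct hc as [<-|hc]; [exact h|].
  inversion hd as [|? ? _ hf]; subst. rewrite Forall_forall in hf.
  destruct (hf c hc) as [k|<-]; [|exact h].
  apply (swo_trans swoO) with (2 := h). apply (single_lt olt_swo); auto.
Qed.

(** Invariant of the fold: [P] is the product of the factors read so far, and its exponent [p] has
    as normal form [hp] the part of [l] already consumed. As the exponents of [hp] dominate the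
    remaining ones, each further factor appends its term to the normal form. *)
Lemma fold_lexprod_spec (a : Ord) (l t : list Ord) (P : QO) (p : Ord) (hp : HO) :
  IsCNF a l -> (forall c, In c t -> phi_spec (opow c) (@callF a (fun b _ => PhiOmega b) (opow c))) ->
  desc t -> phi_spec p P -> otype (rrel (rep p)) ltO hp ->
  (forall x c, at_ hp x <> 0 -> In c t -> ~ olt x c) -> hadd hp (hcnf t) = hcnf l ->
  phi_spec a (fold_left (fun P c => LexProd P (@callF a (fun b _ => PhiOmega b) (opow c))) t P).
Proof.
  intros hl. revert P p hp; induction t as [|c t IH]; intros P p hp hs hd hP ho hx he; simpl.
  - replace a with p; [exact hP|].
    simpl in he. rewrite hadd_0 in he. subst hp.
    apply (bis_HO_uniq (h := hcnf l)); [|apply bis_hcnf, hl].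
    exact (bis_of_otype swoO (iso_refl _) ho).
  - inversion hd as [|? ? hd' hf]; subst. rewrite Forall_forall in hf.
    apply (IH _ (oadd p (opow c)) (hadd hp (single c 1))).
    + intros c' hc'; apply hs; simpl; auto.
    + exact hd'.
    + apply lexprod_spec; [apply opow_pos|exact hP|apply hs; simpl; auto].
    + apply (otype_iso (rep_oadd p (opow c))). apply otype_sum; [|exact ho|].
      * intros x y hx' hy. assert (y = c) as ->.
        { apply NNPP; intros n; exact (hy (single_neq 1 n)). }
        apply hx; simpl; auto.
      * exact (otype_iso (rep_opow c) (otype_opow c)).
    + intros x c' hx' hc'. rewrite hadd_at in hx'. destruct (classic (x = c)) as [->|n].
      * apply ole_not_lt, hf, hc'.
      * rewrite (single_neq 1 n), Nat.add_0_r in hx'. apply hx; simpl; auto.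
    + rewrite hadd_assoc. exact he.
Qed.

(** The two hypotheses say that [a] is 1, so the value to reach is omega. *)
Lemma gamma_sum_spec (a : Ord) : a <> ozero -> (forall b, olt b a -> b = ozero) ->
  phi_spec a (@LexSum nat lt Gamma).
Proof.
  intros h0 h1. pose proof (ozero_lt h0) as hpos.
  assert (hc : forall c i0, ltO c (single a 1) -> exists i, i0 < i /\ ltO c (single ozero i)).
  { intros c i0 hc. rewrite (lt_single1 olt_swo) in hc. exists (S (Nat.max i0 (at_ c ozero))).
    split; [lia|]. apply (lt_single olt_swo); split; [lia|]. intros y hy. apply hc.
    intros k; rewrite (h1 y k) in hy; exact (olt_irrefl hy). }
  split; [|split; [|split]].
  - apply lexsum_trans; [exact nat_swo|]. intros i x y z e e'; simpl in *; congruence.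
  (* Squares leave enough room: j*j + j < i*i whenever j < i. *)
  - apply (@lexsum_LE nat lt Gamma nat_swo (fun n => single ozero n) _ (fun n => single ozero (n * n))).
    + intros n; apply gamma_full_LE.
    + intros j i hji; rewrite single_add; apply (single_mono olt_swo). nia.
    + intros j; rewrite single_add. apply (single_lt olt_swo); auto.
  - apply (@lexsum_GE nat lt Gamma nat_swo (fun n => single ozero n)).
    + intros n; apply gamma_full_GE.
    + intros c h; destruct (hc c 0 h) as (i & _ & hi); exists i; exact hi.
  - intros _ j. apply (@lexsum_Cond nat lt Gamma nat_swo (fun n => single ozero n)).
    + exact 0.
    + intros n; apply gamma_full_GE.
    + exact hc.
Qed.

(** Take omega^b both for fibre [b] and for everything below it: twice omega^b is still below
    omega^b' for b < b'. Closure of [a] under successor provides arbitrarily wide fibres beyond any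
    index. *)
Lemma limit_sum_spec (a : Ord) (F : {b : Ord | olt b a} -> QO) : a <> ozero ->
  (forall b, olt b a -> olt (osucc b) a) -> (forall b, phi_spec (proj1_sig b) (F b)) ->
  phi_spec a (@LexSum {b : Ord | olt b a} (fun x y => olt (proj1_sig x) (proj1_sig y)) F).
Proof.
  intros h0 hlim hF.
  set (ltI := fun x y : {b : Ord | olt b a} => olt (proj1_sig x) (proj1_sig y)).
  assert (WI : swo ltI).
  { split.
    - intros [x hx]; revert hx. induction x as [x IH] using (well_founded_induction olt_wf).
      intros hx; constructor; intros [y hy] h. apply IH, h.
    - intros x y z; apply olt_trans.
    - intros [x hx] [y hy]; unfold ltI; simpl. destruct (olt_total x y) as [h|[h|h]]; auto.
      right; left; apply eq_sig_hprop; [intros; apply proof_irrelevance|exact h]. }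
  assert (hc : forall c (i0 : {b : Ord | olt b a}), ltO c (single a 1) ->
             exists i, ltI i0 i /\ ltO c (single (proj1_sig i) 1)).
  { intros c [i0 hi0] hc. destruct (lt_single1_bound olt_swo hc) as [->|(y & n & hy & hn)].
    - exists (exist (fun b => olt b a) _ (hlim i0 hi0)); split; [apply olt_osucc|]. apply (single_pos olt_swo).
    - destruct (classic (olt i0 y)) as [k|k].
      + exists (exist (fun b => olt b a) _ (hlim y hy)); split; [exact (olt_trans k (olt_osucc y))|].
        apply (swo_trans swoO _ _ _ hn). apply (single_lt olt_swo); [apply olt_osucc|auto].
      + exists (exist (fun b => olt b a) _ (hlim i0 hi0)); split; [apply olt_osucc|].
        apply (swo_trans swoO _ _ _ hn). apply (single_lt olt_swo); [|auto]. apply lt_osucc, k. }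
  split; [|split; [|split]].
  - apply (lexsum_trans WI); intros i; apply (hF i).
  - apply (@lexsum_LE _ ltI F WI (fun b => single (proj1_sig b) 1) _ (fun b => single (proj1_sig b) 1)).
    + intros i; apply (hF i).
    + intros j i hji. apply (hadd_lt_single1 olt_swo); apply (single_lt olt_swo); auto.
    + intros [j hj]; apply (hadd_lt_single1 olt_swo); apply (single_lt olt_swo); auto.
  - apply (@lexsum_GE _ ltI F WI (fun b => single (proj1_sig b) 1)).
    + intros i; apply (hF i).
    + intros c h. destruct (hc c (exist (fun b => olt b a) _ (ozero_lt h0)) h) as (i & _ & hi); exists i; exact hi.
  - intros _ j. apply (@lexsum_Cond _ ltI F WI (fun b => single (proj1_sig b) 1)).
    + exact (exist (fun b => olt b a) _ (ozero_lt h0)).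
    + intros i; apply (hF i).
    + exact hc.
Qed.

Theorem PhiOmega_spec (a : Ord) : phi_spec a (PhiOmega a).
Proof.
  induction a as [a IH] using (well_founded_induction olt_wf).
  rewrite PhiOmega_eq. unfold PhiOmega_body.
  pose proof (cnf_spec a) as hcnf_a. pose proof (bis_hcnf hcnf_a) as hb.
  pose proof (cnf_desc hcnf_a) as hd.
  destruct (cnf a) as [|a1 [|a2 t]].
  - assert (a = ozero) as ->.
    { exact (bis_HO_uniq hb bis_ozero). }
    split; [|split; [|split]].
    + intros x y z e e'; simpl in *; congruence.
    + apply gamma_full_LE.
    + apply gamma_full_GE.
    + intros h; destruct (h eq_refl).
  - simpl in hb. rewrite hadd_0 in hb.
    pose proof (bis_pos hb (single_pos olt_swo a1 a1)) as h0.
    destruct (excluded_middle_informative (a1 = ozero)) as [->|h1].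
    + apply gamma_sum_spec; [exact h0|]. intros b hba.
      destruct (bis_bwd hb _ hba) as (u & hu & hub).
      assert (u = single ozero 0) as ->.
      { apply H_ext; intros x; rewrite single_0_at. apply (proj1 (lt_single1 olt_swo _ _) hu), ozero_le. }
      exact (bis_HO_uniq hub bis_ozero).
    (* Here [a] is omega^a1 with [a1] non-zero, so a value below it remains below after adding
       omega^0. *)
    + apply limit_sum_spec; [exact h0| |intros [b hba]; apply IH, hba].
      intros b hba. destruct (bis_bwd hb _ hba) as (u & hu & hub).
      apply (bis_mono swoO olt_swo (bis_osucc hub) hb). apply (hadd_lt_single1 olt_swo); [exact hu|].
      apply (single_lt olt_swo); [apply ozero_lt, h1|auto].
  - assert (hlt : forall c, In c (a1 :: a2 :: t) -> olt (opow c) a).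
    { intros c hc. apply (bis_mono swoO olt_swo (bis_opow c) hb). apply hcnf_cons_lt; auto. discriminate. }
    assert (hs : forall c, In c (a1 :: a2 :: t) ->
        phi_spec (opow c) (@callF a (fun b _ => PhiOmega b) (opow c))).
    { intros c hc. rewrite callF_eq by auto. apply IH, hlt, hc. }
    inversion hd as [|? ? hd' hf]; subst. rewrite Forall_forall in hf.
    apply (@fold_lexprod_spec a (a1 :: a2 :: t) (a2 :: t) _ (opow a1) (single a1 1) hcnf_a).
    + intros c hc; apply hs; right; exact hc.
    + exact hd'.
    + apply hs; left; reflexivity.
    + exact (otype_iso (rep_opow a1) (otype_opow a1)).
    + intros x c hx hc. assert (x = a1) as ->.
      { apply NNPP; intros n; exact (hx (single_neq 1 n)). }
      apply ole_not_lt, hf, hc.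
    + reflexivity.
Qed.

(** * Disjoint unions *)

Section DUnion.
Variables (A B : QO).
Notation AB := (DUnion A B).

Lemma dunion_LE (v w : HO) : LE ltO (Rbad A) full v -> LE ltO (Rbad B) full w ->
  LE ltO (Rbad AB) full (hadd v w).
Proof.
  intros hA hB.
  apply (LE_sub swoO (fun z : AB => (exists a, z = inl a) \/ (exists b, z = inr b))).
  { intros [a|b] _; [left|right]; eexists; reflexivity. }
  apply (LE_union olt_swo); constructor; intros z [x ->].
  - destruct (LE_inv hA x Logic.I) as (v' & hv & h). exists v'; split; [exact hv|].
    (* The [inr] branch only makes the projection total; every point in play is an [inl]. *)
    apply (LE_map swoO (fun z : AB => match z with inl a => a | inr _ => x end)) with (4 := h).
    + intros z [[a ->] k]; split; auto.
    + intros z z' [[a ->] _] [[a' ->] _] k; exact k.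
    + apply (wf_irrefl (swo_wf swoO)).
  - destruct (LE_inv hB x Logic.I) as (v' & hv & h). exists v'; split; [exact hv|].
    apply (LE_map swoO (fun z : AB => match z with inr b => b | inl _ => x end)) with (4 := h).
    + intros z [[a ->] k]; split; auto.
    + intros z z' [[a ->] _] [[a' ->] _] k; exact k.
    + apply (wf_irrefl (swo_wf swoO)).
Qed.

Definition dset (S : A -> Prop) (T : B -> Prop) (z : AB) : Prop :=
  match z with inl a => S a | inr b => T b end.

Lemma dunion_GE (S : A -> Prop) (T : B -> Prop) (v w : HO) :
  GE ltO (Rinc A) S v -> GE ltO (Rinc B) T w -> GE ltO (Rinc AB) (dset S T) (hadd v w).
Proof.
  intros hA hB.
  apply (GE_sub swoO (fun z : AB => (exists a, z = inl a /\ S a) \/ (exists b, z = inr b /\ T b))).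
  { intros z [(a & -> & h)|(a & -> & h)]; exact h. }
  apply (GE_union olt_swo).
  - intros x y (a & -> & _) (b & -> & _); repeat split; intros k; exact k.
  - apply (GE_map swoO (fun a => inl a : AB)) with (4 := hA).
    + intros x hx; exists x; auto.
    + intros x x' _ _ h; exact h.
    + apply (wf_irrefl (swo_wf swoO)).
  - apply (GE_map swoO (fun a => inr a : AB)) with (4 := hB).
    + intros x hx; exists x; auto.
    + intros x x' _ _ h; exact h.
    + apply (wf_irrefl (swo_wf swoO)).
Qed.

(** Starting point for unions: the last infinite block alone carries the width, and the right-hand
    part is set aside for the isolated points. *)
Lemma Cond_inl (v : HO) (j : nat) (S : A -> Prop) :
  Cond ltO A v j S -> Cond ltO AB v j (dset S (fun _ => False)).
Proof.
  revert S; induction j as [|j IH]; intros S; [auto|]. simpl; intros h d hd.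
  destruct (h d hd) as (z & hz & h1 & h2). exists (inl z); split; [exact hz|split].
  - apply (GE_map swoO (fun a => inl a : AB)) with (4 := h1).
    + intros x hx; exact hx.
    + intros x x' _ _ k; exact k.
    + apply (wf_irrefl (swo_wf swoO)).
  - apply (@Cond_sub _ _ swoO AB v j (dset (fun y => S y /\ ~ qle A y z) (fun _ => False))); [|exact (IH _ h2)].
    intros [a|b]; simpl; tauto.
Qed.

(** As no exponent of [v] exceeds [b0], everything below [omega^b0 + v] is at most
    some [omega^b0 + d'] with [d' < v], so [A] can be used in full at each step. *)
Lemma Cond_dunion (b0 : Ord) (v : HO) (j : nat) (T : B -> Prop) :
  GE ltO (Rinc A) full (single b0 1) -> (forall y, at_ v y <> 0 -> ~ olt b0 y) ->
  ltO (single ozero 0) v ->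
  Cond ltO B v j T -> Cond ltO AB (hadd (single b0 1) v) j (dset full T).
Proof.
  intros hA hs hv0. revert T; induction j as [|j IH]; intros T; [auto|]. simpl; intros h d hd.
  assert (hd' : exists d', ltO d' v /\ ~ ltO (hadd (single b0 1) d') d).
  { destruct (lt_hadd_ordered olt_swo (f := single b0 1) (g := v)) with (2 := hd) as [k|(d' & k & ->)].
    - intros x y hx hy. assert (x = b0) as ->.
      { apply NNPP; intros n; exact (hx (single_neq 1 n)). }
      apply hs, hy.
    - exists (single ozero 0); split; [exact hv0|]. rewrite hadd_0.
      intros l; exact (wf_irrefl (swo_wf swoO) _ (swo_trans swoO _ _ _ l k)).
    - exists d'; split; [exact k|apply (wf_irrefl (swo_wf swoO))]. }
  destruct hd' as (d' & hd1 & hd2). destruct (h d' hd1) as (z & hz & h1 & h2).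
  exists (inr z); split; [exact hz|split].
  - apply (GE_mono swoO (dset full (fun y => T y /\ ~ qle B z y)) (hadd (single b0 1) d'))
      with (3 := dunion_GE hA h1).
    + intros [a|b]; simpl; tauto.
    + exact hd2.
  - apply (@Cond_sub _ _ swoO AB _ j (dset full (fun y => T y /\ ~ qle B y z))); [|exact (IH _ h2)].
    intros [a|b]; simpl; tauto.
Qed.

End DUnion.

Definition phi_sum (l : list Ord) : QO := fold_right DUnion QEmpty (map PhiOmega l).

Lemma phi_sum_trans (l : list Ord) : qtrans (phi_sum l).
Proof.
  induction l as [|b l IH]; [intros []|].
  pose proof (PhiOmega_spec b) as (t & _).
  intros [x|x] [y|y] [z|z]; simpl; try tauto; [apply t|apply IH].
Qed.

Lemma phi_sum_LE (l : list Ord) : LE ltO (Rbad (phi_sum l)) full (hcnf l).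
Proof.
  induction l as [|b l IH]; [apply LE_empty; intros []|].
  apply dunion_LE; [apply PhiOmega_spec|exact IH].
Qed.

Lemma phi_sum_GE (l : list Ord) : GE ltO (Rinc (phi_sum l)) full (hcnf l).
Proof.
  induction l as [|b l IH]; [apply GE_zero, olt_swo|].
  apply (GE_sub swoO (@dset (PhiOmega b) (phi_sum l) full full)); [auto|].
  apply dunion_GE; [apply PhiOmega_spec|exact IH].
Qed.

Lemma Phi_ranks (a : Ord) : oRank (Phi a) a /\ wRank (Phi a) a.
Proof.
  apply ranks_eq.
  - exact (LE_bis swoO (bis_cnf a) (phi_sum_LE (cnf a))).
  - exact (GE_bis swoO (bis_cnf a) (phi_sum_GE (cnf a))).
Qed.

(** * Finite powersets *)

(** Lists stand for finite sets: repetitions and order do not affect the Hoare order, and unions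
    become concatenations. *)
Definition LP (A : QO) : QO :=
  @mkQO (list A) (fun s s' => forall x, In x s -> exists y, In y s' /\ qle A x y).

Definition pf_of_list (A : QO) (s : list A) : Pf A :=
  exist _ (fun x => In x s) (ex_intro _ s (fun x => iff_refl _)).

Lemma pf_enum (A : QO) : exists e : Pf A -> LP A, forall s x, proj1_sig s x <-> In x (e s).
Proof.
  apply (choice (fun (s : Pf A) (l : LP A) => forall x, proj1_sig s x <-> In x l)).
  intros [s [l h]]; exists l; exact h.
Qed.

Lemma Pf_LE (V : Type) (lt : V -> V -> Prop) (W : swo lt) (A : QO) (v : V) :
  LE lt (Rbad (LP A)) full v -> LE lt (Rbad (Pf A)) full v.
Proof.
  destruct (pf_enum A) as [e he]. apply (LE_map W e); auto.
  - intros s s' _ _ h k; apply h. intros x hx. apply he in hx.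
    destruct (k x hx) as (y & hy & l). exists y; split; [apply he, hy|exact l].
  - apply (wf_irrefl (swo_wf W)).
Qed.

Lemma Pf_GE (V : Type) (lt : V -> V -> Prop) (W : swo lt) (A : QO) (R : forall B : QO, B -> B -> Prop)
    (S : LP A -> Prop) (v : V) : R = Rbad \/ R = Rinc ->
  GE lt (R (LP A)) S v -> GE lt (R (Pf A)) full v.
Proof.
  intros hR. apply (GE_map W (@pf_of_list A)); auto.
  - intros s s' _ _; destruct hR as [-> | ->]; exact (fun h => h).
  - apply (wf_irrefl (swo_wf W)).
Qed.

(** * The upper bound [o(Pf A) <= 2^o(A)] *)

(** When the bound [b] is not reached by [S] itself, some residual [S_x] witnesses
    it, and then nothing in [S] is strictly above [x]. *)
Lemma LE_osucc (A : QO) (S : A -> Prop) (b : Ord) : qtrans A ->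
  LE olt (Rbad A) S (osucc b) ->
  LE olt (Rbad A) S b \/
  exists x, S x /\ (forall y, S y -> qle A x y -> qle A y x) /\
            LE olt (Rbad A) (fun y => S y /\ Rbad A x y) b.
Proof.
  intros At h. destruct (classic (LE olt (Rbad A) S b)) as [k|k]; [auto|right].
  assert (hb : forall x, S x -> LE olt (Rbad A) (fun y => S y /\ Rbad A x y) b).
  { intros x hx. destruct (LE_inv h x hx) as (b' & hb' & l).
    apply (LE_mono olt_swo _ b' (fun y hy => hy)); [|exact l]. apply lt_osucc, hb'. }
  assert (hx : exists x, S x /\ ~ exists b', olt b' b /\ LE olt (Rbad A) (fun y => S y /\ Rbad A x y) b').
  { apply NNPP; intros n; apply k; constructor; intros x hx.
    apply NNPP; intros n'; apply n; exists x; auto. }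
  destruct hx as (x & hx & nx). exists x; split; [exact hx|split; [|auto]].
  (* Were [y] strictly above [x], then [x] would survive a move at [y]. By transitivity the residual
     of [x] lies in that of [y], so playing [y] and then [x] bounds it strictly below [b], against
     the choice of [x]. *)
  intros y hy hxy. apply NNPP; intros nyx. apply nx.
  destruct (LE_inv (hb y hy) x (conj hx nyx)) as (b' & hb' & l). exists b'; split; [exact hb'|].
  apply (LE_sub olt_swo _) with (2 := l). intros z [hz1 hz2]; repeat split; auto.
  intros hyz; apply hz2. exact (At _ _ _ hxy hyz).
Qed.

Lemma filter_prop (A : Type) (P : A -> Prop) : exists f : list A -> list A,
  forall l x, In x (f l) <-> In x l /\ P x.
Proof.
  exists (filter (fun x => if excluded_middle_informative (P x) then true else false)).
  intros l x; rewrite filter_In. destruct (excluded_middle_informative (P x)); intuition congruence.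
Qed.

Definition sublists (A : QO) (S : A -> Prop) (s : LP A) : Prop := forall x, In x s -> S x.
Arguments sublists A S s : clear implicits.

Lemma powerset_LE (A : QO) (l : Lim) (k : nat) (S : A -> Prop) : qtrans A ->
  LE olt (Rbad A) S (osn k (proj1_sig l)) ->
  LE ltHL (Rbad (LP A)) (sublists A S) (single l (2 ^ k)).
Proof.
  intros At. revert k S.
  induction l as [l IHl] using (well_founded_induction (swo_wf ltL_swo)).
  intros k; induction k as [|k IHk]; intros S h.
  - constructor; intros s hs.
    (* Each of the finitely many [x] in [s] contributes a value below [single l 1], which is
       additively indecomposable. *)
    assert (H : forall s : list A, sublists A S s -> exists u, ltHL u (single l 1) /\
      LE ltHL (Rbad (LP A)) (fun s' => exists x, In x s /\ sublists A (fun y => S y /\ Rbad A x y) s') u).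
    { clear s hs; intros s; induction s as [|x s IH]; intros hs.
      - exists (single l 0); split; [apply (single_pos ltL_swo)|].
        apply LE_empty. intros s' (x & [] & _).
      - destruct IH as (u & hu & hL); [intros y hy; apply hs; right; exact hy|].
        destruct (LE_inv h x (hs x (or_introl eq_refl))) as (b & hb & hx).
        destruct (osn_decomp b) as (l' & k' & ->).
        (* A residual rank below the limit part [l] has a strictly smaller limit part, so its
           powerset bound is below [single l 1] whatever [k'] is. *)
        assert (hl : ltL l' l).
        { destruct (olt_total (proj1_sig l') (proj1_sig l)) as [c|[c|c]]; [exact c| |]; exfalso.
          - simpl in hb; rewrite c in hb. exact (osn_le _ hb).
          - simpl in hb. exact (osn_le _ (olt_trans hb c)). }
        exists (hadd (single l' (2 ^ k')) u); split.
        + apply (hadd_lt_single1 ltL_swo); [apply (single_lt ltL_swo); auto|exact hu].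
        + apply (LE_sub swoL (fun s' => sublists A (fun y => S y /\ Rbad A x y) s' \/
             exists x, In x s /\ sublists A (fun y => S y /\ Rbad A x y) s')).
          * intros s' (y & [<-|hy] & hs'); [left; exact hs'|right; exists y; auto].
          * apply (LE_union ltL_swo); [apply (IHl l' hl), hx|exact hL]. }
    destruct (H s hs) as (u & hu & hL). exists u; split; [exact hu|].
    apply (LE_sub swoL _) with (2 := hL). intros s' [hs' n].
    apply not_all_ex_not in n. destruct n as [x n]. apply imply_to_and in n. destruct n as [hx n].
    exists x; split; [exact hx|]. intros y hy; split; [apply hs', hy|].
    intros hxy; apply n; exists y; auto.
  - replace (2 ^ Datatypes.S k) with (2 ^ k + 2 ^ k) by (simpl; lia). rewrite <- single_add.
    destruct (@LE_osucc A S (osn k (proj1_sig l)) At h) as [h'|(x & hx & hmax & h')].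
    { apply (LE_mono swoL _ _ (fun s hs => hs)) with (2 := IHk S h'). apply (hadd_ge ltL_swo). }
    (* Sets disjoint from the up-set of [x] live in [Sx]. Those meeting it are determined up to
       equivalence by their trace on [Sx], since everything in [S] above [x] is equivalent to [x].
       Each half costs 2^k. *)
    set (Sx := fun y => S y /\ Rbad A x y).
    apply (LE_sub swoL (fun s => sublists A Sx s \/
             (sublists A S s /\ exists y, In y s /\ qle A x y))).
    { intros s hs. destruct (classic (exists y, In y s /\ qle A x y)) as [c|c]; [right; auto|left].
      intros y hy; split; [apply hs, hy|]. intros hxy; apply c; exists y; auto. }
    apply (LE_union ltL_swo); [exact (IHk Sx h')|].
    destruct (filter_prop (Rbad A x)) as [f hf].
    apply (LE_map swoL (f : LP A -> LP A)) with (4 := IHk Sx h').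
    + intros s [hs _] y hy. apply hf in hy; destruct hy as [hy1 hy2]; split; auto.
    + intros s s' [hs _] [hs' (y0 & hy0 & hxy0)] n c; apply n. intros y hy.
      destruct (classic (qle A x y)) as [hxy|hxy].
      * exists y0; split; [exact hy0|]. apply (At _ x); [apply hmax; auto|exact hxy0].
      * destruct (c y) as (y' & hy' & hyy'); [apply hf; auto|]. apply hf in hy'.
        exists y'; split; [apply hy'|exact hyy'].
    + apply (wf_irrefl (swo_wf swoL)).
Qed.

(** * Lower bounds on the width of a powerset *)

(** Spending the last [n] successors yields a finite antichain whose common residual still has width
    [b]. *)
Lemma GE_chain (A : QO) (b : Ord) (n : nat) (S : A -> Prop) : GE olt (Rinc A) S (osn n b) ->
  exists (xs : list A) (S' : A -> Prop), length xs = n /\ (forall x, In x xs -> S x) /\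
    ForallOrdPairs (Rinc A) xs /\ (forall y, S' y -> S y) /\ GE olt (Rinc A) S' b /\
    (forall x y, In x xs -> S' y -> Rinc A x y).
Proof.
  revert S; induction n as [|n IH]; intros S h.
  - exists nil, S; split; [reflexivity|split; [intros x []|split; [constructor|]]].
    split; [auto|split; [exact h|intros x y []]].
  - destruct (GE_inv h (olt_osucc (osn n b))) as (x & hx & h').
    destruct (IH _ h') as (xs & S' & h1 & h2 & h3 & h4 & h5 & h6).
    exists (x :: xs), S'; split; [simpl; congruence|split; [|split; [|split; [|split; [exact h5|]]]]].
    + intros y [<-|hy]; [exact hx|apply (h2 y hy)].
    + constructor; [|exact h3]. apply Forall_forall; intros y hy; apply (h2 y hy).
    + intros y hy; apply (h4 y hy).
    + intros z y [<-|hz] hy; [apply (h4 y hy)|apply (h6 z y hz hy)].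
Qed.

Definition ext (A : QO) (U : list A) (S : A -> Prop) (s : LP A) : Prop :=
  exists T, (forall x, In x T -> S x) /\ s = T ++ U.

(** A fixed element of [U] above a member of [S] would absorb it and make different sets
    equivalent. *)
Definition avoids (A : QO) (U : list A) (S : A -> Prop) : Prop :=
  forall x u, S x -> In u U -> ~ qle A x u.

(** Named so that the passage to finite multiples can assume it inside the induction that proves
    it. *)
Definition ext_bound (A : QO) (l : Lim) : Prop := forall S U, avoids A U S ->
  GE olt (Rinc A) S (proj1_sig l) -> GE ltHL (Rinc (LP A)) (ext U S) (single l 1).

(** Copies marked by different points [x], [y] of the antichain are incomparable: [x] is below
    neither [y], nor a residual element, nor an element of [U]. *)
Lemma powerset_GE_finite (A : QO) (l : Lim) (n : nat) (S : A -> Prop) (U : list A) :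
  ext_bound A l -> avoids A U S -> GE olt (Rinc A) S (osn n (proj1_sig l)) ->
  GE ltHL (Rinc (LP A)) (ext U S) (single l n).
Proof.
  intros hl hU h. destruct (GE_chain _ _ h) as (xs & S' & <- & h2 & h3 & h4 & h5 & h6).
  apply (GE_sub swoL (fun s => exists x, In x xs /\ ext (x :: U) S' s)).
  { intros s (x & hx & T & hT & ->). exists (T ++ [x]); split.
    - intros y hy; apply in_app_or in hy; destruct hy as [hy|[<-|[]]]; auto.
    - rewrite <- app_assoc; reflexivity. }
  clear h; induction h3 as [|x xs hx h3 IH]; [apply GE_zero, ltL_swo|].
  change (length (x :: xs)) with (1 + length xs). rewrite <- single_add.
  apply (GE_sub swoL (fun s => ext (x :: U) S' s \/ exists x, In x xs /\ ext (x :: U) S' s)).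
  { intros s [hs|(y & hy & hs)]; [exists x|exists y]; simpl; auto. }
  rewrite Forall_forall in hx.
  assert (key : forall y z T T', In y (x :: xs) -> In z (x :: xs) -> Rinc A y z ->
     (forall w, In w T' -> S' w) -> ~ qle (LP A) (T ++ y :: U) (T' ++ z :: U)).
  { intros y z T T' hy hz [hyz _] hT' k.
    destruct (k y) as (w & hw & hyw); [apply in_or_app; simpl; auto|].
    apply in_app_or in hw; destruct hw as [hw|[<-|hw]].
    - exact (proj1 (h6 y w hy (hT' w hw)) hyw).
    - exact (hyz hyw).
    - exact (hU y w (h2 y hy) hw hyw). }
  apply (GE_union ltL_swo).
  - intros s s' (T & hT & ->) (y & hy & T' & hT' & ->).
    assert (hxy : Rinc A x y) by apply hx, hy.
    assert (hyx : Rinc A y x) by (destruct hxy; split; assumption).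
    assert (ix : In x (x :: xs)) by (left; reflexivity).
    assert (iy : In y (x :: xs)) by (right; exact hy).
    split; split; apply key; assumption.
  - apply hl; [|exact h5]. intros y u hy [<-|hu].
    + exact (proj2 (h6 x y (or_introl eq_refl) hy)).
    + exact (hU y u (h4 y hy) hu).
  - apply IH.
    + intros y hy; apply h2; right; exact hy.
    + intros y z hy; apply h6; right; exact hy.
Qed.

(** A value below [single l 1] is below some [single y n] with [y] below [l]; as [l] is then a
    limit, it leaves room for [n] antichain points on top of width [y]. *)
Lemma powerset_GE (A : QO) (l : Lim) : ext_bound A l.
Proof.
  induction l as [l IH] using (well_founded_induction (swo_wf ltL_swo)).
  intros S U hU h. constructor; intros c hc.
  destruct (lt_single1_bound ltL_swo hc) as [->|(y & n & hy & hn)].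
  - exists U; split; [exists nil; split; [intros x []|reflexivity]|apply GE_zero, ltL_swo].
  - assert (h' : GE olt (Rinc A) S (osn n (proj1_sig y))).
    { apply (GE_mono olt_swo _ (proj1_sig l) (fun x hx => hx)); [|exact h].
      intros k. exact (olt_irrefl (olt_trans k (osn_lt_L n l hy))). }
    exact (GE_inv (@powerset_GE_finite A y n S U (IH y hy) hU h') hn).
Qed.

(** The witness [u] keeps a set built on [U] from being below one built on [U']. The opposite
    direction is left to the point [z] added later. *)
Definition separated (A : QO) (S : A -> Prop) (U U' : list A) : Prop :=
  exists u, In u U /\ (forall u', In u' U' -> ~ qle A u u') /\ (forall x, S x -> ~ qle A u x).

(** The sets [T ∪ U_i] are exhausted for [U_1] first, below a point [z]; the other
    families survive by adding [z] to every [U_i]. *)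
Lemma powerset_copies_GE (A : QO) (l : Lim) (Us : list (list A)) (S : A -> Prop) : ltL L0 l ->
  Cond olt A (proj1_sig l) (length Us) S -> (forall U, In U Us -> avoids A U S) ->
  ForallOrdPairs (separated A S) Us ->
  GE ltHL (Rinc (LP A)) (fun s => exists U, In U Us /\ ext U S s) (single l (length Us)).
Proof.
  intros hl0. remember (length Us) as n eqn:en. revert Us S en.
  induction n as [|n IH]; intros [|U Us] S en; try discriminate en.
  { intros _ _ _; apply GE_zero, ltL_swo. }
  injection en as en. intros hC hav hsep. constructor; intros c hc.
  apply (lt_single ltL_swo) in hc; destruct hc as [hc1 hc2].
  (* The coefficient of [c] at [l] is at most [n], so keeping the terms below [l] and putting [n] at
     [l] does not decrease it. *)
  set (c' := hpart (fun x => ltL x l) c).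
  assert (hc' : ltHL c' (single l 1)).
  { apply (lt_single1 ltL_swo); intros y hy; apply hpart_out, hy. }
  assert (hcc : ~ ltHL (hadd c' (single l n)) c).
  { intros (z & hz & _). change (at_ c' z + at_ (single l n) z < at_ c z) in hz.
    destruct (swo_total ltL_swo z l) as [k|[->|k]].
    - unfold c' in hz; rewrite hpart_in in hz by exact k; lia.
    - rewrite single_eq in hz; lia.
    - rewrite hc2 in hz by exact k; lia. }
  assert (hy : exists y m, ltL y l /\ ltHL c' (single y m)).
  { destruct (lt_single1_bound ltL_swo hc') as [->|(y & m & hy & hm)]; [|exists y, m; auto].
    (* When this tail is zero, a positive value at any exponent below [l] will do; [L0] is one
       because [l] is not zero. *)
    exists L0, 1; split; [exact hl0|apply (single_pos ltL_swo)]. }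
  destruct hy as (y & m & hy & hm).
  (* Width y + m outside the up-set of [z] gives the copy over [U] a value exceeding the tail of
     [c]; the other copies continue outside the down-set of [z]. *)
  destruct (hC (osn m (proj1_sig y)) (osn_lt_L m l hy)) as (z & hz & h1 & h2).
  inversion hsep as [|? ? hf hsep']; subst. rewrite Forall_forall in hf.
  set (S1 := fun w => S w /\ ~ qle A z w) in *. set (S2 := fun w => S w /\ ~ qle A w z) in *.
  set (E := fun s => ext U S1 s \/ exists U', In U' (map (cons z) Us) /\ ext U' S2 s).
  assert (hE : GE ltHL (Rinc (LP A)) E (hadd (single y m) (single l (length Us)))).
  { apply (GE_union ltL_swo).
    - intros s s' (T & hT & ->) (U0 & hU0 & T' & hT' & ->).
      apply in_map_iff in hU0; destruct hU0 as (U' & <- & hU').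
      assert (a1 : ~ qle (LP A) (T ++ U) (T' ++ z :: U')).
      { intros k. destruct (hf U' hU') as (u & hu & u1 & u2).
        destruct (k u) as (w & hw & huw); [apply in_or_app; auto|].
        apply in_app_or in hw; destruct hw as [hw|[<-|hw]].
        - exact (u2 w (proj1 (hT' w hw)) huw).
        - exact (u2 z hz huw).
        - exact (u1 w hw huw). }
      assert (a2 : ~ qle (LP A) (T' ++ z :: U') (T ++ U)).
      { intros k. destruct (k z) as (w & hw & hzw); [apply in_or_app; simpl; auto|].
        apply in_app_or in hw; destruct hw as [hw|hw].
        - exact (proj2 (hT w hw) hzw).
        - exact (hav U (or_introl eq_refl) z w hz hw hzw). }
      split; split; assumption.
    - apply powerset_GE_finite; [apply powerset_GE| |exact h1].
      intros x u [hx _] hu. exact (hav U (or_introl eq_refl) x u hx hu).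
    - apply IH.
      + rewrite length_map; reflexivity.
      + exact h2.
      + intros U0 hU0; apply in_map_iff in hU0; destruct hU0 as (U' & <- & hU').
        intros x u [hx hxz] [<-|hu]; [exact hxz|].
        exact (hav U' (or_intror hU') x u hx hu).
      + clear - hsep' hz. induction hsep' as [|V Vs hV _ IHV]; simpl; constructor; [|exact IHV].
        rewrite Forall_forall in *. intros V0 hV0; apply in_map_iff in hV0.
        destruct hV0 as (V' & <- & hV'). destruct (hV V' hV') as (u & hu & u1 & u2).
        exists u; split; [right; exact hu|split].
        * intros u' [<-|hu']; [apply u2, hz|apply u1, hu'].
        * intros x [hx _]; apply u2, hx. }
  assert (hlt : ltHL c (hadd (single y m) (single l (length Us)))).
  { pose proof (hadd_mono_l (single l (length Us)) hm) as k.
    apply (swo_not_lt swoL) in hcc. destruct hcc as [hcc|hcc]; [|rewrite hcc; exact k].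
    exact (swo_trans swoL _ _ _ hcc k). }
  destruct (GE_inv hE hlt) as (s & hs & hr).
  assert (sub : forall s, E s -> exists U0, In U0 (U :: Us) /\ ext U0 S s).
  { intros s0 [(T & hT & ->)|(U0 & hU0 & T & hT & ->)].
    - exists U; split; [left; reflexivity|]. exists T; split; [|reflexivity].
      intros x hx; apply (hT x hx).
    - apply in_map_iff in hU0; destruct hU0 as (U' & <- & hU').
      exists U'; split; [right; exact hU'|]. exists (T ++ [z]); split.
      + intros x hx; apply in_app_or in hx; destruct hx as [hx|[<-|[]]]; [apply (hT x hx)|exact hz].
      + rewrite <- app_assoc; reflexivity. }
  exists s; split; [exact (sub s hs)|].
  apply (GE_sub swoL _) with (2 := hr). intros s0 [k1 k2]; auto.
Qed.

(** * Subsets of a finite antichain *)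

Lemma GE_list (I X : Type) (ltI : I -> I -> Prop) (WI : swo ltI) (i0 : I)
    (R : X -> X -> Prop) (xs : list X) : (forall i, ~ ltI i i0) -> ForallOrdPairs R xs ->
  GE (ltH ltI) R (fun x => In x xs) (single i0 (length xs)).
Proof.
  intros hm h; induction h as [|x xs hx h IH]; [apply GE_zero, WI|].
  constructor; intros c hc. apply (lt_single WI) in hc; destruct hc as [hc1 hc2].
  exists x; split; [left; reflexivity|].
  apply (GE_mono (ltH_swo WI) (fun y => In y xs) (single i0 (length xs))) with (3 := IH).
  - rewrite Forall_forall in hx. intros y hy; split; [right; exact hy|apply hx, hy].
  - intros (z & hz & _). change (at_ (single i0 (length xs)) z < at_ c z) in hz.
    destruct (swo_total WI z i0) as [k|[->|k]].
    + exact (hm z k).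
    + rewrite single_eq in hz; simpl in hc1; lia.
    + rewrite hc2 in hz by exact k; lia.
Qed.

(** Subsets containing the head are listed before those without it, so for distinct elements an
    earlier subset is never included in a later one. *)
Fixpoint pset (X : Type) (l : list X) : list (list X) :=
  match l with
  | nil => [nil]
  | g :: l' => map (cons g) (pset l') ++ pset l'
  end.

Lemma length_pset (X : Type) (l : list X) : length (pset l) = 2 ^ length l.
Proof.
  induction l as [|g l IH]; [reflexivity|]. simpl. rewrite length_app, length_map, IH. lia.
Qed.

Lemma pset_incl (X : Type) (l U : list X) : In U (pset l) -> incl U l.
Proof.
  revert U; induction l as [|g l IH]; intros U hU; simpl in hU.
  - destruct hU as [<-|[]]; intros x [].
  - apply in_app_or in hU; destruct hU as [hU|hU].
    + apply in_map_iff in hU; destruct hU as (U' & <- & hU').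
      intros x [<-|hx]; [left; reflexivity|right; exact (IH U' hU' x hx)].
    + intros x hx; right; exact (IH U hU x hx).
Qed.

Lemma ForallOrdPairs_app (X : Type) (R : X -> X -> Prop) (l l' : list X) :
  ForallOrdPairs R l -> ForallOrdPairs R l' -> (forall x y, In x l -> In y l' -> R x y) ->
  ForallOrdPairs R (l ++ l').
Proof.
  intros h h' hR; induction h as [|x l hx h IH]; simpl; [exact h'|].
  constructor.
  - apply Forall_app; split; [exact hx|]. apply Forall_forall; intros y hy; apply hR; simpl; auto.
  - apply IH; intros y z hy hz; apply hR; simpl; auto.
Qed.

Lemma pset_separated (A : QO) (gs : list A) : ForallOrdPairs (Rinc A) gs ->
  ForallOrdPairs (fun U U' => exists u, In u U /\ forall u', In u' U' -> ~ qle A u u') (pset gs).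
Proof.
  intros h; induction h as [|g gs hg h IH]; simpl.
  - constructor; [constructor|constructor].
  - rewrite Forall_forall in hg. apply ForallOrdPairs_app; [|exact IH|].
    + assert (hin : forall U, In U (pset gs) -> incl U gs) by apply pset_incl.
      induction IH as [|V Vs hV _ IHV]; simpl; constructor.
      * rewrite Forall_forall in *. intros V0 hV0; apply in_map_iff in hV0.
        destruct hV0 as (V' & <- & hV'). destruct (hV V' hV') as (u & hu & u1).
        exists u; split; [right; exact hu|]. intros u' [<-|hu']; [|apply u1, hu'].
        apply (hg u (hin V (or_introl eq_refl) u hu)).
      * apply IHV; intros U hU; apply hin; right; exact hU.
    + intros U U' hU hU'. apply in_map_iff in hU; destruct hU as (V & <- & _).
      exists g; split; [left; reflexivity|]. intros u' hu'. apply (hg u' (@pset_incl _ _ _ hU' _ hu')).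
Qed.

(** * Splitting off the finite part *)

Lemma split_zeros (l : list Ord) :
  (exists k, l = repeat ozero k) \/
  (exists l1 b k, b <> ozero /\ l = l1 ++ b :: repeat ozero k).
Proof.
  induction l as [|b l [[k ->]|(l1 & b' & k & hb & ->)]].
  - left; exists 0; reflexivity.
  - destruct (classic (b = ozero)) as [->|hb].
    + left; exists (S k); reflexivity.
    + right; exists nil, b, k; auto.
  - right; exists (b :: l1), b', k; auto.
Qed.

Lemma hcnf_zeros (k : nat) : hcnf (repeat ozero k) = single ozero k.
Proof.
  induction k as [|k IH]; [reflexivity|]. simpl. rewrite IH. apply single_add.
Qed.

Lemma hcnf_app (l l' : list Ord) : hcnf (l ++ l') = hadd (hcnf l) (hcnf l').
Proof.
  induction l as [|b l IH]; simpl.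
  - rewrite hadd_comm, hadd_0; reflexivity.
  - rewrite IH, hadd_assoc; reflexivity.
Qed.

Lemma ForallOrdPairs_map (X Y : Type) (R : X -> X -> Prop) (R' : Y -> Y -> Prop) (f : X -> Y) (l : list X) :
  (forall x y, R x y -> R' (f x) (f y)) -> ForallOrdPairs R l -> ForallOrdPairs R' (map f l).
Proof.
  intros hf h; induction h as [|x l hx h IH]; simpl; constructor; [|exact IH].
  rewrite Forall_forall in *. intros y hy; apply in_map_iff in hy. destruct hy as (z & <- & hz); auto.
Qed.

Lemma phi_sum_zeros (k : nat) : exists gs : list (phi_sum (repeat ozero k)),
  length gs = k /\ ForallOrdPairs (Rinc _) gs.
Proof.
  induction k as [|k (gs & h1 & h2)]; [exists nil; split; [reflexivity|constructor]|].
  destruct (PhiOmega_spec ozero) as (_ & _ & g & _).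
  destruct (GE_inv g (single_pos olt_swo ozero ozero)) as (x & _ & _).
  exists (inl x :: map inr gs); split; [simpl; rewrite length_map; congruence|].
  constructor.
  - apply Forall_forall; intros y hy; apply in_map_iff in hy; destruct hy as (z & <- & _).
    split; intros h; exact h.
  - refine (@ForallOrdPairs_map _ _ (Rinc _) _ inr gs _ h2); intros y z h; exact h.
Qed.

(** [S] is the union of the infinite blocks and [gs] lists the one-element ones. [Cond] grows from
    the right: the last infinite block starts it, and each further block, with an exponent at least
    as large, is added in full. *)
Lemma phi_sum_split (l1 : list Ord) (b : Ord) (k : nat) : b <> ozero ->
  desc (l1 ++ b :: repeat ozero k) ->
  exists (S : phi_sum (l1 ++ b :: repeat ozero k) -> Prop) (gs : list (phi_sum (l1 ++ b :: repeat ozero k))),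
    length gs = k /\ ForallOrdPairs (Rinc _) gs /\
    (forall g x, In g gs -> S x -> Rinc _ g x) /\
    (forall j, Cond ltO _ (hcnf (l1 ++ [b])) j S).
Proof.
  intros hb; induction l1 as [|b0 l1 IH]; intros hd.
  - destruct (phi_sum_zeros k) as (gs & h1 & h2).
    exists (@dset (PhiOmega b) (phi_sum (repeat ozero k)) full (fun _ => False)), (map inr gs).
    split; [rewrite length_map; exact h1|split; [|split]].
    + refine (@ForallOrdPairs_map _ _ (Rinc _) _ inr gs _ h2); intros y z h; exact h.
    + intros g [x|x] hg hx; [|destruct hx].
      apply in_map_iff in hg; destruct hg as (z & <- & _). split; intros h; exact h.
    + intros j. simpl hcnf. rewrite hadd_0. apply Cond_inl. apply PhiOmega_spec, hb.
  - inversion hd as [|? ? hd' hf]; subst. rewrite Forall_forall in hf.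
    destruct (IH hd') as (S & gs & h1 & h2 & h3 & h4).
    exists (@dset (PhiOmega b0) (phi_sum (l1 ++ b :: repeat ozero k)) full S), (map inr gs).
    split; [rewrite length_map; exact h1|split; [|split]].
    + refine (@ForallOrdPairs_map _ _ (Rinc _) _ inr gs _ h2); intros y z h; exact h.
    + intros g [x|x] hg hx; apply in_map_iff in hg; destruct hg as (z & <- & hz).
      * split; intros h; exact h.
      * exact (h3 z x hz hx).
    + intros j. simpl hcnf. apply Cond_dunion; [apply PhiOmega_spec| | |apply h4].
      * intros y hy. apply hcnf_supp in hy. apply ole_not_lt, hf.
        apply in_app_or in hy; apply in_or_app; simpl; destruct hy as [hy|[<-|[]]]; auto.
      * destruct (swo_total swoO (single ozero 0) (hcnf (l1 ++ [b]))) as [c|[c|c]]; [exact c| |].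
        -- assert (e : at_ (hcnf (l1 ++ [b])) b <> 0) by (apply hcnf_supp, in_or_app; simpl; auto).
           rewrite <- c, single_0_at in e; tauto.
        -- destruct (not_lt_single_0 olt_swo c).
Qed.

Lemma Pf_Phi_infinite (a : Ord) (l1 : list Ord) (b : Ord) (k : nat) :
  b <> ozero -> cnf a = l1 ++ b :: repeat ozero k ->
  oRank (Pf (Phi a)) (pow2 a) /\ wRank (Pf (Phi a)) (pow2 a).
Proof.
  intros hb e. pose proof (bis_cnf a) as ha. pose proof (cnf_desc (cnf_spec a)) as hd.
  rewrite e in ha, hd.
  set (v := hcnf (l1 ++ [b])).
  assert (ev : hcnf (l1 ++ b :: repeat ozero k) = hadd v (single ozero k)).
  { change (l1 ++ b :: repeat ozero k) with (l1 ++ [b] ++ repeat ozero k).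
    rewrite app_assoc, hcnf_app, hcnf_zeros; reflexivity. }
  assert (vb : at_ v b <> 0) by (apply hcnf_supp, in_or_app; simpl; auto).
  assert (v0 : at_ v ozero = 0).
  { apply NNPP; intros n. apply hcnf_supp in n. apply in_app_or in n.
    destruct n as [n|[n|[]]]; [|exact (hb n)].
    assert (o : ole b ozero).
    { clear - hd n. induction l1 as [|c l1 IH]; [destruct n|].
      inversion hd as [|? ? hd' hf]; subst. destruct n as [->|n]; [|exact (IH hd' n)].
      rewrite Forall_forall in hf. apply hf, in_or_app; simpl; auto. }
    destruct o as [o|o]; [exact (ozero_le o)|exact (hb o)]. }
  rewrite ev in ha.
  assert (hm : exists m, bis ltO olt v m).
  { destruct k as [|k].
    - rewrite hadd_0 in ha; exists a; exact ha.
    - assert (hlt : ltO v (hadd v (single ozero (S k)))).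
      { rewrite <- (hadd_0 v ozero) at 1. apply hadd_mono_r, (single_mono olt_swo); lia. }
      destruct (bis_fwd ha _ hlt) as (m & _ & hm). exists m; exact hm. }
  destruct hm as [m hm].
  (* If [m] were a successor, its normal form would contain omega^0, against [v0]. *)
  assert (hmL : forall c, m <> osucc c).
  { intros c ->. destruct (bis_bwd hm _ (olt_osucc c)) as (u & _ & hu).
    pose proof (bis_inj swoO olt_swo hm (bis_osucc hu)) as ee.
    rewrite ee, hadd_at, single_eq in v0; lia. }
  set (l := exist _ m hmL : Lim).
  assert (ea : a = osn k (proj1_sig l)).
  { exact (bis_HO_uniq ha (bis_osn k hm)). }
  assert (hl0 : ltL L0 l).
  { apply ozero_lt. apply (bis_pos (x := ozero) hm).
    destruct (swo_total swoO (single ozero 0) v) as [c|[c|c]]; [exact c| |].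
    - rewrite <- c, single_0_at in vb; tauto.
    - destruct (not_lt_single_0 olt_swo c). }
  apply ranks_eq.
  - replace (pow2 a) with (pow2 (osn k (proj1_sig l))) by (rewrite <- ea; reflexivity).
    apply (LE_bis swoL (bis_pow2 l k)). apply (Pf_LE swoL).
    apply (LE_sub swoL (sublists (Phi a) full)); [intros s _ x _; exact Logic.I|].
    apply powerset_LE; [apply phi_sum_trans|]. rewrite <- ea.
    exact (LE_bis swoO (bis_cnf a) (phi_sum_LE (cnf a))).
  - replace (pow2 a) with (pow2 (osn k (proj1_sig l))) by (rewrite <- ea; reflexivity).
    apply (GE_bis swoL (bis_pow2 l k)).
    unfold Phi; fold (phi_sum (cnf a)). rewrite e.
    destruct (phi_sum_split l1 k hb hd) as (S & gs & h1 & h2 & h3 & h4).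
    replace (2 ^ k) with (length (pset gs)) by (rewrite length_pset, h1; reflexivity).
    apply (@Pf_GE _ _ swoL _ Rinc (fun s => exists U, In U (pset gs) /\ ext U S s) _ (or_intror eq_refl)).
    apply powerset_copies_GE.
    + exact hl0.
    + exact (@Cond_bis _ _ _ _ swoO _ _ _ _ _ hm (h4 _)).
    + intros U hU x u hx hu. apply (h3 u x (@pset_incl _ _ _ hU u hu) hx).
    + assert (hin : forall U, In U (pset gs) -> incl U gs) by apply pset_incl.
      pose proof (pset_separated h2) as hs. revert hin.
      induction hs as [|V Vs hV _ IHV]; intros hin; constructor.
      * rewrite Forall_forall in *. intros V' hV'. destruct (hV V' hV') as (u & hu & u1).
        exists u; split; [exact hu|split; [exact u1|]].
        intros x hx. apply (h3 u x (hin V (or_introl eq_refl) u hu) hx).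
      * apply IHV; intros U hU; apply hin; right; exact hU.
Qed.

(** * The finite case *)

Lemma cnf_ordnat (k : nat) : cnf (ordnat k) = repeat ozero k.
Proof.
  pose proof (bis_inj swoO olt_swo (bis_cnf (ordnat k)) (bis_ordnat _ k olt_swo ozero_le)) as e.
  destruct (split_zeros (cnf (ordnat k))) as [[m em]|(l1 & b & m & hb & em)]; rewrite em in *.
  - rewrite hcnf_zeros in e. apply (f_equal (fun h => at_ h ozero)) in e.
    rewrite !single_eq in e; subst m; reflexivity.
  - assert (n : at_ (hcnf (l1 ++ b :: repeat ozero m)) b <> 0).
    { apply hcnf_supp, in_or_app; simpl; auto. }
    rewrite e, (single_neq k hb) in n; tauto.
Qed.

Lemma ordnat_osn (k : nat) : ordnat k = osn k (proj1_sig L0).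
Proof.
  pose proof (bis_osn k bis_ozero) as h. rewrite hadd_comm, hadd_0 in h.
  exact (bis_HO_uniq (bis_ordnat _ k olt_swo ozero_le) h).
Qed.

Lemma Pf_Phi_finite_LE (k : nat) :
  LE olt (Rbad (Pf (Phi (ordnat k)))) full (ordnat (2 ^ k)).
Proof.
  apply (LE_bis swoL (bis_ordnat _ (2 ^ k) ltL_swo L0_least)). apply (Pf_LE swoL).
  apply (LE_sub swoL (sublists (Phi (ordnat k)) full)); [intros s _ x _; exact Logic.I|].
  apply powerset_LE; [apply phi_sum_trans|]. rewrite <- ordnat_osn.
  exact (LE_bis swoO (bis_cnf _) (phi_sum_LE _)).
Qed.

(** Listed so that none is below a later one, the subsets of the [k] isolated points form a bad
    sequence of length 2^k. Inclusions among them are why the width is treated separately. *)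
Lemma Pf_Phi_finite_GE (k : nat) :
  GE olt (Rbad (Pf (Phi (ordnat k)))) full (ordnat (2 ^ k)).
Proof.
  apply (GE_bis swoL (bis_ordnat _ (2 ^ k) ltL_swo L0_least)).
  unfold Phi; fold (phi_sum (cnf (ordnat k))). rewrite cnf_ordnat.
  destruct (phi_sum_zeros k) as (gs & h1 & h2). replace (2 ^ k) with (length (pset gs)) by (rewrite length_pset, h1; reflexivity).
  apply (@Pf_GE _ _ swoL _ Rbad (fun s => In s (pset gs)) _ (or_introl eq_refl)).
  apply (GE_list ltL_swo); [exact L0_least|].
  pose proof (pset_separated h2) as hs. induction hs as [|V Vs hV _ IHV]; constructor; [|exact IHV].
  rewrite Forall_forall in *. intros V' hV' c. destruct (hV V' hV') as (u & hu & u1).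
  destruct (c u hu) as (w & hw & huw). exact (u1 w hw huw).
Qed.

(** * Width of the powerset of a finite antichain *)

Definition embeds (A B : QO) : Prop :=
  exists f : A -> B, forall x y, qle A x y <-> qle B (f x) (f y).

(** Taking images under an embedding reflects the Hoare order, hence keeps incomparable sets
    incomparable. *)
Lemma embeds_Pf_LE (A B : QO) (c : Ord) : embeds A B ->
  LE olt (Rinc (Pf B)) full c -> LE olt (Rinc (Pf A)) full c.
Proof.
  intros [f hf]. destruct (pf_enum A) as [e he].
  assert (key : forall s s' : Pf A, qle (Pf B) (pf_of_list B (map f (e s))) (pf_of_list B (map f (e s'))) ->
                qle (Pf A) s s').
  { intros s s' k x hx. destruct (k (f x)) as (y & hy & l).
    - simpl. apply in_map, he, hx.
    - simpl in hy. apply in_map_iff in hy; destruct hy as (z & <- & hz).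
      exists z; split; [apply he, hz|apply hf, l]. }
  apply (LE_map olt_swo (fun s => pf_of_list B (map f (e s)))); auto.
  - intros s s' _ _ [h1 h2]; split; intros k; [apply h1|apply h2]; apply key, k.
  - apply olt_irrefl.
Qed.

Lemma PhiOmega_0 : PhiOmega ozero = Gamma 1.
Proof.
  rewrite PhiOmega_eq; unfold PhiOmega_body.
  pose proof (bis_inj swoO olt_swo (bis_cnf ozero) bis_ozero) as e.
  destruct (cnf ozero) as [|b l]; [reflexivity|].
  assert (n : at_ (hcnf (b :: l)) b <> 0) by (apply hcnf_supp; simpl; auto).
  rewrite e, single_0_at in n; tauto.
Qed.

Lemma sig_lt_eq (k : nat) (x y : {n : nat | n < k}) : proj1_sig x = proj1_sig y <-> x = y.
Proof.
  split; [|intros ->; reflexivity].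
  intros e; apply eq_sig_hprop; [intros; apply proof_irrelevance|exact e].
Qed.

Lemma gamma_embeds (k : nat) :
  embeds (Gamma k) (phi_sum (repeat ozero k)) /\ embeds (phi_sum (repeat ozero k)) (Gamma k).
Proof.
  induction k as [|k [[f hf] [g hg]]].
  - split.
    + exists (fun x : Gamma 0 => match Nat.nlt_0_r _ (proj2_sig x) with end).
      intros [x hx]; lia.
    + exists (fun x : Empty_set => match x with end). intros [].
  - change (phi_sum (repeat ozero (S k))) with (DUnion (PhiOmega ozero) (phi_sum (repeat ozero k))).
    rewrite PhiOmega_0. split.
    + exists (fun x : Gamma (S k) =>
        match lt_dec (proj1_sig x) k with
        | left h => inr (f (exist (fun n => n < k) (proj1_sig x) h))
        | right _ => inl (exist (fun n => n < 1) 0 Nat.lt_0_1)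
        end).
      intros [x hx] [y hy]; simpl. rewrite <- sig_lt_eq; simpl.
      destruct (lt_dec x k) as [h|h], (lt_dec y k) as [h'|h']; simpl.
      * rewrite <- hf; simpl. rewrite <- sig_lt_eq; simpl; tauto.
      * split; [lia|tauto].
      * split; [lia|tauto].
      * split; [reflexivity|lia].
    + exists (fun x : DUnion (Gamma 1) (phi_sum (repeat ozero k)) =>
        match x with
        | inl _ => exist (fun n => n < S k) k (Nat.lt_succ_diag_r k)
        | inr z => exist (fun n => n < S k) (proj1_sig (g z))
                     (Nat.lt_lt_succ_r _ _ (proj2_sig (g z)))
        end).
      intros [[x hx]|x] [[y hy]|y]; simpl; rewrite <- !sig_lt_eq; simpl.
      * split; lia.
      * destruct (g y) as [n hn]; simpl; split; [tauto|lia].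
      * destruct (g x) as [n hn]; simpl; split; [tauto|lia].
      * rewrite hg; simpl. rewrite <- sig_lt_eq; tauto.
Qed.

(** No value is computed. [Phi (ordnat k)] is a nested union of [k] one-element blocks; it and
    [Gamma k] embed into each other, so the widths of the two powersets have the same upper bounds
    and are equal. *)
Lemma Pf_Phi_finite_w (k : nat) :
  exists g, wRank (Pf (Phi (ordnat k))) g /\ wRank (Pf (Gamma k)) g.
Proof.
  assert (h1 : LE olt (Rinc (Pf (Phi (ordnat k)))) full (ordnat (2 ^ k))).
  { apply (LE_map olt_swo (fun x => x)) with (4 := Pf_Phi_finite_LE k); auto.
    - intros x y _ _ [h _]; exact h.
    - apply olt_irrefl. }
  unfold Phi in *; fold (phi_sum (cnf (ordnat k))) in *. rewrite cnf_ordnat in *.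
  destruct (gamma_embeds k) as [e1 e2].
  pose proof (embeds_Pf_LE e1 h1) as h2.
  destruct (rank_exists _ _ (antichain_nil _) (@antichain_snoc _) h1) as (g1 & r1 & c1).
  destruct (rank_exists _ _ (antichain_nil _) (@antichain_snoc _) h2) as (g2 & r2 & c2).
  exists g1; split; [exact r1|]. replace g1 with g2; [exact r2|].
  assert (k1 : ~ olt g1 g2).
  { apply c2, (embeds_Pf_LE e1), c1, olt_irrefl. }
  assert (k2 : ~ olt g2 g1).
  { apply c1, (embeds_Pf_LE e2), c2, olt_irrefl. }
  destruct (olt_total g1 g2) as [c|[c|c]]; [tauto|auto|tauto].
Qed.

Theorem mainTheorem10 :
  forall a : Ord,
    oRank (Phi a) a /\ wRank (Phi a) a /\
    ((forall k : nat, a <> ordnat k) ->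
       wRank (Pf (Phi a)) (pow2 a) /\ oRank (Pf (Phi a)) (pow2 a)) /\
    (forall k : nat, a = ordnat k ->
       oRank (Pf (Phi a)) (ordnat (Nat.pow 2 k)) /\
       exists g : Ord, wRank (Pf (Phi a)) g /\ wRank (Pf (Gamma k)) g).
Proof.
  intros a. destruct (Phi_ranks a) as [ho hw].
  split; [exact ho|split; [exact hw|split]].
  - intros hinf. destruct (split_zeros (cnf a)) as [[k e]|(l1 & b & k & hb & e)].
    + destruct (hinf k). pose proof (bis_cnf a) as ha. rewrite e, hcnf_zeros in ha.
      exact (bis_HO_uniq ha (bis_ordnat _ k olt_swo ozero_le)).
    + apply and_comm, (Pf_Phi_infinite _ _ _ hb e).
  - intros k ->. split; [|apply Pf_Phi_finite_w].
    apply oRank_eq; [apply Pf_Phi_finite_LE|apply Pf_Phi_finite_GE].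
Qed.
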